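(* Let $\mathcal{A}$ be the operator of multiplication by the independent variable $z$ in $H=L^2(\nu)$, $\nu=\sum_n \nu_n\delta_{s_n}$, let $\mathcal{A}$ belong to the Schatten class $\mathfrak{S}_p$ for some $p>0$, let $t_n=s_n^{-1}$, let $a=(a_n), b=(b_n)\in L^2(\nu)$ and let $\mathcal{L}=\mathcal{A}+a\otimes b$ be the corresponding rank one perturbation of $\mathcal{A}$. 1. Assume that $\sum_n |a_n b_n t_n|\nu_n<\infty$ and $$\sum_n a_n\bar b_n t_n\nu_n\ne -1.$$ Then both $\mathcal{L}$ and $\mathcal{L}^*$ are complete. 2. Assume that there exists $N\in\mathbb{N}$ such that $\sum_n |a_nb_n||t_n|^{N+1}\nu_n<\infty$ and $$\sum_n a_n\bar b_n t_n\nu_n=-1,\qquad \sum_n a_n\bar b_n t_n^k\nu_n=0\ \ (k=2,\dots,N),\qquad \sum_n a_n\bar b_n t_n^{N+1}\nu_n\ne 0.$$ Then $\dim\big(\mathcal{E}(\mathcal{L})\big)^\perp\le N$ and $\dim\big(\mathcal{E}(\mathcal{L}^* )\big)^\perp\le N$. 3. Suppose the hypotheses of part 2 hold. If $b\notin' zL^2(\nu)$, then $\mathcal{L}$ is complete. If $a\notin' zL^2(\nu)$, then $\mathcal{L}^*$ is complete.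
   Context: Setting: $\{s_n\}\subset\mathbb{C}\setminus\{0\}$ is an infinite sequence of distinct points with $s_n\to0$, $\nu_n>0$, and $\nu=\sum_n\nu_n\delta_{s_n}$ is a finite measure; multiplication by $z$ in $L^2(\nu)$ is then a cyclic compact normal operator with simple point spectrum $\{s_n\}$. Elements $a\in L^2(\nu)$ are identified with sequences $a=(a_n)$, $a_n=a(s_n)$. The operator is in $\mathfrak{S}_p$ iff $\sum_n|s_n|^p<\infty$. The rank one perturbation is $\mathcal{L}x=\mathcal{A}x+(x,b)a$, $x\in H$. For a bounded operator $\mathcal{U}$, generalized eigenvectors are elements of $\ker(\mathcal{U}-\lambda I)^m$, $\lambda\in\mathbb{C}$, $m\in\mathbb{N}$; $\mathcal{E}(\mathcal{U})$ is the closed linear span of all generalized eigenvectors of $\mathcal{U}$, and $\mathcal{U}$ is called complete if $\mathcal{E}(\mathcal{U})=H$. Notation: $a\in' zL^2(\nu)$ means $\sum_{n:\,b_n\ne0}|a_n|^2|t_n|^2\nu_n<\infty$; $b\in' zL^2(\nu)$ means $\sum_{n:\,a_n\ne0}|b_n|^2|t_n|^2\nu_n<\infty$; $\notin'$ is the negation. *)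

(* Defs.v *)
From Stdlib Require Import Reals Lra Lia List.
From Coquelicot Require Import Coquelicot.
Open Scope R_scope.

(** L^2(nu) for nu = sum_n nu_n delta_{s_n}: the points [s n] are distinct and carry positive mass, so a class of
    functions in L^2(nu) is the sequence [x : nat -> C] of its values
    [x n = x(s_n)].  H = L^2(nu) is the set of sequences satisfying [L2 nu];
    operators are maps on sequences, of which only the action on H matters. *)

Definition L2 (nu : nat -> R) (x : nat -> C) : Prop :=
  ex_series (fun n => Cmod (x n) ^ 2 * nu n).

Definition L2norm (nu : nat -> R) (x : nat -> C) : R :=
  sqrt (Series (fun n => Cmod (x n) ^ 2 * nu n)).

(** [Series] is real-valued and total; [CSeries u] is the sum of [u] as soon as
    the complex series converges (see [is_series_CSeries]). *)
Definition CSeries (u : nat -> C) : C :=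
  (Series (fun n => Re (u n)), Series (fun n => Im (u n))).

(** Linear in the first argument. *)
Definition inner (nu : nat -> R) (x y : nat -> C) : C :=
  CSeries (fun n => (x n * Cconj (y n) * nu n)%C).

Definition maps_L2 (nu : nat -> R) (U : (nat -> C) -> (nat -> C)) : Prop :=
  forall x, L2 nu x -> L2 nu (U x).

(** [V] is the Hilbert space adjoint of [U] on L^2(nu). *)
Definition is_adjoint (nu : nat -> R) (U V : (nat -> C) -> (nat -> C)) : Prop :=
  maps_L2 nu V /\
  forall x y, L2 nu x -> L2 nu y -> inner nu (U x) y = inner nu x (V y).

Definition mul_op (s : nat -> C) (x : nat -> C) : nat -> C :=
  fun n => (s n * x n)%C.

(** [rank_one nu a b] is a (x) b : x |-> (x, b) a. *)
Definition rank_one (nu : nat -> R) (a b x : nat -> C) : nat -> C :=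
  fun n => (inner nu x b * a n)%C.

Definition rank_one_perturbation (nu : nat -> R) (s a b x : nat -> C) : nat -> C :=
  fun n => (mul_op s x n + rank_one nu a b x n)%C.

(** [mul_op s] is normal with an orthogonal basis of eigenvectors and
    eigenvalues [s n], so its singular values are the [Cmod (s n)], and it
    belongs to the Schatten class S_p iff they are p-summable.
    [Rpower] is the intended power because [s n <> 0]. *)
Definition mul_op_in_Schatten (s : nat -> C) (p : R) : Prop :=
  ex_series (fun n => Rpower (Cmod (s n)) p).

Definition lin_comb (l : list (C * (nat -> C))) : nat -> C :=
  fun n => fold_right (fun cv acc => (fst cv * snd cv n + acc)%C) (RtoC 0) l.

Definition span (P : (nat -> C) -> Prop) (x : nat -> C) : Prop :=
  exists l : list (C * (nat -> C)),
    List.Forall (fun cv => P (snd cv)) l /\ forall n, x n = lin_comb l n.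

Definition closed_span (nu : nat -> R) (P : (nat -> C) -> Prop) (x : nat -> C) : Prop :=
  L2 nu x /\
  forall eps : R, 0 < eps ->
    exists y, span P y /\ L2norm nu (fun n => x n - y n)%C < eps.

Definition orthogonal_complement (nu : nat -> R) (P : (nat -> C) -> Prop)
    (x : nat -> C) : Prop :=
  L2 nu x /\ forall y, P y -> inner nu x y = RtoC 0.

(** For a linear subspace [P]. *)
Definition dim_le (P : (nat -> C) -> Prop) (N : nat) : Prop :=
  exists vs : list (nat -> C),
    (length vs <= N)%nat /\ List.Forall P vs /\
    forall x, P x -> span (fun v => In v vs) x.

(** Elements of ker (U - lambda I)^m for some lambda and m. *)
Definition generalized_eigenvector (nu : nat -> R) (U : (nat -> C) -> (nat -> C))
    (x : nat -> C) : Prop :=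
  L2 nu x /\
  exists (lambda : C) (m : nat), forall n,
    Nat.iter m (fun (y : nat -> C) k => (U y k - lambda * y k)%C) x n = RtoC 0.

Definition eigen_closure (nu : nat -> R) (U : (nat -> C) -> (nat -> C)) :
    (nat -> C) -> Prop :=
  closed_span nu (generalized_eigenvector nu U).

Definition complete (nu : nat -> R) (U : (nat -> C) -> (nat -> C)) : Prop :=
  forall x, L2 nu x -> eigen_closure nu U x.

(** x in' z L^2(nu) relative to [c]: sum over { n : c_n <> 0 } of
    |x_n|^2 |t_n|^2 nu_n, with t_n = 1/s_n, is finite. *)
Definition in_zL2' (nu : nat -> R) (s c x : nat -> C) : Prop :=
  ex_series (fun n =>
    if Ceq_dec (c n) (RtoC 0) then 0
    else Cmod (x n) ^ 2 * Cmod (/ s n)%C ^ 2 * nu n).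

(** In the moments, [/ s n] is t_n. *)
Definition abs_moment_finite (nu : nat -> R) (s a b : nat -> C) (k : nat) : Prop :=
  ex_series (fun n => Cmod (a n * b n)%C * Cmod (/ s n)%C ^ k * nu n).

Definition moment (nu : nat -> R) (s a b : nat -> C) (k : nat) : C :=
  CSeries (fun n => (a n * Cconj (b n) * (/ s n) ^ k * nu n)%C).

Definition degenerate_moments (nu : nat -> R) (s a b : nat -> C) (N : nat) : Prop :=
  abs_moment_finite nu s a b (N + 1) /\
  moment nu s a b 1 = RtoC (-1) /\
  (forall k, (2 <= k <= N)%nat -> moment nu s a b k = RtoC 0) /\
  moment nu s a b (N + 1) <> RtoC 0.

Lemma Re_sum_n (u : nat -> C) n :
  sum_n u n = (sum_n (fun k => Re (u k)) n, sum_n (fun k => Im (u k)) n).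
Proof.
induction n as [|n IH].
- rewrite !sum_O. destruct (u O); reflexivity.
- rewrite !sum_Sn, IH. destruct (u (S n)); reflexivity.
Qed.

Lemma is_series_CSeries (u : nat -> C) (l : C) : is_series u l -> CSeries u = l.
Proof.
intros H. unfold is_series in H.
destruct l as [p q]. unfold CSeries. f_equal.
- apply is_series_unique. intros P HP.
  assert (Hl : locally (p, q) (fun z : C => P (fst z))).
  { destruct HP as [e He]. exists e. intros z [Hz _]. apply He, Hz. }
  specialize (H _ Hl). unfold filtermap in *.
  destruct H as [n0 H]. exists n0. intros n Hn. specialize (H n Hn).
  rewrite Re_sum_n in H. exact H.
- apply is_series_unique. intros P HP.
  assert (Hl : locally (p, q) (fun z : C => P (snd z))).
  { destruct HP as [e He]. exists e. intros z [_ Hz]. apply He, Hz. }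
  specialize (H _ Hl). unfold filtermap in *.
  destruct H as [n0 H]. exists n0. intros n Hn. specialize (H n Hn).
  rewrite Re_sum_n in H. exact H.
Qed.

Lemma im_le_Cmod (c : C) : Rabs (Im c) <= Cmod c.
Proof.
rewrite <- (sqrt_Rsqr (Rabs (Im c))) by apply Rabs_pos.
rewrite <- Rsqr_abs. unfold Cmod. apply sqrt_le_1_alt.
unfold Rsqr, Im. pose proof (pow2_ge_0 (fst c)). nra.
Qed.

Lemma ex_series_Re (u : nat -> C) :
  ex_series (fun n => Cmod (u n)) -> ex_series (fun n => Re (u n)).
Proof.
intros H. apply (ex_series_le (V := R_CompleteNormedModule)) with (2 := H).
intros n. apply re_le_Cmod.
Qed.

Lemma ex_series_Im (u : nat -> C) :
  ex_series (fun n => Cmod (u n)) -> ex_series (fun n => Im (u n)).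
Proof.
intros H. apply (ex_series_le (V := R_CompleteNormedModule)) with (2 := H).
intros n. apply im_le_Cmod.
Qed.

Lemma ex_series_Rscal (k : R) (u : nat -> R) :
  ex_series u -> ex_series (fun n => k * u n).
Proof. exact (ex_series_scal (K := R_AbsRing) (V := R_NormedModule) k u). Qed.

Lemma ex_series_Rext (u v : nat -> R) :
  (forall n, u n = v n) -> ex_series u -> ex_series v.
Proof. exact (ex_series_ext u v). Qed.

Lemma CSeries_ext u v : (forall n, u n = v n) -> CSeries u = CSeries v.
Proof.
intros H. unfold CSeries. f_equal; apply Series_ext; intros n; now rewrite H.
Qed.

Lemma CSeries_plus u v :
  ex_series (fun n => Cmod (u n)) -> ex_series (fun n => Cmod (v n)) ->
  CSeries (fun n => u n + v n)%C = (CSeries u + CSeries v)%C.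
Proof.
intros Hu Hv. unfold CSeries, Cplus. simpl. f_equal; rewrite <- Series_plus;
  auto using ex_series_Re, ex_series_Im.
Qed.

Lemma CSeries_scal c u :
  ex_series (fun n => Cmod (u n)) ->
  CSeries (fun n => c * u n)%C = (c * CSeries u)%C.
Proof.
intros Hu. pose proof (ex_series_Re _ Hu). pose proof (ex_series_Im _ Hu).
assert (HR : forall k, ex_series (fun n => k * Re (u n)))
  by (intros; now apply ex_series_Rscal).
assert (HI : forall k, ex_series (fun n => k * Im (u n)))
  by (intros; now apply ex_series_Rscal).
unfold CSeries, Cmult. simpl. f_equal.
- rewrite <- !Series_scal_l, <- Series_minus by auto. now apply Series_ext.
- rewrite <- !Series_scal_l, <- Series_plus by auto. now apply Series_ext.
Qed.

Lemma CSeries_conj u : CSeries (fun n => Cconj (u n)) = Cconj (CSeries u).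
Proof.
unfold CSeries, Cconj. simpl. f_equal.
replace (- Series (fun n => Im (u n))) with ((-1) * Series (fun n => Im (u n))) by ring.
rewrite <- Series_scal_l. apply Series_ext. intros n. simpl. unfold Im. ring.
Qed.

Lemma L2_scal nu c x : L2 nu x -> L2 nu (fun n => c * x n)%C.
Proof.
intros H. unfold L2.
apply ex_series_Rext with (fun n => Cmod c ^ 2 * (Cmod (x n) ^ 2 * nu n)).
- intros n. rewrite Cmod_mult. ring.
- now apply ex_series_Rscal.
Qed.

Lemma L2_plus nu x y : (forall n, 0 < nu n) ->
  L2 nu x -> L2 nu y -> L2 nu (fun n => x n + y n)%C.
Proof.
intros Hnu Hx Hy.
apply (ex_series_le (V := R_CompleteNormedModule)) with
  (b := fun n => 2 * (Cmod (x n) ^ 2 * nu n + Cmod (y n) ^ 2 * nu n)).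
- intros n. specialize (Hnu n). change norm with Rabs.
  rewrite Rabs_pos_eq by (apply Rmult_le_pos; [apply pow2_ge_0 | lra]).
  replace (2 * _) with ((2 * (Cmod (x n) ^ 2 + Cmod (y n) ^ 2)) * nu n) by ring.
  apply Rmult_le_compat_r; [lra|].
  pose proof (Cmod_triangle (x n) (y n)). pose proof (Cmod_ge_0 (x n + y n)).
  pose proof (pow2_ge_0 (Cmod (x n) - Cmod (y n))). nra.
- apply ex_series_Rscal.
  now apply (ex_series_plus (K := R_AbsRing) (V := R_NormedModule)).
Qed.

Lemma L2_mul nu s x : (forall n, 0 < nu n) ->
  (exists M, forall n, Cmod (s n) <= M) -> L2 nu x -> L2 nu (mul_op s x).
Proof.
intros Hnu [M HM] Hx.
apply (ex_series_le (V := R_CompleteNormedModule)) with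
  (b := fun n => M ^ 2 * (Cmod (x n) ^ 2 * nu n)).
- intros n. specialize (Hnu n). change norm with Rabs.
  rewrite Rabs_pos_eq by (apply Rmult_le_pos; [apply pow2_ge_0 | lra]).
  unfold mul_op. rewrite Cmod_mult, Rpow_mult_distr, <- Rmult_assoc.
  apply Rmult_le_compat_r; [lra|].
  apply Rmult_le_compat_r; [apply pow2_ge_0|].
  apply pow_incr. split; [apply Cmod_ge_0 | apply HM].
- now apply ex_series_Rscal.
Qed.

Lemma inner_abs nu x y : (forall n, 0 < nu n) -> L2 nu x -> L2 nu y ->
  ex_series (fun n => Cmod (x n * Cconj (y n) * nu n)%C).
Proof.
intros Hnu Hx Hy.
apply (ex_series_le (V := R_CompleteNormedModule)) with
  (b := fun n => Cmod (x n) ^ 2 * nu n + Cmod (y n) ^ 2 * nu n).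
- intros n. specialize (Hnu n). change norm with Rabs.
  rewrite Rabs_pos_eq by apply Cmod_ge_0.
  rewrite !Cmod_mult, Cmod_conj, Cmod_R, (Rabs_pos_eq (nu n)) by lra.
  rewrite <- Rmult_plus_distr_r. apply Rmult_le_compat_r; [lra|].
  pose proof (Cmod_ge_0 (x n)). pose proof (Cmod_ge_0 (y n)).
  pose proof (pow2_ge_0 (Cmod (x n) - Cmod (y n))). nra.
- now apply (ex_series_plus (K := R_AbsRing) (V := R_NormedModule)).
Qed.

Lemma inner_conj nu x y : inner nu y x = Cconj (inner nu x y).
Proof.
unfold inner. rewrite <- CSeries_conj. apply CSeries_ext. intros n.
rewrite !Cmult_conj, Cconj_conj.
replace (Cconj (nu n)) with (RtoC (nu n)) by (unfold Cconj, RtoC; simpl; f_equal; ring).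
ring.
Qed.

Lemma maps_L2_rank_one_perturbation nu s a b : (forall n, 0 < nu n) ->
  (exists M, forall n, Cmod (s n) <= M) -> L2 nu a ->
  maps_L2 nu (rank_one_perturbation nu s a b).
Proof.
intros Hnu Hs Ha x Hx. apply L2_plus; auto using L2_mul.
now apply L2_scal.
Qed.

(** An adjoint exists: it is A^* + b (x) a. *)
Lemma is_adjoint_rank_one_perturbation nu s a b : (forall n, 0 < nu n) ->
  (exists M, forall n, Cmod (s n) <= M) -> L2 nu a -> L2 nu b ->
  is_adjoint nu (rank_one_perturbation nu s a b)
    (rank_one_perturbation nu (fun n => Cconj (s n)) b a).
Proof.
intros Hnu Hs Ha Hb. split.
- apply maps_L2_rank_one_perturbation; auto.
  destruct Hs as [M HM]. exists M. intros n. now rewrite Cmod_conj.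
- intros x y Hx Hy.
  pose proof (inner_abs _ _ _ Hnu (L2_mul _ _ _ Hnu Hs Hx) Hy) as H1.
  pose proof (inner_abs _ _ _ Hnu Ha Hy) as H2.
  pose proof (inner_abs _ _ _ Hnu Hx Hb) as H3.
  assert (Hsc : forall (c : C) u, ex_series (fun n => Cmod (u n)) ->
            ex_series (fun n => Cmod (c * u n)%C)).
  { intros c u Hu. apply ex_series_Rext with (fun n => Cmod c * Cmod (u n)).
    - intros n. now rewrite Cmod_mult.
    - now apply ex_series_Rscal. }
  transitivity (inner nu (mul_op s x) y + inner nu x b * inner nu a y)%C.
  + unfold inner at 2 4. rewrite <- CSeries_scal, <- CSeries_plus by auto.
    apply CSeries_ext. intros n. unfold rank_one_perturbation, rank_one. ring.
  + rewrite (inner_conj nu y a), Cmult_comm. unfold inner at 1 3.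
    rewrite <- CSeries_scal, <- CSeries_plus by auto.
    apply CSeries_ext. intros n. unfold rank_one_perturbation, rank_one, mul_op.
    rewrite Cplus_conj, !Cmult_conj, Cconj_conj. ring.
Qed.

(* Main.v *)
Require Import Defs.
From Stdlib Require Import Reals Arith Lra Lia List Classical ClassicalEpsilon.
From Stdlib Require Import FunctionalExtensionality PropExtensionality.
From Coquelicot Require Import Coquelicot.
Open Scope R_scope.

(** Let [c n = a n * Cconj (b n) * nu n].  The root vectors of the perturbation
    [L] are governed by the determinant [phi z = 1 - z * sum_n c n / (1 - z * s n)],
    where [z] is the inverse of the spectral parameter.  A vector [x] orthogonal
    to all root vectors is encoded in the function
    [h z = z * (sum_n a n * Cconj (x n) * nu n / (1 - z * s n)) / phi z],
    which is [z] times the inner product of [(1 - z L)^-1 a] with [x].  By the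
    projection theorem ([closed_span_total]) the question is how many such [x]
    there are.

    First, [h] is entire ([entire_extension]).  At a zero of [phi] of order [m]
    the vectors [a * s ^ j / (1 - z0 * s) ^ (j + 1)], [j < m], form a Jordan chain
    of [L], and their inner products with [x] are the Taylor coefficients of the
    numerator; so the numerator vanishes to order [m] as well.  Moreover
    [h (/ s n) * Cconj (b n) = - Cconj (x n)], hence [h] determines [x].

    Second, [h] has polynomial growth ([polynomial_growth]).  The hypotheses on
    the moments say that [z ^ N * phi z = mu - sum_n e n / (1 - z * s n)] with [e]
    summable and [mu <> 0] ([N = 0] when the first moment is not [-1]).  On a
    suitable circle of radius comparable to [R] the last sum is small except on a
    small proportion of the circle ([good_circle]), so a Poisson bound gives for
    the maximum [m R] of the truncated logarithm of [Cmod (h z)] on the disc of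
    radius [R] an inequality [m R <= A + A * ln R + delta * m (3 * R)] with
    [delta] as small as desired ([growth_step]).  The Schatten condition makes
    [h] of finite order ([growth_at_scale]), and then iterating the inequality
    removes the last term ([growth_bootstrap]).

    Third, the adjoint [V] of [L] preserves the space of these [x], and acts on
    [h] by [h z => h z / z - inner a x] ([extension_adjoint]).  Every application
    of [V] lowers the degree of the growth by one, and with Liouville's theorem
    [V] is nilpotent on every such [x] ([adjoint_nilpotent]).

    The rest is algebra.  A vector annihilated by a power of [V] is a combination
    of the sequences [Cconj (/ s n) ^ j * b n], [j >= 1] ([adjoint_kernel_form]).  If
    the first moment is not [-1], then [V] is injective and [x = 0].  Under the
    degenerate moment conditions [V ^ (N + 1) y = 0] implies [V ^ N y = 0]
    ([adjoint_ascent]), so [x] ranges over a space of dimension at most [N]; and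
    if [x] is not 0, then some nonzero vector of [L2] in the kernel of [V] is a
    multiple of [Cconj (/ s n) * b n], which gives [b] in [z L2]
    ([kernel_in_zL2]).  The statements on the adjoint of [L] follow by applying
    all this to the data [Cconj s], [b], [a].

    Analytic functions enter through finite Taylor expansions with bounded
    remainder ([germ]), and the mean value inequalities through products over
    four points [z + i ^ k * t] and means over finitely many points of a circle. *)

(** * Auxiliary facts *)

Lemma functional_choice (A B : Type) (R : A -> B -> Prop) :
  (forall x, exists y, R x y) -> exists f, forall x, R x (f x).
Proof.
intros H. exists (fun x => proj1_sig (constructive_indefinite_description _ (H x))).
intros x. exact (proj2_sig (constructive_indefinite_description _ (H x))).
Qed.

Lemma Rmin_lt_inv t a b : t < Rmin a b -> t < a /\ t < b.
Proof. intros H. pose proof (Rmin_l a b). pose proof (Rmin_r a b). lra. Qed.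

Lemma Cmod_minus_sym (x y : C) : Cmod (x - y) = Cmod (y - x).
Proof. rewrite <- Cmod_opp. f_equal. ring. Qed.

Lemma Cmod_reverse_triangle (x y : C) : Cmod x - Cmod y <= Cmod (x - y).
Proof.
pose proof (Cmod_triangle (x - y) y) as H.
replace (x - y + y)%C with x in H by ring. lra.
Qed.

Lemma Cmod_minus_le (x y : C) : Cmod (x - y) <= Cmod x + Cmod y.
Proof. unfold Cminus. rewrite <- (Cmod_opp y). apply Cmod_triangle. Qed.

Lemma Cmod_RtoC_pos (x : R) : 0 <= x -> Cmod x = x.
Proof. intros. now rewrite Cmod_R, Rabs_pos_eq. Qed.

Lemma Cminus_eq_0 (x y : C) : (x - y)%C = 0 -> x = y.
Proof. intros H. replace x with (x - y + y)%C by ring. rewrite H. ring. Qed.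

Lemma Cmult_neq_0_inv (x y : C) : (x * y)%C <> 0 -> x <> 0 /\ y <> 0.
Proof. intros H. split; intros E; apply H; rewrite E; ring. Qed.

Lemma Cmult_integral (x y : C) : (x * y)%C = 0 -> x = 0 \/ y = 0.
Proof.
intros H. destruct (classic (x = 0)) as [|Hx]; auto. right.
destruct (classic (y = 0)) as [|Hy]; auto. exfalso. now apply (Cmult_neq_0 x y).
Qed.

Lemma Cinv_0 : (/ (RtoC 0))%C = 0.
Proof. unfold Cinv, RtoC. simpl. f_equal; unfold Rdiv; ring. Qed.

(** * Germs of analytic functions *)

(** At [z0], [f] has [k] iterated divided differences, the last one bounded
    nearby. This finite amount of Taylor expansion is all that the maximum
    principle asks of an analytic function (it uses [k = 3]), and sums, products
    and inverses inherit it by algebra alone. *)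
Fixpoint germ (k : nat) (f : C -> C) (z0 : C) : Prop :=
  match k with
  | O => exists M d, 0 < d /\ forall w, Cmod w < d -> Cmod (f (z0 + w)%C) <= M
  | S k => exists f1 d, germ k f1 z0 /\ 0 < d /\
      forall w, Cmod w < d -> f (z0 + w)%C = (f z0 + w * f1 (z0 + w))%C
  end.

Lemma Cmod_0_lt d : 0 < d -> Cmod 0 < d.
Proof. now rewrite Cmod_0. Qed.

Lemma germ_ext k f g z0 d : 0 < d ->
  (forall w, Cmod w < d -> f (z0 + w)%C = g (z0 + w)%C) -> germ k f z0 -> germ k g z0.
Proof.
intros Hd H. destruct k as [|k]; simpl.
- intros (M & d' & Hd' & HM). exists M, (Rmin d d').
  split; [now apply Rmin_pos|]. intros w Hw.
  rewrite <- H by (eapply Rlt_le_trans; [exact Hw|apply Rmin_l]).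
  apply HM. eapply Rlt_le_trans; [exact Hw|apply Rmin_r].
- intros (f1 & d' & Hf1 & Hd' & E). exists f1, (Rmin d d').
  split; [assumption|]. split; [now apply Rmin_pos|]. intros w Hw.
  rewrite <- H by (eapply Rlt_le_trans; [exact Hw|apply Rmin_l]).
  replace (g z0) with (f z0).
  + apply E. eapply Rlt_le_trans; [exact Hw|apply Rmin_r].
  + rewrite <- (Cplus_0_r z0). apply H. now apply Cmod_0_lt.
Qed.

Lemma germ_S k f z0 : germ (S k) f z0 -> germ k f z0.
Proof.
revert f. induction k as [|k IH]; intros f.
- intros (f1 & d & (M & d' & Hd' & HM) & Hd & E).
  exists (Cmod (f z0) + M), (Rmin 1 (Rmin d d')).
  split; [repeat apply Rmin_pos; lra|]. intros w Hw.
  pose proof (Rmin_l 1 (Rmin d d')). pose proof (Rmin_r 1 (Rmin d d')).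
  pose proof (Rmin_l d d'). pose proof (Rmin_r d d').
  rewrite E by lra. specialize (HM w ltac:(lra)).
  eapply Rle_trans; [apply Cmod_triangle|]. rewrite Cmod_mult.
  pose proof (Cmod_ge_0 w). pose proof (Cmod_ge_0 (f1 (z0 + w)%C)). nra.
- intros (f1 & d & Hf1 & Hd & E). exists f1, d. auto.
Qed.

Lemma germ_const k c z0 : germ k (fun _ => c) z0.
Proof.
revert c; induction k as [|k IH]; intros c.
- exists (Cmod c), 1. split; [lra|]. intros; lra.
- exists (fun _ => RtoC 0), 1. split; [apply IH|]. split; [lra|]. intros; ring.
Qed.

Lemma germ_id k z0 : germ k (fun z => z) z0.
Proof.
destruct k as [|k].
- exists (Cmod z0 + 1), 1. split; [lra|]. intros w Hw.
  pose proof (Cmod_triangle z0 w). lra.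
- exists (fun _ => RtoC 1), 1. split; [apply germ_const|]. split; [lra|]. intros; ring.
Qed.

Lemma germ_plus k f g z0 : germ k f z0 -> germ k g z0 -> germ k (fun z => f z + g z)%C z0.
Proof.
revert f g; induction k as [|k IH]; intros f g.
- intros (M & d & Hd & HM) (M' & d' & Hd' & HM').
  exists (M + M'), (Rmin d d'). split; [now apply Rmin_pos|]. intros w Hw.
  pose proof (Rmin_l d d'). pose proof (Rmin_r d d').
  specialize (HM w ltac:(lra)). specialize (HM' w ltac:(lra)).
  eapply Rle_trans; [apply Cmod_triangle|]. lra.
- intros (f1 & d & Hf & Hd & E) (g1 & d' & Hg & Hd' & E').
  exists (fun z => f1 z + g1 z)%C, (Rmin d d').
  split; [now apply IH|]. split; [now apply Rmin_pos|]. intros w Hw.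
  pose proof (Rmin_l d d'). pose proof (Rmin_r d d').
  rewrite E, E' by lra. ring.
Qed.

Lemma germ_mult k f g z0 : germ k f z0 -> germ k g z0 -> germ k (fun z => f z * g z)%C z0.
Proof.
revert f g; induction k as [|k IH]; intros f g.
- intros (M & d & Hd & HM) (M' & d' & Hd' & HM').
  exists (M * M'), (Rmin d d'). split; [now apply Rmin_pos|]. intros w Hw.
  pose proof (Rmin_l d d'). pose proof (Rmin_r d d').
  specialize (HM w ltac:(lra)). specialize (HM' w ltac:(lra)).
  rewrite Cmod_mult. apply Rmult_le_compat; auto using Cmod_ge_0.
- intros Hf Hg. pose proof (germ_S _ _ _ Hg) as Hg0.
  destruct Hf as (f1 & d & Hf & Hd & E), Hg as (g1 & d' & Hg & Hd' & E').
  exists (fun z => f1 z * g z + f z0 * g1 z)%C, (Rmin d d').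
  split; [|split; [now apply Rmin_pos|]].
  + apply germ_plus; apply IH; auto using germ_const.
  + intros w Hw.
    pose proof (Rmin_l d d'). pose proof (Rmin_r d d').
    rewrite E by lra. rewrite (E' w) by lra. ring.
Qed.

Lemma germ_continuous f z0 : germ 1 f z0 -> forall e, 0 < e ->
  exists d, 0 < d /\ forall z, Cmod (z - z0) < d -> Cmod (f z - f z0) < e.
Proof.
intros (f1 & d & (M & d' & Hd' & HM) & Hd & E) e He.
assert (HM0 : 0 <= M).
{ eapply Rle_trans; [apply Cmod_ge_0|apply (HM 0)]. now apply Cmod_0_lt. }
exists (Rmin (Rmin d d') (e / (M + 1))).
split; [repeat apply Rmin_pos; auto; apply Rdiv_lt_0_compat; lra|]. intros z Hz.
pose proof (Rmin_l (Rmin d d') (e / (M + 1))). pose proof (Rmin_r (Rmin d d') (e / (M + 1))).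
pose proof (Rmin_l d d'). pose proof (Rmin_r d d').
replace z with (z0 + (z - z0))%C at 1 by ring.
rewrite E by lra. replace (_ - _)%C with ((z - z0) * f1 (z0 + (z - z0)))%C by ring.
specialize (HM (z - z0)%C ltac:(lra)).
rewrite Cmod_mult. pose proof (Cmod_ge_0 (z - z0)).
apply Rle_lt_trans with (Cmod (z - z0) * (M + 1)).
- apply Rmult_le_compat_l; lra.
- apply Rlt_le_trans with (e / (M + 1) * (M + 1)).
  + apply Rmult_lt_compat_r; lra.
  + right. field. lra.
Qed.

Lemma germ_nonzero_near f z0 : germ 1 f z0 -> f z0 <> 0 ->
  exists d, 0 < d /\ forall z, Cmod (z - z0) < d -> Cmod (f z0) / 2 < Cmod (f z).
Proof.
intros H H0. apply Cmod_gt_0 in H0.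
destruct (germ_continuous _ _ H (Cmod (f z0) / 2)) as (d & Hd & E); [lra|].
exists d; split; auto. intros z Hz. specialize (E z Hz).
rewrite Cmod_minus_sym in E. pose proof (Cmod_reverse_triangle (f z0) (f z)). lra.
Qed.

(** The divided difference of [/ f] is [- f1 * / f] divided by [f z0], with [f1]
    that of [f]; so the order of [/ f] can be raised one step at a time,
    starting from boundedness. *)
Lemma germ_inv k f z0 : germ (S k) f z0 -> f z0 <> 0 -> germ (S k) (fun z => / f z)%C z0.
Proof.
intros H H0.
assert (H1 : germ 1 f z0) by (clear - H; induction k; auto; apply IHk, germ_S, H).
destruct (germ_nonzero_near _ _ H1 H0) as (d & Hd & Hnz).
assert (Hnz' : forall w, Cmod w < d -> f (z0 + w)%C <> 0).
{ intros w Hw. apply Cmod_gt_0. apply Rle_lt_trans with (Cmod (f z0) / 2).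
  - pose proof (Cmod_ge_0 (f z0)). lra.
  - apply Hnz. now replace (z0 + w - z0)%C with w by ring. }
assert (Hg0 : germ 0 (fun z => / f z)%C z0).
{ exists (/ (Cmod (f z0) / 2)), d. split; auto. intros w Hw.
  rewrite Cmod_inv by auto. apply Cmod_gt_0 in H0.
  apply Rinv_le_contravar; [lra|]. left. apply Hnz.
  now replace (z0 + w - z0)%C with w by ring. }
assert (G : forall j, (j <= S k)%nat -> germ j (fun z => / f z)%C z0).
{ induction j as [|j IH]; auto. intros Hj.
  assert (Hf : germ (S j) f z0).
  { clear - H Hj. revert H. replace k with ((k - j) + j)%nat by lia.
    generalize (k - j)%nat. intros m. induction m; auto. intros; apply IHm, germ_S; auto. }
  destruct Hf as (f1 & d' & Hf1 & Hd' & E).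
  exists (fun z => - / f z0 * (f1 z * / f z))%C, (Rmin d d').
  split; [|split; [now apply Rmin_pos|]].
  - apply germ_mult; [apply germ_const|]. apply germ_mult; auto. apply IH; lia.
  - intros w Hw. pose proof (Rmin_l d d'). pose proof (Rmin_r d d').
    specialize (Hnz' w ltac:(lra)). specialize (E w ltac:(lra)).
    assert (Ef : (w * f1 (z0 + w))%C = (f (z0 + w) - f z0)%C) by (rewrite E; ring).
    replace (w * (- / f z0 * (f1 (z0 + w) * / f (z0 + w))))%C
      with (- / f z0 * (w * f1 (z0 + w)) * / f (z0 + w))%C by ring.
    rewrite Ef. field. split; auto. }
apply G; auto.
Qed.

Lemma germ_expansion f z0 : germ 3 f z0 ->
  exists c1 c2 M d, 0 < d /\ 0 <= M /\ forall w, Cmod w < d ->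
    Cmod (f (z0 + w) - (f z0 + c1 * w + c2 * w * w))%C <= M * Cmod w ^ 3.
Proof.
intros (f1 & d1 & (f2 & d2 & (f3 & d3 & (M & d4 & Hd4 & HM) & Hd3 & E3) & Hd2 & E2) & Hd1 & E1).
exists (f1 z0), (f2 z0), M, (Rmin (Rmin d1 d2) (Rmin d3 d4)).
split; [repeat apply Rmin_pos; auto|]. split.
{ eapply Rle_trans; [apply Cmod_ge_0|apply (HM 0)]. now apply Cmod_0_lt. }
intros w Hw.
pose proof (Rmin_l (Rmin d1 d2) (Rmin d3 d4)). pose proof (Rmin_r (Rmin d1 d2) (Rmin d3 d4)).
pose proof (Rmin_l d1 d2). pose proof (Rmin_r d1 d2).
pose proof (Rmin_l d3 d4). pose proof (Rmin_r d3 d4).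
rewrite E1, E2, E3 by lra.
replace (_ - _)%C with (w * w * w * f3 (z0 + w))%C by ring.
rewrite !Cmod_mult. specialize (HM w ltac:(lra)).
replace (Cmod w * Cmod w * Cmod w) with (Cmod w ^ 3) by ring.
rewrite (Rmult_comm M). apply Rmult_le_compat_l; auto. apply pow_le, Cmod_ge_0.
Qed.

(** * Log-subharmonic functions *)

Definition quarter_turns (Psi : C -> R) (z : C) (t : R) : R :=
  Psi (z + t)%C * Psi (z - t)%C * (Psi (z + Ci * t)%C * Psi (z - Ci * t)%C).

(** A discrete form of the sub-mean value property of [ln Psi] in which four
    points replace the circle; with products instead of sums, zeros of [Psi]
    need no care. The defect of third order is dominated by the gain of second
    order that the factor [exp (e * Cmod z ^ 2)] brings in [maximum_principle].
    *)
Definition log_subharmonic_at (Psi : C -> R) (z : C) : Prop :=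
  exists M d, 0 < d /\ forall t, 0 < t < d ->
    Psi z ^ 4 * (1 - M * t ^ 3) <= quarter_turns Psi z t.

Lemma Cmod_prod4_diff (p1 p2 p3 p4 q1 q2 q3 q4 : C) B e :
  Cmod p1 <= B -> Cmod p2 <= B -> Cmod p3 <= B -> Cmod p4 <= B ->
  Cmod q1 <= B -> Cmod q2 <= B -> Cmod q3 <= B -> Cmod q4 <= B ->
  Cmod (p1 - q1) <= e -> Cmod (p2 - q2) <= e ->
  Cmod (p3 - q3) <= e -> Cmod (p4 - q4) <= e ->
  Cmod (p1 * p2 * (p3 * p4) - q1 * q2 * (q3 * q4)) <= 4 * B ^ 3 * e.
Proof.
intros H1 H2 H3 H4 H5 H6 H7 H8 E1 E2 E3 E4.
assert (HB : 0 <= B) by (eapply Rle_trans; [apply Cmod_ge_0|exact H1]).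
assert (He : 0 <= e) by (eapply Rle_trans; [apply Cmod_ge_0|exact E1]).
assert (T : forall x y u v : C, forall X Y U V, Cmod x <= X -> Cmod y <= Y -> Cmod u <= U ->
  Cmod v <= V -> Cmod (x * y * u * v) <= X * Y * U * V).
{ intros x y u v X Y U V Hx Hy Hu Hv. rewrite !Cmod_mult.
  assert (0 <= X) by (eapply Rle_trans; [apply Cmod_ge_0|exact Hx]).
  assert (0 <= Y) by (eapply Rle_trans; [apply Cmod_ge_0|exact Hy]).
  assert (0 <= U) by (eapply Rle_trans; [apply Cmod_ge_0|exact Hu]).
  repeat apply Rmult_le_compat; auto using Cmod_ge_0, Rmult_le_pos. }
replace (p1 * p2 * (p3 * p4) - q1 * q2 * (q3 * q4))%C with
  ((p1 - q1) * p2 * p3 * p4 + (p2 - q2) * q1 * p3 * p4 + (p3 - q3) * q1 * q2 * p4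
   + (p4 - q4) * q1 * q2 * q3)%C by ring.
replace (4 * B ^ 3 * e) with (e * B * B * B + e * B * B * B + e * B * B * B + e * B * B * B) by ring.
eapply Rle_trans; [apply Cmod_triangle|]. apply Rplus_le_compat; auto.
eapply Rle_trans; [apply Cmod_triangle|]. apply Rplus_le_compat; auto.
eapply Rle_trans; [apply Cmod_triangle|]. apply Rplus_le_compat; auto.
Qed.

Lemma Ci_sqr : (Ci * Ci)%C = (- (1))%C.
Proof. unfold Ci, Cmult, Copp, RtoC. simpl. f_equal; ring. Qed.

(** The product of the quadratic Taylor polynomial over the quarter turns is
    unchanged when [t] becomes [Ci * t], so it is a polynomial in [t ^ 4], with
    constant term [f z ^ 4]. The Taylor remainders change it by a multiple of [t
    ^ 3]. *)
Lemma log_subharmonic_germ f z : germ 3 f z -> log_subharmonic_at (fun z => Cmod (f z)) z.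
Proof.
intros H. destruct (germ_expansion _ _ H) as (c1 & c2 & M & d & Hd & HM & E).
destruct (Req_dec (Cmod (f z)) 0) as [H0|H0].
{ exists 0, 1. split; [lra|]. intros t _. rewrite H0. unfold quarter_turns.
  pose proof (Cmod_ge_0 (f (z + t)%C)). pose proof (Cmod_ge_0 (f (z - t)%C)).
  pose proof (Cmod_ge_0 (f (z + Ci * t)%C)). pose proof (Cmod_ge_0 (f (z - Ci * t)%C)).
  replace (0 ^ 4 * (1 - 0 * t ^ 3)) with 0 by ring.
  repeat apply Rmult_le_pos; auto. }
set (c0 := f z) in *.
set (q := fun w => (c0 + c1 * w + c2 * w * w)%C).
set (B := Cmod c0 + Cmod c1 + Cmod c2 + M).
set (X := Cmod (2 * c0 * c0 * c2 * c2 - (2 * c0 * c2 - c1 * c1) * (2 * c0 * c2 - c1 * c1))%C + Cmod c2 ^ 4).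
assert (Hc : 0 < Cmod c0) by (pose proof (Cmod_ge_0 c0); lra).
exists ((4 * B ^ 3 * M + X) / Cmod c0 ^ 4), (Rmin 1 d).
split; [apply Rmin_pos; lra|]. intros t [Ht0 Ht].
pose proof (Rmin_l 1 d). pose proof (Rmin_r 1 d).
assert (Mt : Cmod (RtoC t) = t) by (apply Cmod_RtoC_pos; lra).
assert (M1 : forall w, Cmod w = t -> Cmod (f (z + w) - q w)%C <= M * t ^ 3).
{ intros w Hw. rewrite <- Hw. apply E. lra. }
assert (M2 : forall w, Cmod w = t -> Cmod (q w) <= B - M).
{ intros w Hw. unfold q, B. eapply Rle_trans; [apply Cmod_triangle|].
  eapply Rle_trans; [apply Rplus_le_compat_r, Cmod_triangle|].
  rewrite !Cmod_mult, Hw. pose proof (Cmod_ge_0 c1). pose proof (Cmod_ge_0 c2).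
  assert (t * t <= 1) by nra. nra. }
assert (T3 : 0 <= t ^ 3 <= 1).
{ split; [apply pow_le; lra|]. rewrite <- (pow1 3). apply pow_incr; lra. }
assert (M3 : forall w, Cmod w = t -> Cmod (f (z + w)%C) <= B).
{ intros w Hw. specialize (M1 w Hw). specialize (M2 w Hw).
  pose proof (Cmod_reverse_triangle (f (z + w)%C) (q w)).
  assert (M * t ^ 3 <= M) by nra. lra. }
assert (M4 : forall w, Cmod w = t -> Cmod (q w) <= B) by (intros w Hw; specialize (M2 w Hw); lra).
assert (Cw : Cmod (RtoC t) = t /\ Cmod (- RtoC t)%C = t /\ Cmod (Ci * RtoC t)%C = t
   /\ Cmod (- (Ci * RtoC t))%C = t).
{ rewrite !Cmod_opp, Cmod_mult, Cmod_Ci, Mt. repeat split; ring. }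
destruct Cw as (W1 & W2 & W3 & W4).
pose proof (Cmod_prod4_diff (f (z + t)%C) (f (z - t)%C) (f (z + Ci * t)%C) (f (z - Ci * t)%C)
  (q t) (q (- t)%C) (q (Ci * t)%C) (q (- (Ci * t))%C) B (M * t ^ 3)
  (M3 _ W1) (M3 _ W2) (M3 _ W3) (M3 _ W4) (M4 _ W1) (M4 _ W2) (M4 _ W3) (M4 _ W4)
  (M1 _ W1) (M1 _ W2) (M1 _ W3) (M1 _ W4)) as D.
unfold quarter_turns. cbv beta. rewrite <- !Cmod_mult. fold c0.
assert (Q : (q t * q (- t) * (q (Ci * t) * q (- (Ci * t))))%C
  = (c0 ^ 4 + t ^ 3 * (t * (2 * c0 * c0 * c2 * c2 - (2 * c0 * c2 - c1 * c1) * (2 * c0 * c2 - c1 * c1))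
       + t ^ 5 * c2 ^ 4))%C).
{ unfold q.
  replace (c2 * (Ci * t) * (Ci * t))%C with ((Ci * Ci) * (c2 * t * t))%C by ring.
  replace (c2 * (- (Ci * t)) * (- (Ci * t)))%C with ((Ci * Ci) * (c2 * t * t))%C by ring.
  replace ((c0 + c1 * (Ci * t) + Ci * Ci * (c2 * t * t)) * (c0 + c1 * - (Ci * t) + Ci * Ci * (c2 * t * t)))%C
   with ((c0 + Ci * Ci * (c2 * t * t)) * (c0 + Ci * Ci * (c2 * t * t)) - (Ci * Ci) * (c1 * t * c1 * t))%C by ring.
  rewrite Ci_sqr. ring. }
set (Pf := (f (z + t) * f (z - t) * (f (z + Ci * t) * f (z - Ci * t)))%C) in *.
rewrite Q in D.
assert (D2 : Cmod (t ^ 3 * (t * (2 * c0 * c0 * c2 * c2 - (2 * c0 * c2 - c1 * c1) * (2 * c0 * c2 - c1 * c1))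
       + t ^ 5 * c2 ^ 4))%C <= t ^ 3 * X).
{ rewrite Cmod_mult, Cmod_pow, Mt. apply Rmult_le_compat_l; [lra|].
  eapply Rle_trans; [apply Cmod_triangle|]. unfold X.
  rewrite Cmod_mult, Mt, (Cmod_mult (t ^ 5)), !Cmod_pow, Mt.
  assert (t ^ 5 <= 1) by (rewrite <- (pow1 5); apply pow_incr; lra).
  assert (0 <= Cmod c2 ^ 4) by (apply pow_le, Cmod_ge_0).
  apply Rplus_le_compat.
  - rewrite <- (Rmult_1_l (Cmod _)) at 2. apply Rmult_le_compat_r; [apply Cmod_ge_0|lra].
  - rewrite <- (Rmult_1_l (Cmod c2 ^ 4)) at 2. now apply Rmult_le_compat_r. }
assert (F : Cmod c0 ^ 4 <= Cmod Pf + (4 * B ^ 3 * (M * t ^ 3) + t ^ 3 * X)).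
{ rewrite <- Cmod_pow.
  match type of D2 with Cmod ?y <= _ => set (Y := y) in * end.
  replace (c0 ^ 4)%C with (Pf + (- (Pf - (c0 ^ 4 + Y))) + (- Y))%C by ring.
  eapply Rle_trans; [apply Cmod_triangle|]. rewrite Cmod_opp.
  eapply Rle_trans; [apply Rplus_le_compat_r, Cmod_triangle|]. rewrite Cmod_opp. lra. }
assert (Hc4 : 0 < Cmod c0 ^ 4) by (now apply pow_lt).
replace (Cmod c0 ^ 4 * (1 - (4 * B ^ 3 * M + X) / Cmod c0 ^ 4 * t ^ 3))
  with (Cmod c0 ^ 4 - (4 * B ^ 3 * M + X) * t ^ 3) by (field; lra).
lra.
Qed.

(** * Continuity, polar coordinates and maxima *)

Definition Ccontinuous_at (Psi : C -> R) (z : C) : Prop :=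
  forall e, 0 < e -> exists d, 0 < d /\ forall z', Cmod (z' - z) < d -> Rabs (Psi z' - Psi z) < e.

Lemma Ccontinuous_germ f z : germ 1 f z -> Ccontinuous_at (fun z => Cmod (f z)) z.
Proof.
intros H e He. destruct (germ_continuous _ _ H e He) as (d & Hd & E).
exists d; split; auto. intros z' Hz'. specialize (E _ Hz').
apply Rabs_def1.
- pose proof (Cmod_reverse_triangle (f z') (f z)). lra.
- pose proof (Cmod_reverse_triangle (f z) (f z')). rewrite Cmod_minus_sym in E. lra.
Qed.

Lemma Ccontinuous_at_continuous (Psi : C -> R) (z : C) :
  Ccontinuous_at Psi z <-> continuous (T := C_UniformSpace) (U := R_UniformSpace) Psi z.
Proof.
split.
- intros H P [e He]. destruct (H e (cond_pos e)) as (d & Hd & E).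
  assert (Hd2 : 0 < d / sqrt 2) by (apply Rdiv_lt_0_compat; [auto|apply sqrt_lt_R0; lra]).
  exists (mkposreal _ Hd2). intros z' Hz'. apply He, E.
  eapply Rlt_le_trans; [exact (C_NormedModule_mixin_compat2 z z' _ Hz')|].
  simpl. right. field. apply Rgt_not_eq, sqrt_lt_R0; lra.
- intros H e He. destruct (H (ball (Psi z) (mkposreal e He)) (locally_ball _ _)) as (d & Hd).
  exists d. split; [apply cond_pos|]. intros z' Hz'.
  exact (Hd z' (C_NormedModule_mixin_compat1 z z' d Hz')).
Qed.

Lemma Ccontinuous_mult F G z : Ccontinuous_at F z -> Ccontinuous_at G z ->
  Ccontinuous_at (fun z => F z * G z) z.
Proof.
rewrite !Ccontinuous_at_continuous.
apply (continuous_mult (U := C_UniformSpace) (K := R_AbsRing) F G).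
Qed.

Lemma Ccontinuous_plus F G z : Ccontinuous_at F z -> Ccontinuous_at G z ->
  Ccontinuous_at (fun z => F z + G z) z.
Proof.
rewrite !Ccontinuous_at_continuous.
apply (continuous_plus (U := C_UniformSpace) (K := R_AbsRing) (V := R_NormedModule) F G).
Qed.

Lemma Ccontinuous_comp (g : R -> R) F z : continuity_pt g (F z) -> Ccontinuous_at F z ->
  Ccontinuous_at (fun z => g (F z)) z.
Proof.
rewrite !Ccontinuous_at_continuous, continuity_pt_filterlim. intros Hg HF.
exact (continuous_comp (U := C_UniformSpace) (V := R_UniformSpace) (W := R_UniformSpace) F g z HF Hg).
Qed.

Lemma Ccontinuous_Cmod z : Ccontinuous_at Cmod z.
Proof. exact (Ccontinuous_germ (fun z => z) z (germ_id 1 z)). Qed.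

Lemma Ccontinuous_const c z : Ccontinuous_at (fun _ => c) z.
Proof. apply Ccontinuous_at_continuous. apply continuous_const. Qed.

Definition cis (t : R) : C := (cos t, sin t).

Lemma Cmod_cis t : Cmod (cis t) = 1.
Proof.
unfold Cmod, cis; simpl. etransitivity; [|exact sqrt_1]. f_equal.
pose proof (sin2_cos2 t). unfold Rsqr in *. lra.
Qed.

Lemma cis_plus s t : cis (s + t) = (cis s * cis t)%C.
Proof. unfold cis, Cmult; simpl. rewrite cos_plus, sin_plus. f_equal; ring. Qed.

Lemma cis_0 : cis 0 = 1.
Proof. unfold cis. now rewrite cos_0, sin_0. Qed.

Lemma cis_pow t n : (cis t ^ n)%C = cis (INR n * t).
Proof.
induction n as [|n IH].
- simpl. rewrite Rmult_0_l, cis_0. reflexivity.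
- rewrite Cpow_S, IH, <- cis_plus, S_INR. f_equal. ring.
Qed.

Lemma cis_2PI t : cis (t + 2 * PI) = cis t.
Proof. unfold cis. now rewrite cos_plus, sin_plus, cos_2PI, sin_2PI, !Rmult_1_r, !Rmult_0_r, Rminus_0_r, Rplus_0_r. Qed.

Lemma unit_circle_cis (u : C) : Cmod u = 1 -> exists t, 0 <= t <= 2 * PI /\ u = cis t.
Proof.
intros H. destruct u as [x y]. unfold Cmod in H; simpl in H.
assert (H2 : x * x + y * y = 1).
{ assert (E : sqrt (x * (x * 1) + y * (y * 1)) ^ 2 = 1) by (rewrite H; ring).
  rewrite pow2_sqrt in E; pose proof (Rle_0_sqr x); pose proof (Rle_0_sqr y); unfold Rsqr in *; lra. }
assert (Hx : -1 <= x <= 1) by (pose proof (Rle_0_sqr y); unfold Rsqr in *; split; nra).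
pose proof (acos_bound x) as Hb.
assert (Hs : sin (acos x) = sqrt (1 - x * x)) by (rewrite sin_acos; auto).
destruct (Rle_dec 0 y) as [Hy|Hy].
- exists (acos x). split; [lra|]. unfold cis. rewrite cos_acos, Hs by auto. f_equal.
  replace (1 - x * x) with (y * y) by lra. now rewrite sqrt_square.
- exists (2 * PI - acos x). split; [lra|].
  replace (2 * PI - acos x) with (- acos x + 2 * PI) by ring. rewrite cis_2PI.
  unfold cis. rewrite cos_neg, sin_neg, cos_acos, Hs by auto. f_equal.
  replace (1 - x * x) with ((- y) * (- y)) by lra. rewrite sqrt_square; lra.
Qed.

Lemma polar_form (z : C) : exists t, 0 <= t <= 2 * PI /\ z = (Cmod z * cis t)%C.
Proof.
destruct (Req_dec (Cmod z) 0) as [H|H].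
- exists 0. split; [pose proof PI_RGT_0; lra|]. rewrite H. apply Cmod_eq_0 in H. rewrite H. ring.
- assert (Hp : 0 < Cmod z) by (pose proof (Cmod_ge_0 z); lra).
  assert (Hn : RtoC (Cmod z) <> 0) by (intros E; apply H; now injection E).
  destruct (unit_circle_cis (z / Cmod z)%C) as (t & Ht & E).
  + rewrite Cmod_div by auto. rewrite (Cmod_RtoC_pos (Cmod z)) by lra. field; auto.
  + exists t. split; auto. rewrite <- E. field; auto.
Qed.

Lemma clamp_lipschitz a b x y :
  Rabs (Rmax a (Rmin b x) - Rmax a (Rmin b y)) <= Rabs (x - y).
Proof.
unfold Rmax, Rmin. destruct (Rle_dec b x), (Rle_dec b y);
  repeat match goal with |- context [Rle_dec ?p ?q] => destruct (Rle_dec p q) end;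
  unfold Rabs; repeat match goal with |- context [Rcase_abs ?p] => destruct (Rcase_abs p) end; lra.
Qed.

(** Maximise in [y] first: by uniform continuity the partial maxima depend
    continuously on [x], so they attain a maximum too. Clamping [x] to the
    interval makes them a continuous function on the whole line. *)
Lemma continuous_2d_max F a b c d : a <= b -> c <= d ->
  (forall x y, continuity_2d_pt F x y) ->
  exists x0 y0, a <= x0 <= b /\ c <= y0 <= d /\
    forall x y, a <= x <= b -> c <= y <= d -> F x y <= F x0 y0.
Proof.
intros Hab Hcd HF.
assert (Hy : forall x, exists y0, c <= y0 <= d /\ forall y, c <= y <= d -> F x y <= F x y0).
{ intros x. destruct (continuity_ab_maj (F x) c d Hcd) as (y0 & H1 & H2).
  - intros y _ e He. destruct (HF x y (mkposreal e He)) as (dl & Hdl).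
    exists dl. split; [apply cond_pos|]. intros y' [_ Hy']. apply Hdl; auto.
    rewrite Rminus_diag_eq, Rabs_R0 by auto. apply cond_pos.
  - exists y0. split; auto. }
destruct (functional_choice _ _ _ Hy) as (Y & HY).
set (clamp := fun x => Rmax a (Rmin b x)).
assert (Hcl : forall x, a <= clamp x <= b).
{ intros x. unfold clamp. split; [apply Rmax_l|apply Rmax_lub; auto using Rmin_l]. }
assert (Hcl1 : forall x, a <= x <= b -> clamp x = x).
{ intros x Hx. unfold clamp. rewrite Rmin_right, Rmax_right; lra. }
assert (Hcl2 : forall x y, Rabs (clamp x - clamp y) <= Rabs (x - y)).
{ intros x y. apply clamp_lipschitz. }
destruct (continuity_ab_maj (fun x => F (clamp x) (Y (clamp x))) a b Hab) as (x0 & H1 & H2).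
- intros x _ e He. assert (He2 : 0 < e) by auto.
  destruct (uniform_continuity_2d F a b c d (fun x y _ _ => HF x y) (mkposreal e He2)) as (dl & Hdl).
  exists dl. split; [apply cond_pos|]. intros x' [_ Hx']. simpl in *. unfold R_dist in *.
  assert (Hc : Rabs (clamp x' - clamp x) < dl) by (eapply Rle_lt_trans; [apply Hcl2|auto]).
  destruct (HY (clamp x)) as [B1 M1], (HY (clamp x')) as [B2 M2].
  assert (Z : forall y, Rabs (y - y) < dl) by (intros; rewrite Rminus_diag_eq, Rabs_R0 by auto; apply cond_pos).
  pose proof (Hdl (clamp x) (Y (clamp x)) (clamp x') (Y (clamp x)) (Hcl _) B1 (Hcl _) B1 Hc (Z _)) as E1.
  pose proof (Hdl (clamp x) (Y (clamp x')) (clamp x') (Y (clamp x')) (Hcl _) B2 (Hcl _) B2 Hc (Z _)) as E2.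
  specialize (M1 _ B2). specialize (M2 _ B1).
  apply Rabs_def2 in E1. apply Rabs_def2 in E2. apply Rabs_def1; lra.
- exists x0, (Y x0). split; auto. split; [apply HY|]. intros x y Hx Hy'.
  specialize (H1 x Hx). simpl in H1. rewrite !Hcl1 in H1 by auto.
  eapply Rle_trans; [|exact H1]. now apply HY.
Qed.

(** Polar coordinates turn the disc into a rectangle; the radius is clamped
    since [Psi] is continuous only in the disc. *)
Lemma disc_max Psi r : 0 <= r -> (forall z, Cmod z <= r -> Ccontinuous_at Psi z) ->
  exists z1, Cmod z1 <= r /\ forall z, Cmod z <= r -> Psi z <= Psi z1.
Proof.
intros Hr HP. pose proof PI_RGT_0.
set (clamp := fun x => Rmax 0 (Rmin r x)).
assert (Hcl : forall x, 0 <= clamp x <= r).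
{ intros x. unfold clamp. split; [apply Rmax_l|apply Rmax_lub; auto using Rmin_l]. }
assert (Hcl1 : forall x, 0 <= x <= r -> clamp x = x).
{ intros x Hx. unfold clamp. rewrite Rmin_right, Rmax_right; lra. }
assert (Hcl2 : forall x y, Rabs (clamp x - clamp y) <= Rabs (x - y)).
{ intros x y. apply clamp_lipschitz. }
assert (Hm : forall x t, Cmod (clamp x * cis t)%C <= r).
{ intros x t. rewrite Cmod_mult, Cmod_cis, Cmod_RtoC_pos by apply Hcl.
  specialize (Hcl x). lra. }
destruct (continuous_2d_max (fun x t => Psi (clamp x * cis t)%C) 0 r 0 (2 * PI)) as (x0 & t0 & Hx0 & Ht0 & M);
  [lra|lra| |].
- intros x t e. destruct (HP _ (Hm x t) e (cond_pos e)) as (d & Hd & E).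
  assert (Hd4 : 0 < d / (2 * r + 4)) by (apply Rdiv_lt_0_compat; lra).
  destruct (continuity_sin t (d / (2 * r + 4)) Hd4) as (ds & Hds & Es).
  destruct (continuity_cos t (d / (2 * r + 4)) Hd4) as (dc & Hdc & Ec).
  assert (Es' : forall t', Rabs (t' - t) < ds -> Rabs (sin t' - sin t) < d / (2 * r + 4)).
  { intros t' Ht'. destruct (Req_dec t' t) as [->|Q].
    - rewrite Rminus_diag_eq, Rabs_R0; auto.
    - apply (Es t'). split; [split; [exact I|auto]|]. apply Ht'. }
  assert (Ec' : forall t', Rabs (t' - t) < dc -> Rabs (cos t' - cos t) < d / (2 * r + 4)).
  { intros t' Ht'. destruct (Req_dec t' t) as [->|Q].
    - rewrite Rminus_diag_eq, Rabs_R0; auto.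
    - apply (Ec t'). split; [split; [exact I|auto]|]. apply Ht'. }
  exists (mkposreal (Rmin (d / (2 * r + 4)) (Rmin ds dc)) ltac:(repeat apply Rmin_pos; auto)).
  intros x' t' Hx' Ht'. simpl in Hx', Ht'.
  pose proof (Rmin_l (d / (2 * r + 4)) (Rmin ds dc)). pose proof (Rmin_r (d / (2 * r + 4)) (Rmin ds dc)).
  pose proof (Rmin_l ds dc). pose proof (Rmin_r ds dc).
  specialize (Es' t' ltac:(lra)). specialize (Ec' t' ltac:(lra)).
  apply E.
  replace (clamp x' * cis t' - clamp x * cis t)%C with
    ((clamp x' - clamp x) * cis t' + clamp x * (cis t' - cis t))%C by ring.
  eapply Rle_lt_trans; [apply Cmod_triangle|]. rewrite !Cmod_mult, Cmod_cis.
  rewrite <- RtoC_minus, Cmod_R, (Cmod_RtoC_pos (clamp x)) by apply Hcl.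
  specialize (Hcl2 x' x).
  assert (HA : Cmod (cis t' - cis t)%C <= 2 * (d / (2 * r + 4))).
  { eapply Rle_trans; [apply Cmod_2Rmax|]. simpl.
    assert (S2 : sqrt 2 <= 2).
    { rewrite <- (sqrt_square 2) at 2 by lra. apply sqrt_le_1_alt. lra. }
    pose proof (sqrt_pos 2).
    apply Rmult_le_compat; auto.
    - eapply Rle_trans; [apply Rabs_pos|apply Rmax_l].
    - apply Rmax_lub; left; auto. }
  pose proof (Cmod_ge_0 (cis t' - cis t)%C). pose proof (Hcl x).
  assert (Hx : Rabs (clamp x' - clamp x) < d / (2 * r + 4)) by lra.
  assert (Hsum : clamp x * Cmod (cis t' - cis t)%C <= r * (2 * (d / (2 * r + 4))))
    by (apply Rmult_le_compat; lra).
  assert (Hd' : d / (2 * r + 4) * (2 * r + 4) = d) by (field; lra).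
  nra.
- exists (x0 * cis t0)%C. split.
  + rewrite Cmod_mult, Cmod_cis, Cmod_RtoC_pos; lra.
  + intros z Hz. destruct (polar_form z) as (t & Ht & Ez).
    assert (Hz' : 0 <= Cmod z <= r) by (split; [apply Cmod_ge_0|exact Hz]).
    specialize (M (Cmod z) t Hz' Ht). cbv beta in M.
    rewrite (Hcl1 (Cmod z)), (Hcl1 x0) in M by assumption.
    rewrite Ez at 1. exact M.
Qed.

(** * The maximum principle *)

Lemma Cmod_sqr_quarter_turns z t :
  Cmod (z + RtoC t) ^ 2 + Cmod (z - RtoC t) ^ 2
    + (Cmod (z + Ci * RtoC t) ^ 2 + Cmod (z - Ci * RtoC t) ^ 2)
  = 4 * Cmod z ^ 2 + 4 * t ^ 2.
Proof. rewrite !Cmod2_alt. destruct z as [x y]. simpl. unfold Re, Im; simpl. ring. Qed.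

(** The factor [exp (e * Cmod z ^ 2)] multiplies the product over quarter turns
    by [exp (4 * e * t ^ 2)], which for small [t] outweighs the defect [M * t ^
    3]. So the modified function has no positive maximum inside the disc, and
    [e] is arbitrary. *)
Lemma maximum_principle Psi r B : 0 < r ->
  (forall z, 0 <= Psi z) ->
  (forall z, Cmod z <= r -> Ccontinuous_at Psi z) ->
  (forall z, Cmod z < r -> log_subharmonic_at Psi z) ->
  (forall z, Cmod z = r -> Psi z <= B) ->
  forall z, Cmod z <= r -> Psi z <= B.
Proof.
intros Hr Hpos Hcont Hls HB z Hz.
assert (HB0 : 0 <= B).
{ eapply Rle_trans; [apply (Hpos r)|]. apply HB. apply Cmod_RtoC_pos; lra. }
assert (Key : forall e, 0 < e -> Psi z <= B * exp (e * r ^ 2)).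
{ intros e He.
  set (Phi := fun z => Psi z * exp (e * Cmod z ^ 2)).
  destruct (disc_max Phi r) as (z1 & Hz1 & Mx); [lra| |].
  { intros y Hy. apply Ccontinuous_mult; auto.
    apply (Ccontinuous_comp (fun x => exp (e * x ^ 2)) Cmod); [|apply Ccontinuous_Cmod].
    apply derivable_continuous_pt. exists (e * (2 * Cmod y) * exp (e * Cmod y ^ 2)).
    apply is_derive_Reals. auto_derive; auto. simpl. ring. }
  assert (HPhi0 : 0 <= Phi z1) by (apply Rmult_le_pos; auto; left; apply exp_pos).
  assert (Hstep : Psi z <= Phi z1).
  { eapply Rle_trans; [|apply (Mx z Hz)]. unfold Phi.
    rewrite <- (Rmult_1_r (Psi z)) at 1. apply Rmult_le_compat_l; auto.
    rewrite <- exp_0. destruct (Rle_lt_or_eq_dec 0 (e * Cmod z ^ 2)) as [H|H].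
    - apply Rmult_le_pos; [lra|apply pow2_ge_0].
    - left. now apply exp_increasing.
    - rewrite <- H. lra. }
  destruct (Rle_lt_or_eq_dec _ _ Hz1) as [Hin|Hbd].
  2:{ eapply Rle_trans; [exact Hstep|]. unfold Phi. rewrite Hbd.
      apply Rmult_le_compat_r; [left; apply exp_pos|auto]. }
  destruct (Rle_lt_or_eq_dec _ _ HPhi0) as [Hgt|H0].
  2:{ rewrite <- H0 in Hstep. eapply Rle_trans; [exact Hstep|].
      apply Rmult_le_pos; auto. left; apply exp_pos. }
  exfalso.
  destruct (Hls _ Hin) as (M & d & Hd & HM).
  set (M' := Rabs M + 1). assert (HM' : 0 < M') by (unfold M'; pose proof (Rabs_pos M); lra).
  (* So small that the four points stay in the disc and that [M' * t ^ 3] is at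
     most [e * t ^ 2] and at most [1/4]. *)
  set (t := Rmin (Rmin (1/2) (Rmin (e / M') (1 / M'))) (Rmin (d / 2) ((r - Cmod z1) / 2))).
  assert (Ht0 : 0 < t).
  { unfold t. repeat apply Rmin_pos; try lra; apply Rdiv_lt_0_compat; lra. }
  assert (T1 : t <= 1/2).
  { unfold t. eapply Rle_trans; [apply Rmin_l|apply Rmin_l]. }
  assert (T2 : t <= e / M').
  { unfold t. eapply Rle_trans; [apply Rmin_l|]. eapply Rle_trans; [apply Rmin_r|apply Rmin_l]. }
  assert (T3 : t <= 1 / M').
  { unfold t. eapply Rle_trans; [apply Rmin_l|]. eapply Rle_trans; [apply Rmin_r|apply Rmin_r]. }
  assert (T4 : t <= d / 2).
  { unfold t. eapply Rle_trans; [apply Rmin_r|apply Rmin_l]. }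
  assert (T5 : t <= (r - Cmod z1) / 2).
  { unfold t. eapply Rle_trans; [apply Rmin_r|apply Rmin_r]. }
  specialize (HM t ltac:(lra)).
  assert (U2 : M' * t <= e).
  { apply Rle_trans with (M' * (e / M')); [apply Rmult_le_compat_l; lra|]. right; field; lra. }
  assert (U3 : M' * t <= 1).
  { apply Rle_trans with (M' * (1 / M')); [apply Rmult_le_compat_l; lra|]. right; field; lra. }
  assert (Mt : Cmod (RtoC t) = t) by (apply Cmod_RtoC_pos; lra).
  assert (Inn : forall w, Cmod w = t -> Phi (z1 + w)%C <= Phi z1).
  { intros w Hw. apply Mx. pose proof (Cmod_triangle z1 w). lra. }
  assert (Wi : Cmod (Ci * RtoC t) = t) by (rewrite Cmod_mult, Cmod_Ci, Mt; ring).
  pose proof (Inn _ Mt) as I1.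
  pose proof (Inn (- RtoC t)%C ltac:(rewrite Cmod_opp; auto)) as I2.
  pose proof (Inn _ Wi) as I3.
  pose proof (Inn (- (Ci * RtoC t))%C ltac:(rewrite Cmod_opp; auto)) as I4.
  assert (Pp : forall y, 0 <= Phi y) by (intros; apply Rmult_le_pos; auto; left; apply exp_pos).
  assert (Up : quarter_turns Phi z1 t <= Phi z1 ^ 4).
  { unfold quarter_turns. replace (Phi z1 ^ 4) with (Phi z1 * Phi z1 * (Phi z1 * Phi z1)) by ring.
    apply Rmult_le_compat; [apply Rmult_le_pos; apply Pp|apply Rmult_le_pos; apply Pp| |];
      (apply Rmult_le_compat; [apply Pp|apply Pp| |]; assumption). }
  assert (Eq : quarter_turns Phi z1 t = quarter_turns Psi z1 t * exp (e * (4 * Cmod z1 ^ 2 + 4 * t ^ 2))).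
  { rewrite <- Cmod_sqr_quarter_turns. unfold quarter_turns, Phi.
    rewrite !Rmult_plus_distr_l, !exp_plus. ring. }
  assert (Eq2 : Phi z1 ^ 4 = Psi z1 ^ 4 * exp (e * (4 * Cmod z1 ^ 2))).
  { unfold Phi. rewrite Rpow_mult_distr. f_equal.
    replace (e * (4 * Cmod z1 ^ 2)) with (e * Cmod z1 ^ 2 + e * Cmod z1 ^ 2 + (e * Cmod z1 ^ 2 + e * Cmod z1 ^ 2)) by ring.
    rewrite !exp_plus. ring. }
  assert (Ex : 1 + 4 * e * t ^ 2 <= exp (4 * e * t ^ 2)) by apply exp_ineq1_le.
  assert (Low : Phi z1 ^ 4 * ((1 - M * t ^ 3) * exp (4 * e * t ^ 2)) <= quarter_turns Phi z1 t).
  { rewrite Eq, Eq2.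
    replace (e * (4 * Cmod z1 ^ 2 + 4 * t ^ 2)) with (e * (4 * Cmod z1 ^ 2) + 4 * e * t ^ 2) by ring.
    rewrite exp_plus.
    replace (Psi z1 ^ 4 * exp (e * (4 * Cmod z1 ^ 2)) * ((1 - M * t ^ 3) * exp (4 * e * t ^ 2)))
      with (Psi z1 ^ 4 * (1 - M * t ^ 3) * (exp (e * (4 * Cmod z1 ^ 2)) * exp (4 * e * t ^ 2))) by ring.
    apply Rmult_le_compat_r; auto. left. apply Rmult_lt_0_compat; apply exp_pos. }
  assert (HMM : M <= M') by (unfold M'; pose proof (Rle_abs M); lra).
  assert (t2 : 0 < t ^ 2) by (apply pow_lt; auto).
  assert (Y1 : M' * t ^ 3 <= e * t ^ 2).
  { replace (M' * t ^ 3) with (M' * t * t ^ 2) by ring. apply Rmult_le_compat_r; lra. }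
  assert (Y2 : M' * t ^ 3 <= 1/4).
  { replace (M' * t ^ 3) with (M' * t * (t * t)) by ring.
    assert (t * t <= 1/4) by nra. apply Rle_trans with (1 * (1/4)); [|lra].
    apply Rmult_le_compat; nra. }
  assert (Y3 : M * t ^ 3 <= M' * t ^ 3) by (apply Rmult_le_compat_r; auto; apply pow_le; lra).
  assert (Big : 1 < (1 - M * t ^ 3) * exp (4 * e * t ^ 2)).
  { apply Rlt_le_trans with ((1 - M' * t ^ 3) * (1 + 4 * e * t ^ 2)).
    - assert (0 < e * t ^ 2) by (apply Rmult_lt_0_compat; auto). nra.
    - apply Rmult_le_compat; try lra. assert (0 < e * t ^ 2) by (apply Rmult_lt_0_compat; auto). lra. }
  assert (P4 : 0 < Phi z1 ^ 4) by (apply pow_lt; auto). nra. }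
destruct (Rle_lt_dec (Psi z) B) as [|Hlt]; auto. exfalso.
destruct (Rle_lt_or_eq_dec _ _ HB0) as [HBp|HBz].
- assert (Hq : 1 < Psi z / B).
  { apply Rmult_lt_reg_r with B; auto. unfold Rdiv. rewrite Rmult_assoc, Rinv_l; lra. }
  assert (Hl : 0 < ln (Psi z / B)) by (rewrite <- ln_1; apply ln_increasing; lra).
  assert (Hr2 : 0 < r ^ 2) by (apply pow_lt; auto).
  (* With this value of [e], [Key] reads [Psi z <= B * sqrt (Psi z / B)], which
     fails when [Psi z > B]. *)
  specialize (Key (ln (Psi z / B) / 2 / r ^ 2) ltac:(apply Rdiv_lt_0_compat; lra)).
  replace (ln (Psi z / B) / 2 / r ^ 2 * r ^ 2) with (ln (Psi z / B) / 2) in Key by (field; lra).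
  assert (X : exp (ln (Psi z / B) / 2) < Psi z / B).
  { rewrite <- (exp_ln (Psi z / B)) at 2 by lra. apply exp_increasing. lra. }
  apply (Rmult_lt_compat_l B) in X; auto.
  replace (B * (Psi z / B)) with (Psi z) in X by (field; lra). lra.
- specialize (Key 1 Rlt_0_1). rewrite <- HBz in Key. lra.
Qed.

(** * Superharmonic functions and the Poisson kernel *)

Definition superharmonic_at (u : C -> R) (z : C) : Prop :=
  exists K d, 0 < d /\ forall t, 0 < t < d ->
    u (z + t)%C + u (z - t)%C + (u (z + Ci * t)%C + u (z - Ci * t)%C) <= 4 * u z + K * t ^ 3.

Lemma superharmonic_plus u v z : superharmonic_at u z -> superharmonic_at v z ->
  superharmonic_at (fun z => u z + v z) z.
Proof.
intros (K & d & Hd & H) (K' & d' & Hd' & H').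
exists (K + K'), (Rmin d d'). split; [now apply Rmin_pos|]. intros t Ht.
pose proof (Rmin_l d d'). pose proof (Rmin_r d d').
specialize (H t ltac:(lra)). specialize (H' t ltac:(lra)). lra.
Qed.

Lemma superharmonic_scal c u z : 0 <= c -> superharmonic_at u z ->
  superharmonic_at (fun z => c * u z) z.
Proof.
intros Hc (K & d & Hd & H). exists (c * K), d. split; auto. intros t Ht.
specialize (H t Ht). nra.
Qed.

(** The exponential turns the sum of [u] over the quarter turns into a product,
    and defects of third order multiply to a defect of third order. *)
Lemma log_subharmonic_exp_superharmonic Psi u z : (forall z, 0 <= Psi z) ->
  log_subharmonic_at Psi z -> superharmonic_at u z ->
  log_subharmonic_at (fun z => Psi z * exp (- u z)) z.
Proof.
intros Hpos (M & d & Hd & HM) (K & d' & Hd' & HK).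
exists (Rabs M + Rabs K), (Rmin (Rmin d d') (Rmin 1 (Rmin (/ (Rabs M + 1)) (/ (Rabs K + 1))))).
pose proof (Rabs_pos M). pose proof (Rabs_pos K).
split; [repeat apply Rmin_pos; auto; try lra; apply Rinv_0_lt_compat; lra|].
intros t [Ht0 Ht].
assert (t < d /\ t < d' /\ t < 1 /\ t < / (Rabs M + 1) /\ t < / (Rabs K + 1)) as (T1 & T2 & T3 & T4 & T5).
{ apply Rmin_lt_inv in Ht as [Ht1 Ht2]. apply Rmin_lt_inv in Ht1, Ht2.
  destruct Ht2 as [Ht2 Ht3]. apply Rmin_lt_inv in Ht3. tauto. }
specialize (HM t ltac:(lra)). specialize (HK t ltac:(lra)).
assert (Hsm : forall a, 0 <= a -> t < / (a + 1) -> 0 <= a * t ^ 3 <= 1).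
{ intros a Ha Hta. assert (t * (a + 1) <= 1).
  { apply Rle_trans with (/ (a + 1) * (a + 1)); [apply Rmult_le_compat_r; lra|]. right; field; lra. }
  assert (0 <= t ^ 3 <= t).
  { split; [apply pow_le; lra|]. simpl. rewrite Rmult_1_r. assert (t * t <= 1) by nra. nra. }
  split; [apply Rmult_le_pos; lra|]. nra. }
pose proof (Hsm _ H T4) as S1. pose proof (Hsm _ H0 T5) as S2.
assert (t3 : 0 <= t ^ 3) by (apply pow_le; lra).
unfold quarter_turns.
match goal with |- _ <= ?X => replace X with (quarter_turns Psi z t *
  exp (- (u (z + t)%C + u (z - t)%C + (u (z + Ci * t)%C + u (z - Ci * t)%C)))) end.
2:{ unfold quarter_turns. rewrite !Ropp_plus_distr, !exp_plus. ring. }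
rewrite Rpow_mult_distr.
replace (exp (- u z) ^ 4) with (exp (- (4 * u z))).
2:{ replace (- (4 * u z)) with (- u z + - u z + (- u z + - u z)) by ring. rewrite !exp_plus. ring. }
assert (P4 : 0 <= Psi z ^ 4) by (apply pow_le; auto).
apply Rle_trans with (Psi z ^ 4 * (1 - Rabs M * t ^ 3) * (exp (- (4 * u z)) * (1 - Rabs K * t ^ 3))).
- pose proof (exp_pos (- (4 * u z))) as E.
  assert (0 <= Rabs M * t ^ 3 * (Rabs K * t ^ 3)) by (apply Rmult_le_pos; lra).
  replace (Psi z ^ 4 * (1 - Rabs M * t ^ 3) * (exp (- (4 * u z)) * (1 - Rabs K * t ^ 3)))
    with (Psi z ^ 4 * exp (- (4 * u z)) * ((1 - Rabs M * t ^ 3) * (1 - Rabs K * t ^ 3))) by ring.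
  apply Rmult_le_compat_l; [apply Rmult_le_pos; lra|]. lra.
- apply Rmult_le_compat.
  + apply Rmult_le_pos; lra.
  + apply Rmult_le_pos; [left; apply exp_pos|lra].
  + eapply Rle_trans; [|exact HM]. apply Rmult_le_compat_l; auto.
    pose proof (Rle_abs M). nra.
  + apply Rle_trans with (exp (- (4 * u z)) * exp (- (K * t ^ 3))).
    * apply Rmult_le_compat_l; [left; apply exp_pos|].
      pose proof (exp_ineq1_le (- (K * t ^ 3))). pose proof (Rle_abs K). nra.
    * rewrite <- exp_plus. destruct (Req_dec (u (z + t)%C + u (z - t)%C + (u (z + Ci * t)%C + u (z - Ci * t)%C)) (4 * u z + K * t ^ 3)) as [Q|Q].
      -- rewrite Q. right. f_equal. ring.
      -- left. apply exp_increasing. lra.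
Qed.

(** The usual kernel (see [poisson_eq]); as the real part of a rational function
    its sum over quarter turns can be computed exactly. *)
Definition poisson (zeta z : C) : R := Re (2 * zeta / (zeta - z))%C - 1.

Lemma poisson_eq zeta z : Cmod z < Cmod zeta ->
  poisson zeta z = (Cmod zeta ^ 2 - Cmod z ^ 2) / Cmod (zeta - z) ^ 2.
Proof.
intros H. assert (Hne : (zeta - z)%C <> 0).
{ intros E. apply Cminus_eq_0 in E. subst. lra. }
apply Cmod_gt_0 in Hne.
assert (Hq : Cmod (zeta - z) ^ 2 <> 0) by (apply pow_nonzero; lra).
rewrite Cmod2_alt in Hq. rewrite !Cmod2_alt. unfold poisson.
destruct zeta as [a b], z as [x y].
unfold Cdiv, Cinv, Cminus, Cplus, Copp, Cmult, RtoC, Re, Im in *. simpl in *. field.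
rewrite !Rmult_1_r in Hq. exact Hq.
Qed.

Lemma poisson_center (zeta : C) : zeta <> 0 -> poisson zeta 0 = 1.
Proof.
intros H. rewrite poisson_eq.
- replace (zeta - RtoC 0)%C with zeta by ring. rewrite Cmod_0. apply Cmod_gt_0 in H. field. lra.
- rewrite Cmod_0. now apply Cmod_gt_0.
Qed.

Lemma poisson_pos zeta z : Cmod z < Cmod zeta -> 0 <= poisson zeta z.
Proof.
intros H. rewrite poisson_eq by auto. apply Rmult_le_pos.
- pose proof (Cmod_ge_0 z). nra.
- left. apply Rinv_0_lt_compat. apply pow_lt.
  pose proof (Cmod_reverse_triangle zeta z). lra.
Qed.

Lemma poisson_far zeta z d : Cmod z < Cmod zeta -> 0 < d -> d <= Cmod (zeta - z) ->
  poisson zeta z <= (Cmod zeta ^ 2 - Cmod z ^ 2) / d ^ 2.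
Proof.
intros H Hd Hz. rewrite poisson_eq by auto. apply Rmult_le_compat_l.
- pose proof (Cmod_ge_0 z). nra.
- apply Rinv_le_contravar; [now apply pow_lt|]. apply pow_incr. lra.
Qed.

Lemma poisson_le_3 zeta z : 2 * Cmod z <= Cmod zeta -> 0 < Cmod zeta -> poisson zeta z <= 3.
Proof.
intros H H0. pose proof (Cmod_ge_0 z).
eapply Rle_trans; [apply (poisson_far _ _ (Cmod zeta - Cmod z)); try lra|].
- apply Cmod_reverse_triangle.
- replace ((Cmod zeta ^ 2 - Cmod z ^ 2) / (Cmod zeta - Cmod z) ^ 2)
   with ((Cmod zeta + Cmod z) / (Cmod zeta - Cmod z)) by (field; lra).
  apply Rmult_le_reg_r with (Cmod zeta - Cmod z); [lra|].
  unfold Rdiv. rewrite Rmult_assoc, Rinv_l; lra.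
Qed.

(** By partial fractions the sum over the quarter turns is [4] times the central
    value plus the real part of [8 * zeta * t ^ 4 / (A * (A ^ 4 - t ^ 4))],
    where [A = zeta - z]. *)
Lemma poisson_superharmonic zeta z : Cmod z < Cmod zeta -> superharmonic_at (poisson zeta) z.
Proof.
intros H. set (A := (zeta - z)%C).
assert (HA : 0 < Cmod A) by (unfold A; pose proof (Cmod_reverse_triangle zeta z); lra).
assert (Hne : A <> 0) by now apply Cmod_gt_0.
exists (16 * Cmod zeta / Cmod A ^ 5), (Rmin 1 (Cmod A / 2)).
split; [apply Rmin_pos; lra|]. intros t [Ht0 Ht].
pose proof (Rmin_l 1 (Cmod A / 2)). pose proof (Rmin_r 1 (Cmod A / 2)).
assert (Mt : Cmod (RtoC t) = t) by (apply Cmod_RtoC_pos; lra).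
assert (Nz : forall w, Cmod w = t -> (A - w)%C <> 0).
{ intros w Hw E. apply Cminus_eq_0 in E. rewrite <- E in Hw. lra. }
pose proof (Nz _ Mt) as N1.
pose proof (Nz (- RtoC t)%C ltac:(rewrite Cmod_opp; auto)) as N2.
assert (Wi : Cmod (Ci * RtoC t) = t) by (rewrite Cmod_mult, Cmod_Ci, Mt; ring).
pose proof (Nz _ Wi) as N3.
pose proof (Nz (- (Ci * RtoC t))%C ltac:(rewrite Cmod_opp; auto)) as N4.
assert (T4 : (A ^ 4 - t ^ 4)%C = ((A - t) * (A - - t) * ((A - Ci * t) * (A - - (Ci * t))))%C).
{ replace ((A - Ci * t) * (A - - (Ci * t)))%C with (A * A - Ci * Ci * (t * t))%C by ring.
  rewrite Ci_sqr. ring. }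
assert (D4 : (A ^ 4 - t ^ 4)%C <> 0).
{ rewrite T4. repeat apply Cmult_neq_0; auto. }
assert (L4 : Cmod A ^ 4 / 2 <= Cmod (A ^ 4 - t ^ 4)%C).
{ eapply Rle_trans; [|apply Cmod_reverse_triangle]. rewrite !Cmod_pow, Mt.
  assert (Hq : t ^ 4 <= (Cmod A / 2) ^ 4) by (apply pow_incr; lra).
  assert (0 < Cmod A ^ 4) by (now apply pow_lt).
  replace ((Cmod A / 2) ^ 4) with (Cmod A ^ 4 / 16) in Hq by field. lra. }
assert (E : (2 * zeta / (zeta - (z + t)) + 2 * zeta / (zeta - (z - t)) +
   (2 * zeta / (zeta - (z + Ci * t)) + 2 * zeta / (zeta - (z - Ci * t))))%C
   = (4 * (2 * zeta / (zeta - z)) + 8 * zeta * t ^ 4 / (A * (A ^ 4 - t ^ 4)))%C).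
{ replace (zeta - (z + t))%C with (A - t)%C by (unfold A; ring).
  replace (zeta - (z - t))%C with (A - - t)%C by (unfold A; ring).
  replace (zeta - (z + Ci * t))%C with (A - Ci * t)%C by (unfold A; ring).
  replace (zeta - (z - Ci * t))%C with (A - - (Ci * t))%C by (unfold A; ring).
  fold A.
  replace (2 * zeta / (A - t) + 2 * zeta / (A - - t))%C with (4 * zeta * A / ((A - t) * (A - - t)))%C
    by (field; auto).
  replace (2 * zeta / (A - Ci * t) + 2 * zeta / (A - - (Ci * t)))%C
    with (4 * zeta * A / ((A - Ci * t) * (A - - (Ci * t))))%C by (field; auto).
  assert (Q1 : ((A - t) * (A - - t))%C <> 0) by (apply Cmult_neq_0; auto).
  assert (Q2 : ((A - Ci * t) * (A - - (Ci * t)))%C <> 0) by (apply Cmult_neq_0; auto).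
  rewrite T4. revert Q1 Q2.
  replace ((A - t) * (A - - t))%C with (A * A - t * t)%C by ring.
  replace ((A - Ci * t) * (A - - (Ci * t)))%C with (A * A - Ci * Ci * (t * t))%C by ring.
  rewrite Ci_sqr.
  replace (A * A - - (1) * (t * t))%C with (A * A + t * t)%C by ring.
  intros Q1 Q2. field. auto. }
assert (R : forall x y : C, Re (x + y)%C = Re x + Re y) by (intros; reflexivity).
assert (E' := f_equal Re E). rewrite !R in E'.
unfold poisson.
assert (R4 : Re (4 * (2 * zeta / (zeta - z)))%C = 4 * Re (2 * zeta / (zeta - z))%C).
{ generalize (2 * zeta / (zeta - z))%C. intros [x y]. unfold Re, Cmult, RtoC; simpl. ring. }
rewrite R4 in E'.
assert (Bd : Re (8 * zeta * t ^ 4 / (A * (A ^ 4 - t ^ 4)))%C <= 16 * Cmod zeta / Cmod A ^ 5 * t ^ 3).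
{ eapply Rle_trans; [apply Rle_abs|]. eapply Rle_trans; [apply re_le_Cmod|].
  rewrite Cmod_div by (apply Cmult_neq_0; auto).
  rewrite !Cmod_mult, Cmod_pow, Mt, (Cmod_RtoC_pos 8) by lra.
  assert (P5 : 0 < Cmod A ^ 4) by (now apply pow_lt).
  apply Rle_trans with (8 * Cmod zeta * t ^ 3 * / (Cmod A * (Cmod A ^ 4 / 2))).
  - apply Rmult_le_compat.
    + apply Rmult_le_pos; [|apply pow_le; lra]. pose proof (Cmod_ge_0 zeta). lra.
    + left. apply Rinv_0_lt_compat. apply Rmult_lt_0_compat; auto. now apply Cmod_gt_0.
    + apply Rmult_le_compat_l; [pose proof (Cmod_ge_0 zeta); lra|].
      replace (t ^ 4) with (t ^ 3 * t) by ring. rewrite <- (Rmult_1_r (t ^ 3)) at 2.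
      apply Rmult_le_compat_l; [apply pow_le|]; lra.
    + apply Rinv_le_contravar; [apply Rmult_lt_0_compat; lra|].
      apply Rmult_le_compat_l; lra.
  - right. field. lra. }
lra.
Qed.

(** * Finite sums and roots of unity *)

Fixpoint rsum (f : nat -> R) (n : nat) : R :=
  match n with O => 0 | S n => rsum f n + f n end.

Fixpoint csum (f : nat -> C) (n : nat) : C :=
  match n with O => RtoC 0 | S n => (csum f n + f n)%C end.

Lemma rsum_ext f g n : (forall k, (k < n)%nat -> f k = g k) -> rsum f n = rsum g n.
Proof. induction n as [|n IH]; intros H; simpl; auto. rewrite IH, H; auto. Qed.

Lemma rsum_le f g n : (forall k, (k < n)%nat -> f k <= g k) -> rsum f n <= rsum g n.
Proof.
induction n as [|n IH]; intros H; simpl; [lra|].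
apply Rplus_le_compat; auto.
Qed.

Lemma rsum_pos f n : (forall k, (k < n)%nat -> 0 <= f k) -> 0 <= rsum f n.
Proof.
induction n as [|n IH]; intros H; simpl; [lra|].
apply Rplus_le_le_0_compat; auto.
Qed.

Lemma rsum_plus f g n : rsum (fun k => f k + g k) n = rsum f n + rsum g n.
Proof. induction n as [|n IH]; simpl; [|rewrite IH]; lra. Qed.

Lemma rsum_scal c f n : rsum (fun k => c * f k) n = c * rsum f n.
Proof. induction n as [|n IH]; simpl; [|rewrite IH]; lra. Qed.

Lemma rsum_const c n : rsum (fun _ => c) n = INR n * c.
Proof.
induction n as [|n IH]; [simpl; lra|].
rewrite S_INR. simpl. rewrite IH. lra.
Qed.

Lemma rsum_swap (f : nat -> nat -> R) n m :
  rsum (fun k => rsum (f k) m) n = rsum (fun j => rsum (fun k => f k j) n) m.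
Proof.
induction n as [|n IH]; simpl.
- induction m as [|m IHm]; simpl; lra.
- rewrite IH, <- rsum_plus. reflexivity.
Qed.

Lemma rsum_single f n j : (j < n)%nat -> (forall k, (k < n)%nat -> 0 <= f k) -> f j <= rsum f n.
Proof.
induction n as [|n IH]; intros Hj Hf; [lia|]. simpl.
destruct (Nat.eq_dec j n) as [->|Hne].
- assert (0 <= rsum f n) by (apply rsum_pos; auto). lra.
- assert (f j <= rsum f n) by (apply IH; auto; lia). specialize (Hf n ltac:(lia)). lra.
Qed.

Lemma csum_ext f g n : (forall k, (k < n)%nat -> f k = g k) -> csum f n = csum g n.
Proof. induction n as [|n IH]; intros H; simpl; auto. rewrite IH, H; auto. Qed.

Lemma csum_plus f g n : csum (fun k => f k + g k)%C n = (csum f n + csum g n)%C.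
Proof. induction n as [|n IH]; simpl; [|rewrite IH]; ring. Qed.

Lemma csum_scal c f n : csum (fun k => c * f k)%C n = (c * csum f n)%C.
Proof. induction n as [|n IH]; simpl; [|rewrite IH]; ring. Qed.

Lemma csum_0 n : csum (fun _ => RtoC 0) n = 0.
Proof. induction n as [|n IH]; simpl; [|rewrite IH]; try ring; auto. Qed.

Lemma csum_swap (f : nat -> nat -> C) n m :
  csum (fun k => csum (f k) m) n = csum (fun j => csum (fun k => f k j) n) m.
Proof.
induction n as [|n IH]; simpl.
- now rewrite csum_0.
- rewrite IH, <- csum_plus. reflexivity.
Qed.

Lemma csum_geometric (q : C) n : ((1 - q) * csum (fun k => q ^ k) n = 1 - q ^ n)%C.
Proof.
induction n as [|n IH]; [simpl; ring|].
change (csum (fun k => q ^ k)%C (S n)) with (csum (fun k => q ^ k)%C n + q ^ n)%C.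
rewrite Cmult_plus_distr_l, IH, Cpow_S. ring.
Qed.

Lemma Re_csum f n : Re (csum f n) = rsum (fun k => Re (f k)) n.
Proof. induction n as [|n IH]; simpl; auto. rewrite <- IH. reflexivity. Qed.

Definition angle (m k : nat) : R := 2 * PI * INR k / INR m.

Lemma cis_neq_1 t : 0 < t < 2 * PI -> cis (- t) <> 1.
Proof.
intros Ht E. assert (Ec : cos (- t) = 1) by exact (f_equal fst E).
rewrite cos_neg in Ec. replace t with (2 * (t / 2)) in Ec by field.
rewrite cos_2a_sin in Ec. pose proof (sin_gt_0 (t / 2) ltac:(lra) ltac:(lra)). nra.
Qed.

Lemma cis_2PI_INR k : cis (- (2 * PI * INR k)) = 1.
Proof.
induction k as [|k IH].
- simpl. rewrite Rmult_0_r, Ropp_0. apply cis_0.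
- rewrite <- cis_2PI, S_INR. rewrite <- IH. f_equal. ring.
Qed.

Lemma csum_roots_of_unity m j : (0 < j < m)%nat ->
  csum (fun k => cis (- angle m k) ^ j)%C m = 0.
Proof.
intros Hj. assert (Hm : 0 < INR m) by (apply lt_0_INR; lia).
assert (Hj0 : 0 < INR j) by (apply lt_0_INR; lia).
assert (Hjm : INR j < INR m) by (apply lt_INR; lia).
pose proof PI_RGT_0.
rewrite (csum_ext _ (fun k => cis (- angle m j) ^ k)%C).
2:{ intros k _. rewrite !cis_pow. f_equal. unfold angle. field. lra. }
assert (Hq : (1 - cis (- angle m j))%C <> 0).
{ intros E. apply Cminus_eq_0 in E. symmetry in E. revert E. apply cis_neq_1.
  unfold angle. split.
  - apply Rdiv_lt_0_compat; auto. apply Rmult_lt_0_compat; lra.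
  - apply Rmult_lt_reg_r with (INR m); auto. unfold Rdiv.
    rewrite Rmult_assoc, Rinv_l by lra. nra. }
pose proof (csum_geometric (cis (- angle m j)) m) as G.
rewrite cis_pow in G.
replace (INR m * - angle m j) with (- (2 * PI * INR j)) in G by (unfold angle; field; lra).
rewrite cis_2PI_INR in G. replace (1 - 1)%C with (RtoC 0) in G by ring.
apply Cmult_integral in G; destruct G as [G|G]; auto; contradiction.
Qed.

(** * Poisson majorants on sampled circles *)

Definition sample (r : R) (m k : nat) : C := (r * cis (angle m k))%C.

Lemma Cmod_sample r m k : 0 <= r -> Cmod (sample r m k) = r.
Proof. intros. unfold sample. rewrite Cmod_mult, Cmod_cis, Cmod_RtoC_pos; lra. Qed.

Lemma RtoC_neq_0 x : x <> 0 -> RtoC x <> 0.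
Proof. intros H E. apply H. now injection E. Qed.

Lemma cis_inv t : (cis t * cis (- t))%C = 1.
Proof. rewrite <- cis_plus, Rplus_opp_r. apply cis_0. Qed.

Lemma Cpow_neq_1 (x : C) n : Cmod x < 1 -> (0 < n)%nat -> (1 - x ^ n)%C <> 0.
Proof.
intros Hx Hn E. apply Cminus_eq_0 in E.
assert (Hm : Cmod (x ^ n)%C = 1) by (rewrite <- E; apply Cmod_1).
rewrite Cmod_pow in Hm. destruct n as [|n]; [lia|].
assert (Cmod x ^ n <= 1) by (rewrite <- (pow1 n); apply pow_incr; pose proof (Cmod_ge_0 x); lra).
simpl in Hm. pose proof (Cmod_ge_0 x). pose proof (pow_le (Cmod x) n H0). nra.
Qed.

(** Up to the factor [1 - (z / rho) ^ m], common to all [k], each term is a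
    truncated geometric series in [z / sample rho m k]; in the sum over [k] all
    powers but the zeroth cancel because they run through roots of unity. *)
Lemma csum_kernel rho m z : 0 < rho -> (0 < m)%nat -> Cmod z < rho ->
  csum (fun k => sample rho m k / (sample rho m k - z))%C m
  = (INR m / (1 - (z / rho) ^ m))%C.
Proof.
intros Hr Hm Hz. pose proof (RtoC_neq_0 rho ltac:(lra)) as Hr'.
assert (Hx : Cmod (z / rho)%C < 1).
{ rewrite Cmod_div, (Cmod_RtoC_pos rho) by (auto; lra).
  apply Rmult_lt_reg_r with rho; auto. unfold Rdiv. rewrite Rmult_assoc, Rinv_l; lra. }
pose proof (Cpow_neq_1 _ _ Hx Hm) as HQ.
assert (HmR : 0 < INR m) by (now apply lt_0_INR).
rewrite (csum_ext _ (fun k => / (1 - (z / rho) ^ m) *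
   csum (fun j => (z / rho) ^ j * cis (- angle m k) ^ j) m)%C).
- rewrite csum_scal, csum_swap.
  rewrite (csum_ext _ (fun j => if Nat.eq_dec j 0 then RtoC (INR m) else RtoC 0)).
  + assert (S : forall n, (0 < n)%nat ->
       csum (fun j => if Nat.eq_dec j 0 then RtoC (INR m) else RtoC 0) n = INR m).
    { induction n as [|n IH]; intros Hn; [lia|]. simpl.
      destruct n as [|n]; [simpl; ring|]. rewrite IH by lia. simpl. ring. }
    rewrite S by auto. field. auto.
  + intros j Hj. rewrite csum_scal. destruct (Nat.eq_dec j 0) as [->|Hj0].
    * simpl. assert (S : forall n, csum (fun _ => RtoC 1) n = INR n).
      { induction n as [|n IH]; [reflexivity|]. rewrite S_INR. simpl. rewrite IH, RtoC_plus. ring. }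
      rewrite S. ring.
    * rewrite csum_roots_of_unity by lia. ring.
- intros k _. set (x := (z / rho * cis (- angle m k))%C).
  assert (Hx1 : Cmod x < 1) by (unfold x; rewrite Cmod_mult, Cmod_cis; lra).
  assert (Hxm : (x ^ m = (z / rho) ^ m)%C).
  { unfold x. rewrite Cpow_mult_l, cis_pow.
    replace (INR m * - angle m k) with (- (2 * PI * INR k)) by (unfold angle; field; lra).
    rewrite cis_2PI_INR. ring. }
  rewrite (csum_ext _ (fun j => x ^ j)%C) by (intros; unfold x; now rewrite Cpow_mult_l).
  pose proof (csum_geometric x m) as G. rewrite Hxm in G.
  assert (H1x : (1 - x)%C <> 0).
  { pose proof (Cpow_neq_1 x 1 Hx1 ltac:(lia)) as H. now rewrite Cpow_1_r in H. }
  assert (Hz' : (sample rho m k - z)%C = (sample rho m k * (1 - x))%C).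
  { unfold sample, x.
    replace (rho * cis (angle m k) * (1 - z / rho * cis (- angle m k)))%C with
     (rho * cis (angle m k) - z / rho * rho * (cis (angle m k) * cis (- angle m k)))%C by ring.
    rewrite cis_inv. field. auto. }
  assert (Hs : sample rho m k <> 0).
  { apply Cmod_gt_0. rewrite Cmod_sample; lra. }
  rewrite Hz'. rewrite <- (Cmult_1_l (csum _ _)).
  replace (RtoC 1 * csum (fun j => x ^ j) m)%C with (/ (1 - x) * ((1 - x) * csum (fun j => x ^ j) m))%C
    by (field; auto).
  rewrite G. field. auto.
Qed.

(** The kernels are an approximate identity: their mean is 1 up to an error of
    order [(Cmod z / rho) ^ m]. *)
Lemma poisson_average rho m z kappa : 0 < rho -> (0 < m)%nat -> Cmod z < rho ->
  (Cmod z / rho) ^ m <= 1 / 2 -> 4 * (Cmod z / rho) ^ m <= kappa ->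
  INR m * (1 - kappa) <= rsum (fun k => poisson (sample rho m k) z) m.
Proof.
intros Hr Hm Hz H2 Hk. pose proof (RtoC_neq_0 rho ltac:(lra)) as Hr'.
assert (HmR : 0 < INR m) by (now apply lt_0_INR).
set (Q := ((z / rho) ^ m)%C).
assert (HQ : Cmod Q = (Cmod z / rho) ^ m).
{ unfold Q. rewrite Cmod_pow, Cmod_div, (Cmod_RtoC_pos rho); auto; lra. }
rewrite (rsum_ext _ (fun k => 2 * Re (sample rho m k / (sample rho m k - z))%C + -1)).
- rewrite rsum_plus, rsum_scal, rsum_const, <- Re_csum, csum_kernel by auto. fold Q.
  assert (H1Q : 1/2 <= Cmod (1 - Q)%C).
  { pose proof (Cmod_reverse_triangle 1 Q). rewrite Cmod_1 in H. lra. }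
  assert (HnQ : (1 - Q)%C <> 0) by (apply Cmod_gt_0; lra).
  replace (INR m / (1 - Q))%C with (INR m * (1 + Q / (1 - Q)))%C by (field; auto).
  assert (ER : forall (x : R) y, Re (x * (1 + y))%C = x * (1 + Re y)).
  { intros x [y y']. unfold Re, Cmult, Cplus, RtoC; simpl. ring. }
  rewrite ER.
  assert (B : - (2 * Cmod Q) <= Re (Q / (1 - Q))%C).
  { assert (Rabs (Re (Q / (1 - Q))%C) <= 2 * Cmod Q).
    { eapply Rle_trans; [apply re_le_Cmod|]. rewrite Cmod_div by auto.
      unfold Rdiv. rewrite (Rmult_comm 2). apply Rmult_le_compat_l; [apply Cmod_ge_0|].
      rewrite <- (Rinv_inv 2). apply Rinv_le_contravar; lra. }
    unfold Rabs in H. destruct (Rcase_abs _); lra. }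
  nra.
- intros k _. unfold poisson.
  replace (2 * sample rho m k / (sample rho m k - z))%C with
    (2 * (sample rho m k / (sample rho m k - z)))%C by (unfold Cdiv; ring).
  generalize (sample rho m k / (sample rho m k - z))%C. intros [x y].
  unfold Re, Cmult, RtoC; simpl. ring.
Qed.

Definition sample_mean (l : C -> R) (r : R) (m : nat) : R :=
  rsum (fun k => l (sample r m k)) m / INR m.

(** The mean [u] of [l] at the samples, weighted with Poisson kernels, is
    superharmonic; hence [Psi * exp (- u)] is log-subharmonic and it is enough
    to bound it by [exp eps] on the circle. The poles of the kernels are put on
    a slightly larger circle, so that [u] is defined on the closed disc; on the
    circle of radius [r] the kernels concentrate near the point considered, and
    uniform continuity of [l] gives [l <= u + eps]. At the centre the kernels
    equal 1, and on the half disc they are at most 3. *)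
Lemma poisson_majorant (Psi l : C -> R) r B eps : 0 < r -> 0 < eps ->
  (forall z, 0 <= Psi z) ->
  (forall z, Cmod z <= r -> Ccontinuous_at Psi z) ->
  (forall z, Cmod z < r -> log_subharmonic_at Psi z) ->
  (forall z, Cmod z = r -> Psi z <= exp (l z)) ->
  (forall z, Cmod z = r -> 0 <= l z <= B) ->
  (forall e, 0 < e -> exists d, 0 < d /\ forall z z', Cmod z = r -> Cmod z' = r ->
     Cmod (z - z') < d -> l z <= l z' + e) ->
  exists m0, forall m, (m0 <= m)%nat -> (0 < m)%nat ->
    Psi 0 <= exp (eps + sample_mean l r m) /\
    forall z, Cmod z <= r / 2 -> Psi z <= exp (eps + 3 * sample_mean l r m).
Proof.
intros Hr Heps Hpos Hcont Hls Hl HB Huc.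
assert (HB0 : 0 <= B).
{ destruct (HB r) as [H1 H2]; [apply Cmod_RtoC_pos; lra|]. lra. }
set (e := eps / 3). assert (He : 0 < e) by (unfold e; lra).
destruct (Huc e He) as (d & Hd & Hu).
set (kappa := e / (B + 1)). assert (Hkap : 0 < kappa) by (apply Rdiv_lt_0_compat; lra).
(* A kernel with pole at distance [h] from the circle is at most [kappa] at
   points of the circle at distance [d / 2] or more from the pole. *)
set (h := Rmin (d / 2) (Rmin r (kappa * (d / 2) ^ 2 / (3 * r)))).
assert (Hd2 : 0 < (d / 2) ^ 2) by (apply pow_lt; lra).
assert (Hh : 0 < h).
{ unfold h. repeat apply Rmin_pos; try lra. apply Rdiv_lt_0_compat; [apply Rmult_lt_0_compat|]; lra. }
assert (Hh1 : h <= d / 2) by apply Rmin_l.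
assert (Hh2 : h <= r) by (eapply Rle_trans; [apply Rmin_r|apply Rmin_l]).
assert (Hh3 : h <= kappa * (d / 2) ^ 2 / (3 * r)) by (eapply Rle_trans; [apply Rmin_r|apply Rmin_r]).
set (rho := r + h).
assert (Hq : Rabs (r / rho) < 1).
{ rewrite Rabs_pos_eq by (apply Rlt_le, Rdiv_lt_0_compat; unfold rho; lra).
  apply Rmult_lt_reg_r with rho; [unfold rho; lra|]. unfold Rdiv.
  rewrite Rmult_assoc, Rinv_l; unfold rho; lra. }
destruct (pow_lt_1_zero (r / rho) Hq (Rmin (1/2) (kappa / 4))) as (m0 & Hm0).
{ apply Rmin_pos; lra. }
exists m0. intros m Hm Hmp. specialize (Hm0 m Hm).
rewrite Rabs_pos_eq in Hm0 by (apply pow_le, Rlt_le, Rdiv_lt_0_compat; unfold rho; lra).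
apply Rmin_lt_inv in Hm0 as [Hq1 Hq2].
assert (HmR : 0 < INR m) by (now apply lt_0_INR).
set (u := fun z => / INR m * rsum (fun k => l (sample r m k) * poisson (sample rho m k) z) m).
assert (Hlk : forall k, 0 <= l (sample r m k) <= B) by (intros; apply HB, Cmod_sample; lra).
assert (Hsr : forall k, Cmod (sample rho m k) = rho) by (intros; apply Cmod_sample; unfold rho; lra).
assert (Hup : forall z, Cmod z <= r -> 0 <= u z).
{ intros z Hz. apply Rmult_le_pos; [left; now apply Rinv_0_lt_compat|]. apply rsum_pos.
  intros k _. apply Rmult_le_pos; [apply Hlk|]. apply poisson_pos. rewrite Hsr. unfold rho; lra. }
assert (Hbd : forall z, Cmod z = r -> l z - u z <= eps).
{ intros z Hz. destruct (Rle_lt_dec (l z) e) as [Hle|Hgt].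
  { pose proof (Hup z ltac:(lra)). unfold e in *. lra. }
  assert (Hpt : forall k, (l z - e) * poisson (sample rho m k) z - B * kappa
             <= l (sample r m k) * poisson (sample rho m k) z).
  { intros k. assert (Hzs : Cmod z < Cmod (sample rho m k)) by (rewrite Hsr; unfold rho; lra).
    pose proof (poisson_pos _ _ Hzs) as Hpp. pose proof (HB z Hz) as HBz.
    assert (0 <= B * kappa) by (apply Rmult_le_pos; lra).
    destruct (Rlt_le_dec (Cmod (sample rho m k - z)) (d / 2)) as [Hn|Hf].
    - assert (l z <= l (sample r m k) + e).
      { apply Hu; auto; [apply Cmod_sample; lra|].
        replace (z - sample r m k)%C with (- (sample rho m k - z) + (sample rho m k - sample r m k))%C by ring.
        eapply Rle_lt_trans; [apply Cmod_triangle|]. rewrite Cmod_opp.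
        replace (sample rho m k - sample r m k)%C with (h * cis (angle m k))%C
          by (unfold sample, rho; rewrite RtoC_plus; ring).
        rewrite Cmod_mult, Cmod_cis, Cmod_RtoC_pos; lra. }
      assert ((l z - e) * poisson (sample rho m k) z <= l (sample r m k) * poisson (sample rho m k) z)
        by (apply Rmult_le_compat_r; lra). lra.
    - assert (Hpf : poisson (sample rho m k) z <= kappa).
      { eapply Rle_trans; [apply (poisson_far _ _ (d / 2)); auto; lra|].
        rewrite Hsr, Hz. apply Rmult_le_reg_r with ((d / 2) ^ 2); auto.
        unfold Rdiv at 1. rewrite Rmult_assoc, Rinv_l, Rmult_1_r by lra.
        replace (rho ^ 2 - r ^ 2) with (h * (2 * r + h)) by (unfold rho; ring).
        apply Rle_trans with (h * (3 * r)); [apply Rmult_le_compat_l; lra|].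
        apply Rle_trans with (kappa * (d / 2) ^ 2 / (3 * r) * (3 * r)).
        - apply Rmult_le_compat_r; lra.
        - right. field. lra. }
      assert ((l z - e) * poisson (sample rho m k) z <= B * kappa) by (apply Rmult_le_compat; lra).
      assert (0 <= l (sample r m k) * poisson (sample rho m k) z)
        by (apply Rmult_le_pos; auto; apply Hlk). lra. }
  assert (Hav : INR m * (1 - kappa) <= rsum (fun k => poisson (sample rho m k) z) m).
  { apply poisson_average; auto; try (unfold rho; lra); rewrite Hz; lra. }
  assert (Hsum : (l z - e) * (INR m * (1 - kappa)) - INR m * (B * kappa)
     <= rsum (fun k => l (sample r m k) * poisson (sample rho m k) z) m).
  { eapply Rle_trans; [|apply rsum_le; intros k _; apply Hpt].
    rewrite (rsum_ext _ (fun k => (l z - e) * poisson (sample rho m k) z + - (B * kappa))) by (intros; ring).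
    rewrite rsum_plus, rsum_scal, rsum_const.
    assert ((l z - e) * (INR m * (1 - kappa)) <= (l z - e) * rsum (fun k => poisson (sample rho m k) z) m)
      by (apply Rmult_le_compat_l; lra). lra. }
  assert (Hu2 : (l z - e) * (1 - kappa) - B * kappa <= u z).
  { unfold u. apply Rmult_le_reg_l with (INR m); auto. rewrite <- Rmult_assoc, Rinv_r by lra. lra. }
  pose proof (HB z Hz).
  assert (Hk1 : kappa * (B + 1) = e) by (unfold kappa; field; lra).
  assert ((l z - e) * kappa <= B * kappa) by (apply Rmult_le_compat_r; lra).
  replace eps with (3 * e) by (unfold e; field). lra. }
assert (Main : forall z, Cmod z <= r -> Psi z * exp (- u z) <= exp eps).
{ apply maximum_principle; auto.
  - intros z. apply Rmult_le_pos; auto. left; apply exp_pos.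
  - intros z Hz. apply Ccontinuous_mult; auto.
    assert (Hcu : forall n, Ccontinuous_at (fun z => rsum (fun k => l (sample r m k) * poisson (sample rho m k) z) n) z).
    { induction n as [|n IH]; simpl; [apply Ccontinuous_const|]. apply Ccontinuous_plus; auto.
      apply Ccontinuous_mult; [apply Ccontinuous_const|].
      unfold poisson. apply Ccontinuous_plus; [|apply Ccontinuous_const].
      assert (Hg : germ 1 (fun z => 2 * sample rho m n / (sample rho m n - z))%C z).
      { apply germ_mult; [apply germ_const|]. apply (germ_inv 0).
        - apply germ_plus; [apply germ_const|].
          apply (germ_ext _ (fun z => (- (1)) * z)%C _ _ 1); [lra|intros; ring|].
          apply germ_mult; [apply germ_const|apply germ_id].
        - intros E. apply Cminus_eq_0 in E. rewrite <- E, Hsr in Hz. unfold rho in Hz; lra. }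
      intros e' He'. destruct (germ_continuous _ _ Hg e' He') as (d' & Hd' & E').
      exists d'; split; auto. intros z' Hz'. eapply Rle_lt_trans; [|apply (E' z' Hz')].
      eapply Rle_trans; [|apply re_le_Cmod]. right. f_equal. }
    apply (Ccontinuous_comp exp (fun z => - u z)).
    + apply derivable_continuous_pt, derivable_pt_exp.
    + intros e' He'. destruct (Ccontinuous_mult (fun _ => - / INR m) _ z (Ccontinuous_const _ _) (Hcu m) e' He') as (d' & Hd' & E').
      exists d'; split; auto. intros z' Hz'. specialize (E' z' Hz'). unfold u.
      rewrite !Ropp_mult_distr_l. exact E'.
  - intros z Hz. apply log_subharmonic_exp_superharmonic; auto.
    apply superharmonic_scal; [left; now apply Rinv_0_lt_compat|].
    assert (Hs0 : superharmonic_at (fun _ => 0) z).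
    { exists 0, 1. split; [lra|]. intros; lra. }
    generalize m at 3. intros n. induction n as [|n IH]; simpl; auto.
    apply superharmonic_plus; auto. apply superharmonic_scal; [apply Hlk|].
    apply poisson_superharmonic. rewrite Hsr. unfold rho; lra.
  - intros z Hz. apply Rle_trans with (exp (l z) * exp (- u z)).
    + apply Rmult_le_compat_r; [left; apply exp_pos|auto].
    + rewrite <- exp_plus. specialize (Hbd z Hz).
      destruct (Req_dec (l z + - u z) eps) as [Q|Q]; [rewrite Q; lra|].
      left; apply exp_increasing; lra. }
assert (Main2 : forall z v, Cmod z <= r -> u z <= v -> Psi z <= exp (eps + v)).
{ intros z v Hz Hv. specialize (Main z Hz). rewrite exp_Ropp in Main.
  apply (Rmult_le_compat_r (exp (u z))) in Main; [|left; apply exp_pos].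
  rewrite Rmult_assoc, Rinv_l, Rmult_1_r, <- exp_plus in Main by (pose proof (exp_pos (u z)); lra).
  eapply Rle_trans; [exact Main|].
  destruct (Req_dec (u z) v) as [Q|Q]; [rewrite Q; lra|]. left; apply exp_increasing; lra. }
split.
- apply Main2; [rewrite Cmod_0; lra|]. unfold u, sample_mean, Rdiv. right.
  rewrite Rmult_comm. f_equal. apply rsum_ext. intros k _.
  rewrite poisson_center; [ring|]. apply Cmod_gt_0. rewrite Hsr. unfold rho; lra.
- intros z Hz. apply Main2; [lra|]. unfold u, sample_mean, Rdiv.
  replace (3 * (rsum (fun k => l (sample r m k)) m * / INR m))
    with (/ INR m * rsum (fun k => 3 * l (sample r m k)) m) by (rewrite rsum_scal; ring).
  apply Rmult_le_compat_l; [left; now apply Rinv_0_lt_compat|]. apply rsum_le. intros k _.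
  rewrite Rmult_comm. apply Rmult_le_compat_r; [apply Hlk|]. apply poisson_le_3; rewrite Hsr; unfold rho; lra.
Qed.

(** * Truncated logarithms *)

Definition log_plus (x : R) : R := ln (Rmax 1 x).

Lemma log_plus_pos x : 0 <= log_plus x.
Proof.
unfold log_plus. rewrite <- ln_1. apply ln_le; [lra|apply Rmax_l].
Qed.

Lemma le_exp_log_plus x : x <= exp (log_plus x).
Proof.
unfold log_plus. rewrite exp_ln; [apply Rmax_r|]. pose proof (Rmax_l 1 x). lra.
Qed.

Lemma log_plus_le_of_exp x y : 0 <= y -> x <= exp y -> log_plus x <= y.
Proof.
intros Hy H. rewrite <- (ln_exp y). apply ln_le.
- pose proof (Rmax_l 1 x). lra.
- apply Rmax_lub; auto. rewrite <- exp_0. destruct Hy as [Hy| <-]; [|lra].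
  left. now apply exp_increasing.
Qed.

Lemma exp_le x y : x <= y -> exp x <= exp y.
Proof. intros [H| ->]; [left; now apply exp_increasing|lra]. Qed.

Lemma exp_le_inv x y : exp x <= exp y -> x <= y.
Proof. intros H. apply Rnot_lt_le. intros Hlt. apply exp_increasing in Hlt. lra. Qed.

Lemma log_plus_le x y : x <= y -> log_plus x <= log_plus y.
Proof.
intros H. apply log_plus_le_of_exp; [apply log_plus_pos|].
eapply Rle_trans; [exact H|apply le_exp_log_plus].
Qed.

Lemma continuity_pt_log_plus x : continuity_pt log_plus x.
Proof.
apply (continuity_pt_comp (fun x => Rmax 1 x) ln).
- apply continuity_pt_filterlim. intros P [e He]. exists e. intros y Hy. apply He.
  change (Rabs (Rmax 1 y - Rmax 1 x) < e). change (Rabs (y - x) < e) in Hy.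
  eapply Rle_lt_trans; [|exact Hy].
  unfold Rmax. repeat match goal with |- context [Rle_dec ?p ?q] => destruct (Rle_dec p q) end;
  unfold Rabs; repeat match goal with |- context [Rcase_abs ?p] => destruct (Rcase_abs p) end; lra.
- apply derivable_continuous_pt. eexists. apply derivable_pt_lim_ln.
  pose proof (Rmax_l 1 x). lra.
Qed.

Lemma germ_le k j f z : (j <= k)%nat -> germ k f z -> germ j f z.
Proof. induction 1; auto. intros H'. apply IHle, germ_S, H'. Qed.

(** At the centre this is Jensen's inequality, on the half disc a bound of
    Harnack type by three times the mean. *)
Lemma poisson_log_plus (f : C -> C) r eps : 0 < r -> 0 < eps ->
  (forall z, Cmod z <= 2 * r -> germ 3 f z) ->
  exists m0, forall m, (m0 <= m)%nat -> (0 < m)%nat ->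
    Cmod (f 0) <= exp (eps + sample_mean (fun z => log_plus (Cmod (f z))) r m) /\
    forall z, Cmod z <= r / 2 ->
      Cmod (f z) <= exp (eps + 3 * sample_mean (fun z => log_plus (Cmod (f z))) r m).
Proof.
intros Hr He Hf.
assert (Hc : forall z, Cmod z <= 2 * r -> Ccontinuous_at (fun z => Cmod (f z)) z).
{ intros z Hz. apply Ccontinuous_germ, (germ_le 3); auto. }
assert (Hc2 : forall z, Cmod z <= 2 * r -> Ccontinuous_at (fun z => log_plus (Cmod (f z))) z).
{ intros z Hz. apply Ccontinuous_comp; [apply continuity_pt_log_plus|]. now apply Hc. }
destruct (disc_max (fun z => log_plus (Cmod (f z))) r) as (z1 & Hz1 & HB); [lra| |].
{ intros z Hz. apply Hc2. lra. }
apply (poisson_majorant (fun z => Cmod (f z)) (fun z => log_plus (Cmod (f z))) r (log_plus (Cmod (f z1))) eps); auto.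
- intros z. apply Cmod_ge_0.
- intros z Hz. apply Hc. lra.
- intros z Hz. apply log_subharmonic_germ, Hf. lra.
- intros z Hz. apply le_exp_log_plus.
- intros z Hz. split; [apply log_plus_pos|]. apply HB. lra.
- intros e He'.
  assert (Hbox : forall x y, - r <= x <= r -> - r <= y <= r -> Cmod (x, y) <= 2 * r).
  { intros x y Hx Hy. eapply Rle_trans; [apply Cmod_2Rmax|]. simpl.
    assert (S2 : sqrt 2 <= 2).
    { rewrite <- (sqrt_square 2) at 2 by lra. apply sqrt_le_1_alt. lra. }
    apply Rmult_le_compat; auto using sqrt_pos.
    - eapply Rle_trans; [apply Rabs_pos|apply Rmax_l].
    - apply Rmax_lub; apply Rabs_le; lra. }
  destruct (uniform_continuity_2d (fun x y => log_plus (Cmod (f (x, y)))) (- r) r (- r) r)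
    with (eps := mkposreal e He') as (d & Hd).
  { intros x y Hx Hy e'. destruct (Hc2 (x, y) (Hbox x y Hx Hy) e' (cond_pos e')) as (d & Hd & E).
    assert (Hd2 : 0 < d / 2) by lra.
    exists (mkposreal _ Hd2). intros x' y' Hx' Hy'. simpl in Hx', Hy'. apply E.
    change ((x', y') - (x, y))%C with ((x' - x), (y' - y)).
    eapply Rle_lt_trans; [apply Cmod_2Rmax|]. simpl.
    assert (S2 : sqrt 2 < 2).
    { rewrite <- (sqrt_square 2) at 2 by lra. apply sqrt_lt_1_alt. lra. }
    pose proof (Rmax_lub_lt (Rabs (x' - x)) (Rabs (y' - y)) (d / 2) Hx' Hy').
    pose proof (Rle_trans _ _ _ (Rabs_pos (x' - x)) (Rmax_l (Rabs (x' - x)) (Rabs (y' - y)))).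
    pose proof (sqrt_pos 2).
    apply Rle_lt_trans with (2 * Rmax (Rabs (x' - x)) (Rabs (y' - y))); [|lra].
    apply Rmult_le_compat_r; lra. }
  exists d. split; [apply cond_pos|]. intros [x y] [x' y'] Hz Hz' Hd'.
  assert (Hxy : forall x y, Cmod (x, y) = r -> - r <= x <= r /\ - r <= y <= r).
  { intros u v Huv. pose proof (Rmax_Cmod (u, v)) as Hm. simpl in Hm. rewrite Huv in Hm.
    pose proof (Rmax_l (Rabs u) (Rabs v)). pose proof (Rmax_r (Rabs u) (Rabs v)).
    split; apply Rabs_le_between; lra. }
  destruct (Hxy _ _ Hz) as [B1 B2]. destruct (Hxy _ _ Hz') as [B3 B4].
  change ((x, y) - (x', y'))%C with ((x - x'), (y - y')) in Hd'.
  pose proof (Rmax_Cmod (x - x', y - y')) as Hm. simpl in Hm.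
  pose proof (Rmax_l (Rabs (x - x')) (Rabs (y - y'))). pose proof (Rmax_r (Rabs (x - x')) (Rabs (y - y'))).
  specialize (Hd x' y' x y B3 B4 B1 B2 ltac:(lra) ltac:(lra)). simpl in Hd.
  apply Rabs_def2 in Hd. lra.
Qed.

(** * Inverse square roots on grids *)

(** A primitive of [/ sqrt (Rabs y)], by which sums over a grid telescope. *)
Definition signed_sqrt (y : R) : R := if Rle_dec 0 y then 2 * sqrt y else - (2 * sqrt (- y)).

Lemma signed_sqrt_mono u v : u <= v -> signed_sqrt u <= signed_sqrt v.
Proof.
intros H. unfold signed_sqrt. destruct (Rle_dec 0 u), (Rle_dec 0 v).
- pose proof (sqrt_le_1_alt _ _ H). lra.
- lra.
- pose proof (sqrt_pos (- u)). pose proof (sqrt_pos v). lra.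
- pose proof (sqrt_le_1_alt (- v) (- u) ltac:(lra)). lra.
Qed.

Lemma signed_sqrt_opp y : signed_sqrt (- y) = - signed_sqrt y.
Proof.
unfold signed_sqrt. destruct (Rle_dec 0 (- y)), (Rle_dec 0 y); rewrite ?Ropp_involutive; try lra.
replace y with 0 by lra. rewrite Ropp_0, sqrt_0. lra.
Qed.

Lemma signed_sqrt_diff u v : v <= u -> signed_sqrt u - signed_sqrt v <= 4 * sqrt (u - v).
Proof.
assert (Q : forall a b, 0 <= b <= a -> sqrt a <= sqrt b + sqrt (a - b)).
{ intros a b H. pose proof (sqrt_pos b). pose proof (sqrt_pos (a - b)).
  rewrite <- (sqrt_square (sqrt b + sqrt (a - b))) by lra. apply sqrt_le_1_alt.
  pose proof (sqrt_sqrt b ltac:(lra)). pose proof (sqrt_sqrt (a - b) ltac:(lra)). nra. }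
intros H. unfold signed_sqrt. pose proof (sqrt_pos (u - v)).
destruct (Rle_dec 0 u), (Rle_dec 0 v).
- pose proof (Q u v ltac:(lra)). lra.
- pose proof (sqrt_le_1_alt u (u - v) ltac:(lra)). pose proof (sqrt_le_1_alt (- v) (u - v) ltac:(lra)). lra.
- lra.
- pose proof (Q (- v) (- u) ltac:(lra)) as E. replace (- v - - u) with (u - v) in E by ring. lra.
Qed.

(** The inverse square root is convex, so its value at the midpoint of an
    interval is at most its mean. *)
Lemma signed_sqrt_step h y : 0 < h -> h / 2 <= Rabs y ->
  h * / sqrt (Rabs y) <= signed_sqrt (y + h / 2) - signed_sqrt (y - h / 2).
Proof.
assert (P : forall y, 0 < h -> h / 2 <= y ->
   h * / sqrt y <= signed_sqrt (y + h / 2) - signed_sqrt (y - h / 2)).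
{ intros x Hh Hx. unfold signed_sqrt.
  destruct (Rle_dec 0 (x + h / 2)); [|lra]. destruct (Rle_dec 0 (x - h / 2)); [|lra].
  set (p := sqrt (x + h / 2)). set (q := sqrt (x - h / 2)). set (g := sqrt x).
  assert (Ep : p * p = x + h / 2) by (apply sqrt_sqrt; lra).
  assert (Eq : q * q = x - h / 2) by (apply sqrt_sqrt; lra).
  assert (Eg : g * g = x) by (apply sqrt_sqrt; lra).
  assert (0 < p) by (apply sqrt_lt_R0; lra). assert (0 <= q) by apply sqrt_pos.
  assert (0 < g) by (apply sqrt_lt_R0; lra).
  assert (Hpq : p + q <= 2 * g).
  { apply Rsqr_incr_0_var; [|lra]. unfold Rsqr. pose proof (Rle_0_sqr (p - q)). unfold Rsqr in *. nra. }
  assert (Hd : (p - q) * (p + q) = h) by lra.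
  assert (0 <= p - q).
  { apply Rnot_lt_le. intros Hlt. nra. }
  apply Rmult_le_reg_r with g; auto. rewrite Rmult_assoc, Rinv_l by lra. nra. }
intros Hh Hy. unfold Rabs in *. destruct (Rcase_abs y).
- specialize (P (- y) Hh Hy).
  replace (- y + h / 2) with (- (y - h / 2)) in P by ring.
  replace (- y - h / 2) with (- (y + h / 2)) in P by ring.
  rewrite !signed_sqrt_opp in P. lra.
- apply P; auto.
Qed.

(** Sums of inverse square roots over a grid are split in two: [off_cell] is the
    part that can be estimated, while grid points within half a step of the
    singularity can only be counted, and avoided later. *)
Definition near_cell (h y : R) : R := if Rlt_dec (Rabs y) (h / 2) then 1 else 0.
Definition off_cell (h y : R) : R := if Rlt_dec (Rabs y) (h / 2) then 0 else / sqrt (Rabs y).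

Lemma near_cell_pos h y : 0 <= near_cell h y.
Proof. unfold near_cell. destruct (Rlt_dec _ _); lra. Qed.

Lemma off_cell_pos h y : 0 < h -> 0 <= off_cell h y.
Proof.
intros. unfold off_cell. destruct (Rlt_dec _ _); [lra|]. left. apply Rinv_0_lt_compat, sqrt_lt_R0. lra.
Qed.

(** Each term is bounded by the increment of a step function, and the increments
    telescope to at most 1. *)
Lemma near_cell_sum x0 h tau L : 0 < h ->
  rsum (fun l => near_cell h (x0 + INR l * h - tau)) L <= 1.
Proof.
intros Hh. set (c := fun y => if Rlt_dec 0 y then 1 else 0).
assert (H : rsum (fun l => near_cell h (x0 + INR l * h - tau)) L
   <= c (x0 + INR L * h - tau - h / 2) - c (x0 - tau - h / 2)).
{ induction L as [|L IH].
  - simpl. rewrite Rmult_0_l, Rplus_0_r. lra.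
  - rewrite S_INR. simpl. eapply Rle_trans; [apply Rplus_le_compat_r, IH|].
    set (y := x0 + INR L * h - tau).
    replace (x0 + (INR L + 1) * h - tau - h / 2) with (y + h / 2) by (unfold y; field).
    fold y. cut (near_cell h y <= c (y + h / 2) - c (y - h / 2)); [lra|].
    unfold near_cell, c. destruct (Rlt_dec (Rabs y) (h / 2)) as [Hy|Hy].
    + apply Rabs_def2 in Hy. destruct (Rlt_dec 0 (y + h / 2)), (Rlt_dec 0 (y - h / 2)); lra.
    + destruct (Rlt_dec 0 (y + h / 2)), (Rlt_dec 0 (y - h / 2)); lra. }
eapply Rle_trans; [exact H|]. unfold c. destruct (Rlt_dec _ _), (Rlt_dec _ _); lra.
Qed.

Lemma off_cell_sum x0 h tau L : 0 < h ->
  rsum (fun l => off_cell h (x0 + INR l * h - tau)) L <= 4 * sqrt (INR L * h) / h.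
Proof.
intros Hh.
assert (H : h * rsum (fun l => off_cell h (x0 + INR l * h - tau)) L
   <= signed_sqrt (x0 + INR L * h - tau - h / 2) - signed_sqrt (x0 - tau - h / 2)).
{ induction L as [|L IH].
  - simpl. rewrite Rmult_0_l, Rplus_0_r. lra.
  - rewrite S_INR. simpl. rewrite Rmult_plus_distr_l. eapply Rle_trans; [apply Rplus_le_compat_r, IH|].
    set (y := x0 + INR L * h - tau).
    replace (x0 + (INR L + 1) * h - tau - h / 2) with (y + h / 2) by (unfold y; field).
    fold y. cut (h * off_cell h y <= signed_sqrt (y + h / 2) - signed_sqrt (y - h / 2)); [lra|].
    unfold off_cell. destruct (Rlt_dec (Rabs y) (h / 2)) as [Hy|Hy].
    + pose proof (signed_sqrt_mono (y - h / 2) (y + h / 2) ltac:(lra)). lra.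
    + apply signed_sqrt_step; lra. }
apply Rmult_le_reg_l with h; auto. eapply Rle_trans; [exact H|].
pose proof (pos_INR L).
eapply Rle_trans; [apply signed_sqrt_diff; nra|].
replace (x0 + INR L * h - tau - h / 2 - (x0 - tau - h / 2)) with (INR L * h) by ring.
right. field. lra.
Qed.

Lemma rsum_exists_lt f L : rsum f L < INR L -> exists l, (l < L)%nat /\ f l < 1.
Proof.
induction L as [|L IH]; intros H; [simpl in H; lra|].
rewrite S_INR in H. simpl in H. destruct (Rlt_dec (f L) 1).
- exists L. auto.
- destruct IH as (l & Hl & Hf); [lra|]. exists l. auto.
Qed.

(** Try [2 * K + 1] equally spaced radii. At most [K] of them come too close to
    some [tau n], and the mean over all of them of the weighted sum of inverse
    square roots is at most half of the bound claimed; so some radius meets both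
    requirements. *)
Lemma good_radius (w tau : nat -> R) K rad W : 0 < rad -> 0 < W ->
  (forall n, 0 <= w n) -> rsum w K <= W ->
  exists r, 2 * rad <= r <= 3 * rad /\ (forall n, (n < K)%nat -> r <> tau n) /\
    rsum (fun n => w n * / sqrt (Rabs (r - tau n))) K <= 8 * W / sqrt rad.
Proof.
intros HR HW Hw HS.
set (L := (2 * K + 1)%nat). set (h := rad / INR L).
assert (HL : 0 < INR L) by (apply lt_0_INR; unfold L; lia).
assert (Hh : 0 < h) by (apply Rdiv_lt_0_compat; auto).
assert (HLh : INR L * h = rad) by (unfold h; field; lra).
set (r := fun l => 2 * rad + h / 2 + INR l * h).
assert (HsR : 0 < sqrt rad) by (now apply sqrt_lt_R0).
set (s := 8 * W / sqrt rad). assert (Hs : 0 < s) by (apply Rdiv_lt_0_compat; lra).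
set (X := fun l => rsum (fun n => w n * off_cell h (r l - tau n)) K).
set (Y := fun l => rsum (fun n => near_cell h (r l - tau n)) K).
destruct (rsum_exists_lt (fun l => Y l + / s * X l) L) as (l & Hl & Hlt).
{ rewrite rsum_plus, rsum_scal.
  assert (HY : rsum Y L <= INR K).
  { unfold Y. rewrite rsum_swap. rewrite <- (Rmult_1_r (INR K)), <- rsum_const. apply rsum_le.
    intros n _. apply near_cell_sum; auto. }
  assert (HX : rsum X L <= 4 * sqrt rad / h * W).
  { unfold X. rewrite rsum_swap. apply Rle_trans with (4 * sqrt rad / h * rsum w K).
    - rewrite <- rsum_scal. apply rsum_le. intros n _. rewrite rsum_scal.
      rewrite (Rmult_comm _ (w n)). apply Rmult_le_compat_l; auto.
      rewrite <- HLh. apply off_cell_sum; auto.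
    - apply Rmult_le_compat_l; auto. left. apply Rdiv_lt_0_compat; lra. }
  assert (HX' : / s * rsum X L <= INR L / 2).
  { apply Rle_trans with (/ s * (4 * sqrt rad / h * W)).
    - apply Rmult_le_compat_l; auto. left. now apply Rinv_0_lt_compat.
    - right. unfold s, h. replace rad with (sqrt rad * sqrt rad) at 3 by (apply sqrt_sqrt; lra).
      field. repeat split; lra. }
  assert (INR L = 2 * INR K + 1).
  { unfold L. rewrite plus_INR, mult_INR. simpl. ring. }
  lra. }
exists (r l).
assert (HX0 : 0 <= X l).
{ apply rsum_pos. intros. apply Rmult_le_pos; auto. now apply off_cell_pos. }
assert (HY0 : 0 <= / s * X l) by (apply Rmult_le_pos; auto; left; now apply Rinv_0_lt_compat).
assert (Hfar : forall n, (n < K)%nat -> ~ Rabs (r l - tau n) < h / 2).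
{ intros n Hn Hnear. assert (1 <= Y l); [|lra].
  eapply Rle_trans; [|apply (rsum_single _ K n Hn)].
  - unfold near_cell. destruct (Rlt_dec _ _); [lra|contradiction].
  - intros; apply near_cell_pos. }
split; [|split].
- unfold r. pose proof (pos_INR l).
  assert (Hl1 : (INR l + 1) * h <= INR L * h).
  { apply Rmult_le_compat_r; [lra|]. rewrite <- S_INR. apply le_INR. lia. }
  rewrite HLh in Hl1. assert (0 <= INR l * h) by (apply Rmult_le_pos; lra). lra.
- intros n Hn E. apply (Hfar n Hn). rewrite E, Rminus_diag_eq, Rabs_R0 by auto. lra.
- assert (HY1 : 0 <= Y l) by (apply rsum_pos; intros; apply near_cell_pos).
  assert (HXs : X l <= s).
  { apply Rmult_le_reg_l with (/ s); [now apply Rinv_0_lt_compat|]. rewrite Rinv_l; lra. }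
  eapply Rle_trans; [|exact HXs]. unfold X. right. apply rsum_ext. intros n Hn. f_equal.
  unfold off_cell. destruct (Rlt_dec _ _) as [H|H]; auto. exfalso. exact (Hfar n Hn H).
Qed.

(** * Circles that stay away from given points on average *)

Lemma sin_lower x : 0 <= x <= PI / 2 -> x / 3 <= sin x.
Proof.
intros Hx. pose proof PI_4.
destruct (pre_sin_bound x 0 ltac:(lra) ltac:(lra)) as [H1 _].
unfold sin_approx, sin_term in H1. simpl in H1.
eapply Rle_trans; [|exact H1]. field_simplify. assert (x * x <= 4) by nra. nra.
Qed.

Lemma chord_lower th al D : 0 <= D <= PI -> cos (th - al) = cos D ->
  D / 3 <= Cmod (cis th - cis al).
Proof.
intros HD E. pose proof (sin_lower (D / 2) ltac:(lra)) as Hs.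
apply Rsqr_incr_0_var; [|apply Cmod_ge_0]. rewrite !Rsqr_pow2, Cmod2_alt.
unfold cis, Re, Im, Cminus, Cplus, Copp; simpl.
rewrite cos_minus in E. pose proof (sin2_cos2 th). pose proof (sin2_cos2 al). unfold Rsqr in *.
assert (E2 : cos D = 1 - 2 * sin (D / 2) * sin (D / 2)).
{ replace D with (2 * (D / 2)) at 1 by field. apply cos_2a_sin. }
assert (D / 2 / 3 * (D / 2 / 3) <= sin (D / 2) * sin (D / 2)) by (apply Rmult_le_compat; lra).
nra.
Qed.

Lemma inv_sqrt_le_off_cell h D A : 0 < h -> 0 <= D -> ~ D < h / 2 -> D / 3 <= A ->
  0 < A /\ / sqrt A <= 2 * off_cell h D.
Proof.
intros Hh HD Hn HA. split; [lra|]. unfold off_cell. rewrite Rabs_pos_eq by auto.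
destruct (Rlt_dec D (h / 2)); [contradiction|].
assert (0 < sqrt D) by (apply sqrt_lt_R0; lra).
assert (H1 : sqrt D <= 2 * sqrt A).
{ rewrite <- (sqrt_square 2), <- sqrt_mult by lra. apply sqrt_le_1_alt. lra. }
apply Rmult_le_reg_r with (sqrt D); auto. rewrite Rmult_assoc, Rinv_l by lra.
assert (0 < sqrt A) by lra.
apply Rmult_le_reg_l with (sqrt A); auto. rewrite <- Rmult_assoc, Rinv_r by lra. lra.
Qed.

Lemma off_cell_abs h y : off_cell h (Rabs y) = off_cell h y.
Proof. unfold off_cell. now rewrite Rabs_Rabsolu. Qed.

(** [Y] marks the samples too close to [u], and [X] controls the others. The
    chord is at least a third of the arc, and the three copies [al], [al + 2 *
    PI], [al - 2 * PI] of the argument of [u] turn distances on the circle into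
    distances on the line. *)
Lemma angular_sum (u : C) m : Cmod u = 1 -> (0 < m)%nat ->
  exists X Y : nat -> R, (forall k, 0 <= X k) /\ (forall k, 0 <= Y k) /\
    rsum Y m <= 3 /\ rsum X m <= 12 * INR m /\
    forall k, (k < m)%nat -> Y k < 1 ->
      0 < Cmod (cis (angle m k) - u) /\ / sqrt (Cmod (cis (angle m k) - u)) <= X k.
Proof.
intros Hu Hm. destruct (unit_circle_cis u Hu) as (al & Hal & Eu).
assert (HmR : 0 < INR m) by (now apply lt_0_INR).
pose proof PI_RGT_0 as HPI. pose proof PI2_3_2 as HP3.
set (h := 2 * PI / INR m).
assert (Hh : 0 < h) by (apply Rdiv_lt_0_compat; lra).
assert (Ean : forall k tau, angle m k - tau = 0 + INR k * h - tau) by (intros; unfold angle, h; field; lra).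
exists (fun k => 2 * (off_cell h (angle m k - al) + (off_cell h (angle m k - (al + 2 * PI))
               + off_cell h (angle m k - (al - 2 * PI))))),
       (fun k => near_cell h (angle m k - al) + (near_cell h (angle m k - (al + 2 * PI))
               + near_cell h (angle m k - (al - 2 * PI)))).
pose proof (fun y => off_cell_pos h y Hh) as Po. pose proof (near_cell_pos h) as Pn.
split; [|split; [|split; [|split]]].
- intros k. pose proof (Po (angle m k - al)). pose proof (Po (angle m k - (al + 2 * PI))).
  pose proof (Po (angle m k - (al - 2 * PI))). lra.
- intros k. pose proof (Pn (angle m k - al)). pose proof (Pn (angle m k - (al + 2 * PI))).
  pose proof (Pn (angle m k - (al - 2 * PI))). lra.
- rewrite !rsum_plus.
  assert (S : forall tau, rsum (fun k => near_cell h (angle m k - tau)) m <= 1).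
  { intros tau. rewrite (rsum_ext _ (fun k => near_cell h (0 + INR k * h - tau))) by (intros; now rewrite Ean).
    now apply near_cell_sum. }
  pose proof (S al). pose proof (S (al + 2 * PI)). pose proof (S (al - 2 * PI)). lra.
- rewrite rsum_scal, !rsum_plus.
  assert (S : forall tau, rsum (fun k => off_cell h (angle m k - tau)) m <= 2 * INR m).
  { intros tau. rewrite (rsum_ext _ (fun k => off_cell h (0 + INR k * h - tau))) by (intros; now rewrite Ean).
    eapply Rle_trans; [now apply off_cell_sum|].
    replace (INR m * h) with (2 * PI) by (unfold h; field; lra).
    apply Rmult_le_reg_r with h; auto. unfold Rdiv. rewrite Rmult_assoc, Rinv_l by lra.
    replace (2 * INR m * h) with (2 * (2 * PI)) by (unfold h; field; lra).
    assert (Hsq : 2 * sqrt (2 * PI) <= 2 * PI).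
    { rewrite <- (sqrt_square (2 * PI)) at 2 by lra.
      rewrite <- (sqrt_square 2) at 1 by lra. rewrite <- sqrt_mult by lra.
      apply sqrt_le_1_alt. nra. }
    lra. }
  pose proof (S al). pose proof (S (al + 2 * PI)). pose proof (S (al - 2 * PI)). lra.
- intros k Hk HY. rewrite Eu.
  set (th := angle m k) in *.
  assert (Hth : 0 <= th <= 2 * PI).
  { unfold th, angle. pose proof (pos_INR k). split.
    - apply Rmult_le_pos; [nra|left; now apply Rinv_0_lt_compat].
    - apply Rmult_le_reg_r with (INR m); auto. unfold Rdiv. rewrite Rmult_assoc, Rinv_l by lra.
      rewrite Rmult_1_r. apply Rmult_le_compat_l; [lra|]. left. now apply lt_INR. }
  assert (Hbest : exists tau, (tau = al \/ tau = al + 2 * PI \/ tau = al - 2 * PI) /\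
     Rabs (th - tau) <= PI).
  { destruct (Rle_dec (Rabs (th - al)) PI) as [|Hgt]; [exists al; auto|].
    unfold Rabs in Hgt. destruct (Rcase_abs (th - al)).
    - exists (al - 2 * PI). split; auto. apply Rabs_le. lra.
    - exists (al + 2 * PI). split; auto. apply Rabs_le. lra. }
  destruct Hbest as (tau & Htau & HD).
  assert (Hcos : cos (th - al) = cos (Rabs (th - tau))).
  { transitivity (cos (th - tau)).
    - destruct Htau as [-> | [-> | ->]]; auto.
      + replace (th - (al + 2 * PI)) with (th - al - 2 * PI) by ring.
        rewrite (cos_minus (th - al)), cos_2PI, sin_2PI. ring.
      + replace (th - (al - 2 * PI)) with (th - al + 2 * PI) by ring.
        rewrite (cos_plus (th - al)), cos_2PI, sin_2PI. ring.
    - unfold Rabs. destruct (Rcase_abs _); auto. now rewrite cos_neg. }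
  pose proof (chord_lower th al (Rabs (th - tau)) (conj (Rabs_pos _) HD) Hcos) as Hch.
  pose proof (Pn (th - al)). pose proof (Pn (th - (al + 2 * PI))). pose proof (Pn (th - (al - 2 * PI))).
  pose proof (Po (th - al)). pose proof (Po (th - (al + 2 * PI))). pose proof (Po (th - (al - 2 * PI))).
  assert (Hn : near_cell h (th - tau) < 1) by (destruct Htau as [-> | [-> | ->]]; lra).
  assert (Hnot : ~ Rabs (th - tau) < h / 2).
  { intros Hlt. unfold near_cell in Hn. destruct (Rlt_dec _ _); [lra|contradiction]. }
  destruct (inv_sqrt_le_off_cell h _ _ Hh (Rabs_pos _) Hnot Hch) as [H6 H7].
  split; auto. eapply Rle_trans; [exact H7|]. rewrite off_cell_abs.
  destruct Htau as [-> | [-> | ->]]; lra.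
Qed.

(** The distance from [z] to [t n] is at least [Rabs (r - Cmod (t n))], and at
    least [rad] times the distance of the directions of [z] and [t n]; hence it
    is at least the geometric mean of the two. This splits [rad / Cmod (z - t
    n)] into a radial and an angular inverse square root, both of which have
    bounded means. The radius is the one of [good_radius]. A sample with [beta k
    >= 1] is bad; when [W] is small compared with [theta], bad samples are rare
    for all large [m], which is what makes the growth inequality contract. *)
Lemma good_circle (w : nat -> R) (t : nat -> C) K rad W : 0 < rad -> 0 < W ->
  (forall n, 0 <= w n) -> (forall n, t n <> 0) -> rsum w K <= W ->
  exists r, 2 * rad <= r <= 3 * rad /\
    (forall n, (n < K)%nat -> r <> Cmod (t n) /\
       w n * / sqrt (Rabs (r - Cmod (t n))) <= 8 * W / sqrt rad) /\
    forall theta, 0 < theta -> exists m1, forall m, (m1 <= m)%nat -> (0 < m)%nat ->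
      exists beta : nat -> R, (forall k, 0 <= beta k) /\
        rsum beta m <= INR m * (97 * W / theta) /\
        forall k, (k < m)%nat -> beta k < 1 ->
          rsum (fun n => w n * (rad / Cmod (sample r m k - t n))) K < theta.
Proof.
intros HR HW Hw Ht HS.
destruct (good_radius w (fun n => Cmod (t n)) K rad W HR HW Hw HS) as (r & Hr & Hne & Hsum).
exists r. split; auto.
assert (HsR : 0 < sqrt rad) by (now apply sqrt_lt_R0).
assert (Hd : forall n, (n < K)%nat -> 0 < Rabs (r - Cmod (t n))).
{ intros n Hn. apply Rabs_pos_lt. specialize (Hne n Hn). lra. }
assert (Hinv : forall n, (n < K)%nat -> 0 <= w n * / sqrt (Rabs (r - Cmod (t n)))).
{ intros n Hn. apply Rmult_le_pos; auto. left. apply Rinv_0_lt_compat, sqrt_lt_R0; auto. }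
split.
{ intros n Hn. split; auto. eapply Rle_trans; [|exact Hsum].
  apply (rsum_single (fun n => w n * / sqrt (Rabs (r - Cmod (t n))))); auto. }
intros theta Hth.
set (u := fun n => (t n / Cmod (t n))%C).
assert (HtC : forall n, RtoC (Cmod (t n)) <> 0).
{ intros n. apply RtoC_neq_0. specialize (Ht n). apply Cmod_gt_0 in Ht. lra. }
assert (Hu : forall n, Cmod (u n) = 1).
{ intros n. unfold u. rewrite Cmod_div by auto. rewrite (Cmod_RtoC_pos (Cmod (t n))) by apply Cmod_ge_0.
  specialize (Ht n). apply Cmod_gt_0 in Ht. field. lra. }
destruct (INR_unbounded (3 * INR K * theta / W)) as (m1 & Hm1).
exists m1. intros m Hm Hmp.
assert (HmR : 0 < INR m) by (now apply lt_0_INR).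
destruct (functional_choice _ _ _ (fun n => angular_sum (u n) m (Hu n) Hmp)) as (X & HX).
destruct (functional_choice _ _ _ HX) as (Y & HXY). clear HX.
set (c := fun n => w n * (sqrt rad * / sqrt (Rabs (r - Cmod (t n))))).
assert (Hc : forall n, (n < K)%nat -> 0 <= c n).
{ intros n Hn. unfold c. specialize (Hinv n Hn). nra. }
assert (Hcs : rsum c K <= 8 * W).
{ apply Rle_trans with (sqrt rad * (8 * W / sqrt rad)); [|right; field; lra].
  eapply Rle_trans; [|apply Rmult_le_compat_l; [lra|exact Hsum]].
  rewrite <- rsum_scal. right. apply rsum_ext. intros. unfold c. ring. }
exists (fun k => rsum (fun n => Y n k) K + / theta * rsum (fun n => c n * X n k) K).
assert (HY0 : forall k, 0 <= rsum (fun n => Y n k) K).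
{ intros k. apply rsum_pos. intros n _. apply HXY. }
assert (HX0 : forall k, 0 <= rsum (fun n => c n * X n k) K).
{ intros k. apply rsum_pos. intros n Hn. apply Rmult_le_pos; auto. apply HXY. }
assert (Hith : 0 < / theta) by (now apply Rinv_0_lt_compat).
split; [|split].
- intros k. specialize (HY0 k). specialize (HX0 k).
  assert (0 <= / theta * rsum (fun n => c n * X n k) K) by (apply Rmult_le_pos; lra). lra.
- rewrite rsum_plus, rsum_scal, !(rsum_swap _ m K).
  assert (A1 : rsum (fun j => rsum (fun k => Y j k) m) K <= 3 * INR K).
  { rewrite Rmult_comm, <- rsum_const. apply rsum_le. intros n _. apply HXY. }
  assert (A2 : rsum (fun j => rsum (fun k => c j * X j k) m) K <= 12 * INR m * (8 * W)).
  { apply Rle_trans with (12 * INR m * rsum c K); [|apply Rmult_le_compat_l; lra].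
    rewrite <- rsum_scal. apply rsum_le. intros n Hn. rewrite rsum_scal, Rmult_comm.
    apply Rmult_le_compat_r; auto. apply HXY. }
  (* Samples too close to some [t n] number at most [3 * INR K] and are absorbed
     by taking [m] large; this is the 1 in [97 = 12 * 8 + 1]. *)
  assert (A3 : 3 * INR K <= INR m * (W / theta)).
  { apply le_INR in Hm. assert (Hq : 3 * INR K * theta / W <= INR m) by lra.
    apply Rmult_le_reg_r with (theta / W); [now apply Rdiv_lt_0_compat|].
    replace (INR m * (W / theta) * (theta / W)) with (INR m) by (field; lra).
    eapply Rle_trans; [|exact Hq]. right. field. lra. }
  apply (Rmult_le_compat_l (/ theta)) in A2; [|lra].
  replace (INR m * (97 * W / theta)) with (INR m * (W / theta) + / theta * (12 * INR m * (8 * W))) by (field; lra).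
  lra.
- intros k Hk Hb. specialize (HX0 k).
  assert (Hi : 0 <= / theta * rsum (fun n => c n * X n k) K) by (apply Rmult_le_pos; lra).
  assert (Hlt : rsum (fun n => c n * X n k) K < theta).
  { specialize (HY0 k). apply Rmult_lt_reg_l with (/ theta); auto. rewrite Rinv_l by lra. lra. }
  eapply Rle_lt_trans; [|exact Hlt]. apply rsum_le. intros n Hn.
  unfold c. rewrite Rmult_assoc. apply Rmult_le_compat_l; auto.
  destruct (HXY n) as (_ & HYp & _ & _ & Hbest).
  destruct (Hbest k Hk) as [Hpos HX].
  { assert (Y n k <= rsum (fun n => Y n k) K); [|lra].
    apply (rsum_single (fun n => Y n k)); auto. intros; apply HXY. }
  set (g := Rabs (r - Cmod (t n))) in *. set (A := Cmod (cis (angle m k) - u n)) in *.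
  specialize (Hd n Hn). fold g in Hd.
  assert (Hg : g <= Cmod (sample r m k - t n)).
  { unfold g. pose proof (Cmod_reverse_triangle (sample r m k) (t n)) as T1.
    pose proof (Cmod_reverse_triangle (t n) (sample r m k)) as T2. rewrite Cmod_minus_sym in T2.
    rewrite Cmod_sample in T1, T2 by lra. apply Rabs_le. lra. }
  assert (HA : rad * A <= Cmod (sample r m k - t n)).
  { assert (r * A <= 2 * Cmod (sample r m k - t n)); [|nra].
    assert (E : (r * (cis (angle m k) - u n) = (sample r m k - t n) + (t n - r * u n))%C)
      by (unfold sample; ring).
    assert (E2 : r * A = Cmod (r * (cis (angle m k) - u n))%C)
      by (rewrite Cmod_mult, Cmod_RtoC_pos; unfold A; lra).
    rewrite E2, E. eapply Rle_trans; [apply Cmod_triangle|].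
    assert (E3 : (t n - r * u n = (Cmod (t n) - r) * u n)%C) by (unfold u; field; auto).
    rewrite E3, Cmod_mult, Hu, <- RtoC_minus, Cmod_R, Rabs_minus_sym. fold g. lra. }
  set (B := Cmod (sample r m k - t n)) in *.
  assert (HB : 0 < B) by lra.
  assert (0 < sqrt g) by (now apply sqrt_lt_R0).
  assert (0 < sqrt A) by (now apply sqrt_lt_R0).
  apply Rle_trans with (sqrt rad * / sqrt g * / sqrt A).
  2:{ apply Rmult_le_compat_l; auto. apply Rmult_le_pos; [lra|]. left. now apply Rinv_0_lt_compat. }
  assert (Hs : sqrt rad * sqrt g * sqrt A <= B).
  { rewrite <- (sqrt_square B) by lra. rewrite <- !sqrt_mult by (try apply Rmult_le_pos; lra).
    apply sqrt_le_1_alt. replace (rad * g * A) with (g * (rad * A)) by ring.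
    apply Rmult_le_compat; try lra. apply Rmult_le_pos; lra. }
  apply Rmult_le_reg_r with (B * (sqrt g * sqrt A)).
  { apply Rmult_lt_0_compat; auto. now apply Rmult_lt_0_compat. }
  replace (rad / B * (B * (sqrt g * sqrt A))) with (sqrt rad * (sqrt rad * sqrt g * sqrt A))
    by (replace rad with (sqrt rad * sqrt rad) at 3 by (apply sqrt_sqrt; lra); field; lra).
  replace (sqrt rad * / sqrt g * / sqrt A * (B * (sqrt g * sqrt A))) with (sqrt rad * B) by (field; lra).
  apply Rmult_le_compat_l; lra.
Qed.

(** * Absolutely convergent complex series *)

Definition summable (u : nat -> C) : Prop := ex_series (fun n => Cmod (u n)).

Lemma ex_series_pos_le (u v : nat -> R) : (forall n, 0 <= u n <= v n) -> ex_series v -> ex_series u.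
Proof.
intros H Hv. apply (ex_series_le (V := R_CompleteNormedModule)) with (2 := Hv).
intros n. change (Rabs (u n) <= v n). rewrite Rabs_pos_eq; apply H.
Qed.

Lemma ex_series_Rplus (u v : nat -> R) : ex_series u -> ex_series v -> ex_series (fun n => u n + v n).
Proof. apply (ex_series_plus (K := R_AbsRing) (V := R_NormedModule)). Qed.

Lemma summable_le (u : nat -> C) (v : nat -> R) :
  (forall n, Cmod (u n) <= v n) -> ex_series v -> summable u.
Proof. intros H. apply ex_series_pos_le. intros n. split; [apply Cmod_ge_0|apply H]. Qed.

Lemma summable_bounded_mult (u f : nat -> C) M : summable u -> (forall n, u n <> 0 -> Cmod (f n) <= M) ->
  summable (fun n => u n * f n)%C.
Proof.
intros Hu Hf. apply summable_le with (fun n => Rabs M * Cmod (u n)).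
- intros n. rewrite Cmod_mult, Rmult_comm.
  destruct (classic (u n = 0)) as [->|Hn]; [rewrite Cmod_0; lra|].
  apply Rmult_le_compat_r; [apply Cmod_ge_0|]. eapply Rle_trans; [now apply Hf|apply Rle_abs].
- now apply ex_series_Rscal.
Qed.

Lemma summable_scal c u : summable u -> summable (fun n => c * u n)%C.
Proof.
intros Hu. apply summable_le with (fun n => Cmod c * Cmod (u n)).
- intros n. rewrite Cmod_mult. lra.
- now apply ex_series_Rscal.
Qed.

Lemma summable_plus u v : summable u -> summable v -> summable (fun n => u n + v n)%C.
Proof.
intros Hu Hv. apply summable_le with (fun n => Cmod (u n) + Cmod (v n)).
- intros n. apply Cmod_triangle.
- now apply ex_series_Rplus.
Qed.

Lemma summable_ext u v : (forall n, u n = v n) -> summable u -> summable v.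
Proof. intros H. apply ex_series_Rext. intros n. now rewrite H. Qed.

Lemma Series_pos (u : nat -> R) : (forall n, 0 <= u n) -> ex_series u -> 0 <= Series u.
Proof.
intros H Hu. replace 0 with (Series (fun _ => 0 * 0)).
- apply Series_le; auto. intros n. specialize (H n). lra.
- rewrite Series_scal_l. ring.
Qed.

Lemma CSeries_0 : CSeries (fun _ => RtoC 0) = 0.
Proof.
unfold CSeries. replace (Series (fun _ => Re (RtoC 0))) with 0.
- replace (Series (fun _ => Im (RtoC 0))) with 0; auto.
  rewrite (Series_ext _ (fun _ => 0 * 0)) by (intros; simpl; ring). rewrite Series_scal_l. ring.
- rewrite (Series_ext _ (fun _ => 0 * 0)) by (intros; simpl; ring). rewrite Series_scal_l. ring.
Qed.

Lemma CSeries_abs u : summable u -> Cmod (CSeries u) <= Series (fun n => Cmod (u n)).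
Proof.
intros Hu. set (l := CSeries u).
assert (E : Cmod l ^ 2 = Re (CSeries (fun n => Cconj l * u n)%C)).
{ rewrite CSeries_scal by auto. fold l. rewrite Cmult_comm, Cmod2_alt.
  destruct l as [x y]. unfold Re, Im, Cmult, Cconj. simpl. ring. }
assert (H : Cmod l ^ 2 <= Cmod l * Series (fun n => Cmod (u n))).
{ assert (ReC : forall v, Re (CSeries v) = Series (fun n => Re (v n))) by reflexivity.
  rewrite E, <- Series_scal_l, ReC.
  eapply Rle_trans; [apply Rle_abs|]. eapply Rle_trans; [apply Series_Rabs|].
  - apply ex_series_pos_le with (fun n => Cmod l * Cmod (u n)).
    + intros n. split; [apply Rabs_pos|]. eapply Rle_trans; [apply re_le_Cmod|].
      rewrite Cmod_mult, Cmod_conj. lra.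
    + now apply ex_series_Rscal.
  - apply Series_le; [|now apply ex_series_Rscal].
    intros n. split; [apply Rabs_pos|]. eapply Rle_trans; [apply re_le_Cmod|].
    rewrite Cmod_mult, Cmod_conj. lra. }
pose proof (Series_pos (fun n => Cmod (u n)) (fun n => Cmod_ge_0 _) Hu).
destruct (Req_dec (Cmod l) 0) as [Hl|Hl]; [lra|].
pose proof (Cmod_ge_0 l). apply Rmult_le_reg_l with (Cmod l); lra.
Qed.

Lemma CSeries_abs_le u v : (forall n, Cmod (u n) <= v n) -> ex_series v ->
  Cmod (CSeries u) <= Series v.
Proof.
intros H Hv. eapply Rle_trans; [apply CSeries_abs, (summable_le _ _ H Hv)|].
apply Series_le; auto. intros n. split; [apply Cmod_ge_0|auto].
Qed.

Definition delta (n0 : nat) (n : nat) : C := if Nat.eq_dec n n0 then RtoC 1 else RtoC 0.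

Lemma Series_single (n0 : nat) (x : R) : is_series (fun n => if Nat.eq_dec n n0 then x else 0) x.
Proof.
intros P [e He]. exists n0. intros n Hn. apply He.
assert (E : sum_n (fun n => if Nat.eq_dec n n0 then x else 0) n = x).
{ clear He.
  assert (Hlt : forall k, (k < n0)%nat -> sum_n (fun n => if Nat.eq_dec n n0 then x else 0) k = 0).
  { induction k as [|k IH]; intros Hk.
    - rewrite sum_O. destruct (Nat.eq_dec 0 n0); auto. lia.
    - rewrite sum_Sn, IH by lia. destruct (Nat.eq_dec (S k) n0); [lia|]. unfold plus; simpl. ring. }
  induction Hn as [|n Hn IH].
  - destruct n0 as [|n0].
    + now rewrite sum_O.
    + rewrite sum_Sn, Hlt by lia. destruct (Nat.eq_dec (S n0) (S n0)); [|lia]. unfold plus; simpl. ring.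
  - rewrite sum_Sn, IH. destruct (Nat.eq_dec (S n) n0); [lia|]. unfold plus; simpl. ring. }
change (Rabs (minus (sum_n (fun n => if Nat.eq_dec n n0 then x else 0) n) x) < e).
rewrite E. unfold minus, plus, opp; simpl. rewrite Rplus_opp_r, Rabs_R0. apply cond_pos.
Qed.

Lemma CSeries_delta n0 u : CSeries (fun n => delta n0 n * u n)%C = u n0.
Proof.
unfold CSeries. destruct (u n0) as [x y] eqn:E. f_equal.
- rewrite (Series_ext _ (fun n => if Nat.eq_dec n n0 then x else 0)).
  + apply is_series_unique, Series_single.
  + intros n. unfold delta. destruct (Nat.eq_dec n n0) as [->|_].
    * rewrite E. unfold Re, Cmult, RtoC; simpl. ring.
    * destruct (u n). unfold Re, Cmult, RtoC; simpl. ring.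
- rewrite (Series_ext _ (fun n => if Nat.eq_dec n n0 then y else 0)).
  + apply is_series_unique, Series_single.
  + intros n. unfold delta. destruct (Nat.eq_dec n n0) as [->|_].
    * rewrite E. unfold Im, Cmult, RtoC; simpl. ring.
    * destruct (u n). unfold Im, Cmult, RtoC; simpl. ring.
Qed.

Lemma summable_delta n0 u : summable (fun n => delta n0 n * u n)%C.
Proof.
unfold summable. apply ex_series_Rext with (fun n => if Nat.eq_dec n n0 then Cmod (u n0) else 0).
- intros n. unfold delta. destruct (Nat.eq_dec n n0) as [->|_]; rewrite Cmod_mult.
  + rewrite Cmod_1. ring.
  + rewrite Cmod_0. ring.
- eexists. apply Series_single.
Qed.

(** * Null sequences *)

Definition Ctends_0 (s : nat -> C) : Prop :=
  forall e, 0 < e -> exists K, forall n, (K <= n)%nat -> Cmod (s n) < e.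

Lemma Ctends_0_bounded s : Ctends_0 s -> exists M, 0 < M /\ forall n, Cmod (s n) <= M.
Proof.
intros H. destruct (H 1 Rlt_0_1) as (K & HK).
exists (rsum (fun n => Cmod (s n)) K + 1).
assert (H0 : 0 <= rsum (fun n => Cmod (s n)) K) by (apply rsum_pos; intros; apply Cmod_ge_0).
split; [lra|]. intros n. destruct (le_lt_dec K n) as [Hn|Hn].
- specialize (HK n Hn). lra.
- assert (Cmod (s n) <= rsum (fun n => Cmod (s n)) K); [|lra].
  apply (rsum_single (fun n => Cmod (s n))); auto. intros; apply Cmod_ge_0.
Qed.

Lemma finite_lower_bound (x : nat -> C) K :
  exists kap, 0 < kap /\ forall n, (n < K)%nat -> x n <> 0 -> kap <= Cmod (x n).
Proof.
induction K as [|K (kap & Hk & IH)].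
- exists 1. split; [lra|]. intros; lia.
- destruct (classic (x K = 0)) as [H0|H0].
  + exists kap. split; auto. intros n Hn Hx. destruct (Nat.eq_dec n K) as [->|]; [contradiction|].
    apply IH; auto; lia.
  + exists (Rmin kap (Cmod (x K))). apply Cmod_gt_0 in H0. split; [now apply Rmin_pos|].
    intros n Hn Hx. destruct (Nat.eq_dec n K) as [->|]; [apply Rmin_r|].
    eapply Rle_trans; [apply Rmin_l|]. apply IH; auto; lia.
Qed.

(** For large [n] the factor is close to 1 whatever [z] near [z0], and finitely
    many [n] remain. *)
Lemma denominators_lower_bound s z0 : Ctends_0 s ->
  exists kap d, 0 < kap /\ 0 < d /\ forall z n, Cmod (z - z0) < d ->
    (z0 * s n)%C <> 1 -> kap <= Cmod (1 - z * s n).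
Proof.
intros Hs. set (A := Cmod z0 + 1). assert (HA : 0 < A) by (unfold A; pose proof (Cmod_ge_0 z0); lra).
destruct (Ctends_0_bounded s Hs) as (M & HM & HsM).
destruct (Hs (/ (2 * A))) as (K & HK); [apply Rinv_0_lt_compat; lra|].
destruct (finite_lower_bound (fun n => 1 - z0 * s n)%C K) as (k0 & Hk0 & Hfin).
exists (Rmin (1/2) (k0 / 2)), (Rmin 1 (k0 / (2 * M))).
split; [apply Rmin_pos; lra|]. split; [apply Rmin_pos; [lra|apply Rdiv_lt_0_compat; lra]|].
intros z n Hz Hne. apply Rmin_lt_inv in Hz as [Hz1 Hz2].
destruct (le_lt_dec K n) as [Hn|Hn].
- eapply Rle_trans; [apply Rmin_l|]. specialize (HK n Hn).
  pose proof (Cmod_reverse_triangle 1 (z * s n)) as H. rewrite Cmod_1, Cmod_mult in H.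
  assert (Cmod z < A) by (unfold A; pose proof (Cmod_reverse_triangle z z0); lra).
  assert (Cmod z * Cmod (s n) <= A * / (2 * A)).
  { apply Rmult_le_compat; auto using Cmod_ge_0; lra. }
  replace (A * / (2 * A)) with (1/2) in H1 by (field; lra). lra.
- eapply Rle_trans; [apply Rmin_r|].
  specialize (Hfin n Hn).
  assert (Hnz : (1 - z0 * s n)%C <> 0) by (intros E; apply Hne; symmetry; now apply Cminus_eq_0).
  specialize (Hfin Hnz).
  pose proof (Cmod_reverse_triangle (1 - z0 * s n) (z * s n - z0 * s n)) as H.
  replace (1 - z0 * s n - (z * s n - z0 * s n))%C with (1 - z * s n)%C in H by ring.
  replace (z * s n - z0 * s n)%C with ((z - z0) * s n)%C in H by ring.
  rewrite (Cmod_mult (z - z0)) in H.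
  assert (Cmod (z - z0) * Cmod (s n) <= k0 / (2 * M) * M).
  { apply Rmult_le_compat; auto using Cmod_ge_0; lra. }
  replace (k0 / (2 * M) * M) with (k0 / 2) in H0 by (field; lra). lra.
Qed.

(** * Resolvent sums *)

Definition resolvent_sum (s e : nat -> C) (z : C) : C :=
  CSeries (fun n => e n * / (1 - z * s n))%C.

(** The coefficients of the divided difference at [z0] of a resolvent sum, see
    [resolvent_expansion]. *)
Definition shifted (s : nat -> C) (z0 : C) (e : nat -> C) : nat -> C :=
  fun n => (e n * (s n * / (1 - z0 * s n)))%C.

(** The point [/ s n] is a pole only if its coefficient does not vanish;
    otherwise the term there is 0. *)
Definition regular (s e : nat -> C) (z : C) : Prop := forall n, (z * s n)%C = 1 -> e n = 0.

Lemma regular_neq s e z n : regular s e z -> e n <> 0 -> (z * s n)%C <> 1.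
Proof. intros H He E. apply He, H, E. Qed.

Lemma resolvent_summable s e z : Ctends_0 s -> summable e -> regular s e z ->
  summable (fun n => e n * / (1 - z * s n))%C.
Proof.
intros Hs He Hr. destruct (denominators_lower_bound s z Hs) as (kap & d & Hk & Hd & H).
apply summable_bounded_mult with (/ kap); auto. intros n Hn.
specialize (H z n). replace (z - z)%C with (RtoC 0) in H by ring. rewrite Cmod_0 in H.
specialize (H Hd (regular_neq _ _ _ _ Hr Hn)).
rewrite Cmod_inv by (apply Cmod_gt_0; lra). apply Rinv_le_contravar; lra.
Qed.

Lemma shifted_summable s e z0 : Ctends_0 s -> summable e -> regular s e z0 -> summable (shifted s z0 e).
Proof.
intros Hs He Hr. destruct (Ctends_0_bounded s Hs) as (M & HM & HsM).
apply (summable_ext (fun n => (e n * / (1 - z0 * s n)) * s n)%C).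
- intros n. unfold shifted. ring.
- apply summable_bounded_mult with M; auto. now apply resolvent_summable.
Qed.

Lemma shifted_regular s e z0 z : regular s e z -> regular s (shifted s z0 e) z.
Proof. intros H n Hn. unfold shifted. rewrite (H n Hn). ring. Qed.

Lemma regular_near s e z0 : Ctends_0 s -> regular s e z0 -> exists d, 0 < d /\
  forall z, Cmod (z - z0) < d -> regular s e z.
Proof.
intros Hs Hr. destruct (denominators_lower_bound s z0 Hs) as (kap & d & Hk & Hd & H).
exists d; split; auto. intros z Hz n Hn. apply NNPP. intros Hne.
specialize (H z n Hz (regular_neq _ _ _ _ Hr Hne)). rewrite Hn in H.
replace (1 - 1)%C with (RtoC 0) in H by ring. rewrite Cmod_0 in H. lra.
Qed.

Lemma resolvent_expansion s e z0 z : Ctends_0 s -> summable e ->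
  regular s e z0 -> regular s e z ->
  resolvent_sum s e z = (resolvent_sum s e z0 + (z - z0) * resolvent_sum s (shifted s z0 e) z)%C.
Proof.
intros Hs He Hr0 Hr. unfold resolvent_sum.
rewrite <- CSeries_scal, <- CSeries_plus.
- apply CSeries_ext. intros n. unfold shifted. destruct (classic (e n = 0)) as [->|Hn]; [ring|].
  pose proof (regular_neq _ _ _ _ Hr Hn) as H1. pose proof (regular_neq _ _ _ _ Hr0 Hn) as H2.
  field. split; intros E; apply Cminus_eq_0 in E; auto.
- now apply resolvent_summable.
- apply summable_scal. apply resolvent_summable; auto using shifted_summable, shifted_regular.
- apply resolvent_summable; auto using shifted_summable, shifted_regular.
Qed.

Lemma germ_resolvent k s e z0 : Ctends_0 s -> summable e -> regular s e z0 ->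
  germ k (resolvent_sum s e) z0.
Proof.
intros Hs. revert e. induction k as [|k IH]; intros e He Hr.
- destruct (denominators_lower_bound s z0 Hs) as (kap & d & Hk & Hd & H).
  exists (Series (fun n => / kap * Cmod (e n))), d. split; auto. intros w Hw.
  unfold resolvent_sum. apply CSeries_abs_le; [|now apply ex_series_Rscal].
  intros n. rewrite Cmod_mult, Rmult_comm.
  destruct (classic (e n = 0)) as [->|Hn]; [rewrite Cmod_0; lra|].
  apply Rmult_le_compat_r; [apply Cmod_ge_0|].
  specialize (H (z0 + w)%C n). replace (z0 + w - z0)%C with w in H by ring.
  specialize (H Hw (regular_neq _ _ _ _ Hr Hn)).
  rewrite Cmod_inv by (apply Cmod_gt_0; lra). apply Rinv_le_contravar; lra.
- destruct (regular_near s e z0 Hs Hr) as (d & Hd & Hn).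
  exists (resolvent_sum s (shifted s z0 e)), d. split; [|split; auto].
  + apply IH; auto using shifted_summable, shifted_regular.
  + intros w Hw. rewrite (resolvent_expansion s e z0 (z0 + w)); auto.
    * f_equal. f_equal. ring.
    * apply Hn. now replace (z0 + w - z0)%C with w by ring.
Qed.

Fixpoint shifted_iter (s : nat -> C) (z0 : C) (m : nat) (e : nat -> C) : nat -> C :=
  match m with O => e | S m => shifted s z0 (shifted_iter s z0 m e) end.

Lemma shifted_iter_regular s z0 m e z : regular s e z -> regular s (shifted_iter s z0 m e) z.
Proof. intros H. induction m; simpl; auto using shifted_regular. Qed.

Lemma shifted_iter_summable s z0 m e : Ctends_0 s -> summable e -> regular s e z0 ->
  summable (shifted_iter s z0 m e).
Proof.
intros Hs He Hr. induction m as [|m IH]; simpl; auto.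
apply shifted_summable; auto using shifted_iter_regular.
Qed.

Lemma shifted_iter_eq s z0 m e n :
  shifted_iter s z0 m e n = (e n * (s n * / (1 - z0 * s n)) ^ m)%C.
Proof.
induction m as [|m IH]; [simpl; ring|]. rewrite Cpow_S. simpl. unfold shifted at 1. rewrite IH. ring.
Qed.

Lemma resolvent_zero_order s e z0 z m : Ctends_0 s -> summable e -> regular s e z0 -> regular s e z ->
  (forall j, (j < m)%nat -> resolvent_sum s (shifted_iter s z0 j e) z0 = 0) ->
  resolvent_sum s e z = ((z - z0) ^ m * resolvent_sum s (shifted_iter s z0 m e) z)%C.
Proof.
intros Hs He Hr0 Hr. induction m as [|m IH]; intros H0.
- simpl. ring.
- rewrite IH by auto. rewrite (resolvent_expansion s (shifted_iter s z0 m e) z0 z);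
    auto using shifted_iter_summable, shifted_iter_regular.
  rewrite (H0 m) by lia. rewrite Cpow_S. simpl. ring.
Qed.

(** Multiplying [e] by [q n - q k] preserves the vanishing of all moments and
    removes the index [k]; in this way all indices other than [n0] with [Cmod (q
    n) > Cmod (q n0) / 2] can be removed. After division by [q n0 ^ j] only the
    term of [n0] survives as [j] grows. *)
Lemma moments_zero (e q : nat -> C) : summable e -> Ctends_0 q ->
  (forall n, e n <> 0 -> q n <> 0) ->
  (forall m n, e m <> 0 -> e n <> 0 -> q m = q n -> m = n) ->
  (forall j, CSeries (fun n => e n * q n ^ j)%C = 0) -> forall n, e n = 0.
Proof.
intros He Hq Hnz Hinj Hmom n0. apply NNPP. intros Hn0.
destruct (Ctends_0_bounded q Hq) as (M & HM & HqM).
assert (Hq0 : 0 < Cmod (q n0)) by (apply Cmod_gt_0; auto).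
destruct (Hq (Cmod (q n0) / 2)) as (K & HK); [lra|].
assert (Hann : forall k, exists e' : nat -> C, summable e' /\
   (forall n, e n = 0 -> e' n = 0) /\ e' n0 <> 0 /\
   (forall n, (n < k)%nat -> n <> n0 -> e' n = 0) /\
   (forall j, CSeries (fun n => e' n * q n ^ j)%C = 0)).
{ induction k as [|k (e' & He' & Hz & Hne & Hk & Hm)].
  - exists e. repeat split; auto. intros; lia.
  - destruct (Nat.eq_dec k n0) as [->|Hkn].
    { exists e'. repeat split; auto. intros n Hn Hnn. apply Hk; auto; lia. }
    destruct (classic (e k = 0)) as [Hek|Hek].
    { exists e'. repeat split; auto. intros n Hn Hnn.
      destruct (Nat.eq_dec n k) as [->|]; auto. apply Hk; auto; lia. }
    exists (fun n => e' n * (q n - q k))%C. repeat split.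
    + apply summable_bounded_mult with (M + M); auto. intros n _.
      eapply Rle_trans; [apply Cmod_minus_le|]. pose proof (HqM n). pose proof (HqM k). lra.
    + intros n Hn. rewrite (Hz n Hn). ring.
    + apply Cmult_neq_0; auto. intros E. apply Cminus_eq_0 in E. apply Hkn.
      symmetry. apply Hinj; auto.
    + intros n Hn Hnn. destruct (Nat.eq_dec n k) as [->|].
      * replace (q k - q k)%C with (RtoC 0) by ring. ring.
      * rewrite Hk by (auto; lia). ring.
    + intros j.
      assert (Hsj : forall j, summable (fun n => e' n * q n ^ j)%C).
      { intros i. apply summable_bounded_mult with (M ^ i); auto. intros n _. rewrite Cmod_pow.
        apply pow_incr. split; [apply Cmod_ge_0|auto]. }
      rewrite (CSeries_ext _ (fun n => e' n * q n ^ (S j) + (- q k) * (e' n * q n ^ j))%C)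
        by (intros n; rewrite Cpow_S; ring).
      rewrite CSeries_plus; [|exact (Hsj (S j))|exact (summable_scal _ _ (Hsj j))].
      rewrite CSeries_scal by exact (Hsj j). rewrite !Hm. ring. }
destruct (Hann K) as (e' & He' & _ & Hne & Hk & Hm).
apply Hne. apply Cmod_eq_0. apply Rle_antisym; [|apply Cmod_ge_0].
apply Rnot_lt_le. intros Hpos.
set (T := Series (fun n => Cmod (e' n))).
assert (HT : 0 <= T) by (apply Series_pos; auto; intros; apply Cmod_ge_0).
assert (Hb : forall j, Cmod (e' n0) <= (1/2) ^ j * T).
{ intros j. set (f := fun n => (e' n * (q n / q n0) ^ j)%C).
  assert (Hqn : q n0 <> 0) by auto.
  set (g := fun n => if Nat.eq_dec n n0 then RtoC 0 else f n).
  assert (Hg : forall n, Cmod (g n) <= (1/2) ^ j * Cmod (e' n)).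
  { intros n. assert (0 <= (1/2) ^ j) by (apply pow_le; lra). unfold g. destruct (Nat.eq_dec n n0).
    - rewrite Cmod_0. apply Rmult_le_pos; auto. apply Cmod_ge_0.
    - unfold f. destruct (le_lt_dec K n) as [HKn|HKn].
      + rewrite Cmod_mult, Rmult_comm, Cmod_pow, Cmod_div by auto.
        apply Rmult_le_compat_r; [apply Cmod_ge_0|]. apply pow_incr. split.
        * apply Rmult_le_pos; [apply Cmod_ge_0|left; now apply Rinv_0_lt_compat].
        * specialize (HK n HKn). apply Rmult_le_reg_r with (Cmod (q n0)); auto.
          unfold Rdiv at 1. rewrite Rmult_assoc, Rinv_l; lra.
      + rewrite Hk by auto. rewrite Cmult_0_l, Cmod_0. lra. }
  assert (Hsg : summable g) by (apply (summable_le _ _ Hg); now apply ex_series_Rscal).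
  assert (Hsum : CSeries f = 0).
  { unfold f. rewrite (CSeries_ext _ (fun n => (/ q n0) ^ j * (e' n * q n ^ j))%C).
    - rewrite CSeries_scal, Hm; [ring|].
      apply summable_bounded_mult with (M ^ j); auto. intros n _. rewrite Cmod_pow.
      apply pow_incr. split; [apply Cmod_ge_0|auto].
    - intros n. unfold Cdiv. rewrite Cpow_mult_l. ring. }
  assert (Hf : CSeries f = (f n0 + CSeries g)%C).
  { rewrite <- (CSeries_delta n0 f), <- CSeries_plus; auto.
    - apply CSeries_ext. intros n. unfold g, delta. destruct (Nat.eq_dec n n0); ring.
    - apply summable_delta. }
  assert (Hfn : f n0 = e' n0).
  { unfold f, Cdiv. rewrite Cinv_r by auto. rewrite Cpow_1_l. ring. }
  replace (e' n0) with (- CSeries g)%C.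
  - rewrite Cmod_opp. unfold T. rewrite <- Series_scal_l. apply CSeries_abs_le; auto.
    now apply ex_series_Rscal.
  - rewrite Hsum, Hfn in Hf. replace (e' n0) with (e' n0 + CSeries g - CSeries g)%C by ring.
    rewrite <- Hf. ring. }
destruct (pow_lt_1_zero (1/2)) with (y := Cmod (e' n0) / (T + 1)) as (j & Hj).
{ rewrite Rabs_pos_eq; lra. }
{ apply Rdiv_lt_0_compat; lra. }
specialize (Hj j (le_n _)). rewrite Rabs_pos_eq in Hj by (apply pow_le; lra).
specialize (Hb j). assert (0 <= (1/2) ^ j) by (apply pow_le; lra).
apply (Rmult_lt_compat_r (T + 1)) in Hj; [|lra].
replace (Cmod (e' n0) / (T + 1) * (T + 1)) with (Cmod (e' n0)) in Hj by (field; lra). nra.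
Qed.

(** * Linear algebra in L2 *)

Record perturbation_data (s : nat -> C) (nu : nat -> R) (a b : nat -> C) : Prop := {
  pd_nonzero : forall n, s n <> 0;
  pd_inj : forall m n, s m = s n -> m = n;
  pd_null : Ctends_0 s;
  pd_nu : forall n, 0 < nu n;
  pd_a : L2 nu a;
  pd_b : L2 nu b }.

Lemma inner_plus_l nu x y z : (forall n, 0 < nu n) -> L2 nu x -> L2 nu y -> L2 nu z ->
  inner nu (fun n => x n + y n)%C z = (inner nu x z + inner nu y z)%C.
Proof.
intros Hnu Hx Hy Hz. unfold inner. rewrite <- CSeries_plus; auto using inner_abs.
apply CSeries_ext. intros n. ring.
Qed.

Lemma inner_scal_l nu c x z : (forall n, 0 < nu n) -> L2 nu x -> L2 nu z ->
  inner nu (fun n => c * x n)%C z = (c * inner nu x z)%C.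
Proof.
intros Hnu Hx Hz. unfold inner. rewrite <- CSeries_scal; auto using inner_abs.
apply CSeries_ext. intros n. ring.
Qed.

Lemma L2_ext nu x y : (forall n, x n = y n) -> L2 nu x -> L2 nu y.
Proof. intros H. apply ex_series_Rext. intros n. now rewrite H. Qed.

Lemma L2_bounded_mult nu f x M : (forall n, 0 < nu n) -> (forall n, Cmod (f n) <= M) -> L2 nu x ->
  L2 nu (fun n => f n * x n)%C.
Proof. intros Hnu Hf. apply (L2_mul nu f); auto. now exists M. Qed.

Lemma L2_delta nu n0 : L2 nu (delta n0).
Proof.
unfold L2. apply ex_series_Rext with (fun n => if Nat.eq_dec n n0 then nu n0 else 0).
- intros n. unfold delta. destruct (Nat.eq_dec n n0) as [->|_]; rewrite ?Cmod_1, ?Cmod_0; ring.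
- eexists. apply Series_single.
Qed.

Lemma L2_0 nu : L2 nu (fun _ => RtoC 0).
Proof.
unfold L2. apply ex_series_Rext with (fun n => if Nat.eq_dec n 0 then 0 else 0).
- intros n. rewrite Cmod_0. destruct (Nat.eq_dec n 0); ring.
- eexists. apply Series_single.
Qed.

Lemma inner_delta_l nu n0 x : inner nu (delta n0) x = (Cconj (x n0) * nu n0)%C.
Proof.
unfold inner. rewrite <- (CSeries_delta n0 (fun n => Cconj (x n) * nu n)%C).
apply CSeries_ext. intros n. ring.
Qed.

Definition shift_op (U : (nat -> C) -> nat -> C) (lambda : C) (y : nat -> C) : nat -> C :=
  fun k => (U y k - lambda * y k)%C.

(** A generalized eigenvector with its eigenvalue exposed, as Jordan chains need
    it. *)
Definition root_vector (nu : nat -> R) U (lambda : C) (y : nat -> C) : Prop :=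
  L2 nu y /\ exists m, Nat.iter m (shift_op U lambda) y = (fun _ => RtoC 0).

Lemma root_vector_generalized nu U lambda y : root_vector nu U lambda y ->
  generalized_eigenvector nu U y.
Proof.
intros [Hy (m & Hm)]. split; auto. exists lambda, m. intros n.
change (Nat.iter m (shift_op U lambda) y n = 0). now rewrite Hm.
Qed.

Lemma generalized_root_vector nu U y : generalized_eigenvector nu U y ->
  exists lambda, root_vector nu U lambda y.
Proof.
intros [Hy (lambda & m & H)]. exists lambda. split; auto. exists m.
apply functional_extensionality. exact H.
Qed.

Section LinearOperator.
Context (nu : nat -> R) (U : (nat -> C) -> nat -> C).
Context (Hnu : forall n, 0 < nu n) (HU : maps_L2 nu U)
  (Uplus : forall x y, L2 nu x -> L2 nu y -> U (fun n => x n + y n)%C = (fun n => U x n + U y n)%C)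
  (Uscal : forall c x, L2 nu x -> U (fun n => c * x n)%C = (fun n => c * U x n)%C).

Lemma shift_op_L2 lambda y : L2 nu y -> L2 nu (shift_op U lambda y).
Proof.
intros Hy. apply (L2_ext nu (fun n => U y n + (- lambda) * y n)%C).
- intros n. unfold shift_op. ring.
- apply L2_plus; auto. now apply L2_scal.
Qed.

Lemma shift_op_plus lambda x y : L2 nu x -> L2 nu y ->
  shift_op U lambda (fun n => x n + y n)%C = (fun n => shift_op U lambda x n + shift_op U lambda y n)%C.
Proof.
intros Hx Hy. apply functional_extensionality. intros n. unfold shift_op.
rewrite Uplus by auto. ring.
Qed.

Lemma shift_op_scal lambda c x : L2 nu x ->
  shift_op U lambda (fun n => c * x n)%C = (fun n => c * shift_op U lambda x n)%C.
Proof.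
intros Hx. apply functional_extensionality. intros n. unfold shift_op.
rewrite Uscal by auto. ring.
Qed.

Lemma iter_shift_op_L2 lambda m y : L2 nu y -> L2 nu (Nat.iter m (shift_op U lambda) y).
Proof. intros Hy. induction m; simpl; auto using shift_op_L2. Qed.

Lemma iter_shift_op_plus lambda m x y : L2 nu x -> L2 nu y ->
  Nat.iter m (shift_op U lambda) (fun n => x n + y n)%C
  = (fun n => Nat.iter m (shift_op U lambda) x n + Nat.iter m (shift_op U lambda) y n)%C.
Proof.
intros Hx Hy. induction m as [|m IH]; simpl; auto.
rewrite IH. apply shift_op_plus; now apply iter_shift_op_L2.
Qed.

Lemma iter_shift_op_scal lambda m c x : L2 nu x ->
  Nat.iter m (shift_op U lambda) (fun n => c * x n)%C
  = (fun n => c * Nat.iter m (shift_op U lambda) x n)%C.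
Proof.
intros Hx. induction m as [|m IH]; simpl; auto.
rewrite IH. apply shift_op_scal; now apply iter_shift_op_L2.
Qed.

Lemma iter_shift_op_0 lambda m :
  Nat.iter m (shift_op U lambda) (fun _ => RtoC 0) = (fun _ => RtoC 0).
Proof.
induction m as [|m IH]; simpl; auto. rewrite IH.
pose proof (shift_op_scal lambda 0 _ (L2_0 nu)) as H.
replace (fun _ : nat => RtoC 0) with (fun n : nat => (RtoC 0 * RtoC 0)%C) at 1.
- rewrite H. apply functional_extensionality. intros; ring.
- apply functional_extensionality. intros; ring.
Qed.

Lemma root_vector_scal lambda c y : root_vector nu U lambda y ->
  root_vector nu U lambda (fun n => c * y n)%C.
Proof.
intros [Hy (m & Hm)]. split; [now apply L2_scal|]. exists m.
rewrite iter_shift_op_scal, Hm by auto. apply functional_extensionality. intros; ring.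
Qed.

Lemma root_vector_plus lambda x y : root_vector nu U lambda x -> root_vector nu U lambda y ->
  root_vector nu U lambda (fun n => x n + y n)%C.
Proof.
intros [Hx (m & Hm)] [Hy (m' & Hm')]. split; [now apply L2_plus|]. exists (m + m')%nat.
rewrite iter_shift_op_plus by auto.
rewrite (Nat.iter_add m m' _ _ y), Hm', (Nat.add_comm m m'), (Nat.iter_add m' m _ _ x), Hm.
rewrite !iter_shift_op_0. apply functional_extensionality. intros; ring.
Qed.

Lemma root_vector_of_image lambda y : L2 nu y -> root_vector nu U lambda (shift_op U lambda y) ->
  root_vector nu U lambda y.
Proof.
intros Hy [_ (m & Hm)]. split; auto. exists (S m). simpl. now rewrite <- Nat.iter_swap.
Qed.

Lemma root_vector_image lambda y : root_vector nu U lambda y ->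
  root_vector nu U lambda (shift_op U lambda y).
Proof.
intros [Hy (m & Hm)]. split; [now apply shift_op_L2|]. exists m.
rewrite Nat.iter_swap, Hm. exact (iter_shift_op_0 lambda 1).
Qed.

Lemma root_vector_operator lambda y : root_vector nu U lambda y -> root_vector nu U lambda (U y).
Proof.
intros H. pose proof (root_vector_plus _ _ _ (root_vector_image _ _ H) (root_vector_scal _ lambda _ H)) as H'.
replace (U y) with (fun n => shift_op U lambda y n + lambda * y n)%C; auto.
apply functional_extensionality. intros n. unfold shift_op. ring.
Qed.

End LinearOperator.

(** * The perturbation determinant *)

Section Perturbation.
Context (s : nat -> C) (nu : nat -> R) (a b : nat -> C) (D : perturbation_data s nu a b).
Let L := rank_one_perturbation nu s a b.
Let Hnu := pd_nu _ _ _ _ D.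

Lemma perturbation_maps_L2 : maps_L2 nu L.
Proof.
apply maps_L2_rank_one_perturbation; try apply D.
destruct (Ctends_0_bounded s (pd_null _ _ _ _ D)) as (M & _ & HM). now exists M.
Qed.

Lemma perturbation_plus x y : L2 nu x -> L2 nu y ->
  L (fun n => x n + y n)%C = (fun n => L x n + L y n)%C.
Proof.
intros Hx Hy. apply functional_extensionality. intros n.
unfold L, rank_one_perturbation, rank_one, mul_op. rewrite inner_plus_l; auto; [ring|apply D].
Qed.

Lemma perturbation_scal c x : L2 nu x -> L (fun n => c * x n)%C = (fun n => c * L x n)%C.
Proof.
intros Hx. apply functional_extensionality. intros n.
unfold L, rank_one_perturbation, rank_one, mul_op. rewrite inner_scal_l; auto; [ring|apply D].
Qed.

(** With [A] the multiplication operator, [resolvent_sum s (coupling x) z] is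
    the inner product of [(1 - z A)^-1 a] with [x]. *)
Definition coupling (x : nat -> C) : nat -> C := fun n => (a n * Cconj (x n) * nu n)%C.

Lemma coupling_summable x : L2 nu x -> summable (coupling x).
Proof. intros Hx. apply inner_abs; auto. apply D. Qed.

(** The perturbation determinant in the variable [z = / lambda]: if [z] is
    neither 0 nor one of the points [/ s n], then [phi z = 0] exactly when [/ z]
    is an eigenvalue of [L]. *)
Definition phi (z : C) : C := (1 - z * resolvent_sum s (coupling b) z)%C.

(** The [m]-th iterated divided difference of [phi] at [z0]. *)
Definition phi_quot (z0 : C) (m : nat) (z : C) : C :=
  match m with
  | O => phi z
  | S j => (- (resolvent_sum s (shifted_iter s z0 j (coupling b)) z0
              + z * resolvent_sum s (shifted_iter s z0 m (coupling b)) z))%C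
  end.

Lemma coupling_b_summable : summable (coupling b).
Proof. apply coupling_summable, D. Qed.

Lemma phi_quot_expansion z0 m z : regular s (coupling b) z0 -> regular s (coupling b) z ->
  phi_quot z0 m z = (phi_quot z0 m z0 + (z - z0) * phi_quot z0 (S m) z)%C.
Proof.
intros H0 H. pose proof coupling_b_summable as Hc. pose proof (pd_null _ _ _ _ D) as Hs.
destruct m as [|m].
- simpl. unfold phi. rewrite (resolvent_expansion s (coupling b) z0 z) by auto. ring.
- unfold phi_quot. set (e := shifted_iter s z0 (S m) (coupling b)).
  change (shifted_iter s z0 (S (S m)) (coupling b)) with (shifted s z0 e).
  rewrite (resolvent_expansion s e z0 z);
    unfold e; auto using shifted_iter_regular, shifted_iter_summable. ring.
Qed.

Lemma phi_factor z0 m z : regular s (coupling b) z0 -> regular s (coupling b) z ->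
  (forall j, (j < m)%nat -> phi_quot z0 j z0 = 0) -> phi z = ((z - z0) ^ m * phi_quot z0 m z)%C.
Proof.
intros H0 H. induction m as [|m IH]; intros Hj.
- simpl. ring.
- rewrite IH by auto. rewrite (phi_quot_expansion z0 m z), (Hj m) by auto. rewrite Cpow_S. ring.
Qed.

Lemma germ_phi_quot k z0 m : regular s (coupling b) z0 -> germ k (phi_quot z0 m) z0.
Proof.
intros H. pose proof coupling_b_summable as Hc. pose proof (pd_null _ _ _ _ D) as Hs.
assert (G : forall c e, summable e -> regular s e z0 ->
   germ k (fun z => c + (- (1)) * (z * resolvent_sum s e z))%C z0).
{ intros c e He Hr. apply germ_plus; [apply germ_const|]. apply germ_mult; [apply germ_const|].
  apply germ_mult; [apply germ_id|]. now apply germ_resolvent. }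
destruct m as [|m].
- apply (germ_ext k _ _ z0 1 Rlt_0_1) with (2 := G 1 _ Hc H). intros w _. simpl. unfold phi. ring.
- eapply (germ_ext k _ _ z0 1 Rlt_0_1) with
    (2 := G (- resolvent_sum s (shifted_iter s z0 m (coupling b)) z0)%C
            (shifted_iter s z0 (S m) (coupling b)) _ _).
  intros w _. simpl. ring.
  Unshelve.
  + now apply shifted_iter_summable.
  + now apply shifted_iter_regular.
Qed.

(** If all divided differences of [phi] at [z0] vanished, so would all moments
    of the masses [c n / (1 - z0 * s n) ^ 2] at the distinct nodes [s n / (1 -
    z0 * s n)]; then [c = 0] by [moments_zero], and [phi z0] would be 1. *)
Lemma phi_finite_order z0 : regular s (coupling b) z0 ->
  exists m, phi_quot z0 m z0 <> 0 /\ forall j, (j < m)%nat -> phi_quot z0 j z0 = 0.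
Proof.
intros Hr. apply NNPP. intros Hno.
assert (Hall : forall m, phi_quot z0 m z0 = 0).
{ intros m. induction m as [m IH] using (well_founded_induction lt_wf).
  apply NNPP. intros H. apply Hno. exists m. split; auto. }
pose proof coupling_b_summable as Hc. pose proof (pd_null _ _ _ _ D) as Hs.
set (c := coupling b) in *.
assert (Hrho : forall n, c n <> 0 -> (1 - z0 * s n)%C <> 0).
{ intros n Hn E. apply Hn, Hr. symmetry. now apply Cminus_eq_0. }
assert (Hce : forall n, (c n * / (1 - z0 * s n) * / (1 - z0 * s n))%C = 0).
{ apply (moments_zero _ (fun n => s n * / (1 - z0 * s n))%C).
  - apply summable_ext with (fun n => c n * / (1 - z0 * s n) * / (1 - z0 * s n))%C; [intros; ring|].
    assert (H1 : summable (fun n => c n * / (1 - z0 * s n))%C) by (now apply resolvent_summable).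
    apply (resolvent_summable s _ z0 Hs H1). intros n Hn. rewrite (Hr n Hn). ring.
  - destruct (denominators_lower_bound s z0 Hs) as (kap & d & Hk & Hd & H).
    intros e He. destruct (Hs (e * kap)) as (K & HK); [now apply Rmult_lt_0_compat|].
    exists K. intros n Hn. specialize (HK n Hn). rewrite Cmod_mult.
    destruct (classic ((z0 * s n)%C = 1)) as [E|E].
    + rewrite E. replace (1 - 1)%C with (RtoC 0) by ring. rewrite Cinv_0, Cmod_0. lra.
    + specialize (H z0 n). replace (z0 - z0)%C with (RtoC 0) in H by ring.
      rewrite Cmod_0 in H. specialize (H Hd E).
      rewrite Cmod_inv by (apply Cmod_gt_0; lra).
      apply Rle_lt_trans with (Cmod (s n) * / kap).
      * apply Rmult_le_compat_l; [apply Cmod_ge_0|]. apply Rinv_le_contravar; lra.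
      * apply Rmult_lt_reg_r with kap; auto. rewrite Rmult_assoc, Rinv_l; lra.
  - intros n Hn. apply Cmult_neq_0_inv in Hn as [Hn Hi]. apply Cmult_neq_0; auto. apply D.
  - intros m n Hm Hn E. apply Cmult_neq_0_inv in Hm as [Hm _], Hn as [Hn _].
    apply Cmult_neq_0_inv in Hm as [Hm _], Hn as [Hn _].
    apply Hrho in Hm. apply Hrho in Hn. apply (pd_inj _ _ _ _ D).
    assert (E2 : (s m * (1 - z0 * s n) = s n * (1 - z0 * s m))%C).
    { replace (s m * (1 - z0 * s n))%C with
        (s m * / (1 - z0 * s m) * (1 - z0 * s m) * (1 - z0 * s n))%C by (field; auto).
      rewrite E. field. auto. }
    replace (s m) with (s m * (1 - z0 * s n) + z0 * s m * s n)%C by ring. rewrite E2. ring.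
  - intros j. pose proof (Hall (S j)) as Hj. unfold phi_quot in Hj. fold c in Hj.
    assert (Hsj : forall i, summable (fun n => shifted_iter s z0 i c n * / (1 - z0 * s n))%C).
    { intros i. apply resolvent_summable; auto using shifted_iter_summable, shifted_iter_regular. }
    unfold resolvent_sum in Hj. rewrite <- CSeries_scal, <- CSeries_plus in Hj;
      [|apply Hsj|apply (summable_scal z0), Hsj|apply Hsj].
    rewrite (CSeries_ext _ (fun n => shifted_iter s z0 j c n * / (1 - z0 * s n) +
      z0 * (shifted_iter s z0 (S j) c n * / (1 - z0 * s n)))%C).
    + match type of Hj with (- ?X)%C = _ => replace X with (- - X)%C by ring; rewrite Hj; ring end.
    + intros n. rewrite !shifted_iter_eq, Cpow_S.
      destruct (classic (c n = 0)) as [->|Hn]; [ring|]. apply Hrho in Hn.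
      generalize ((s n * / (1 - z0 * s n)) ^ j)%C. intros X. field. auto. }
assert (Hc0 : forall n, c n = 0).
{ intros n. apply NNPP. intros Hn. specialize (Hce n).
  pose proof (Hrho n Hn) as H1. revert Hce. apply Cmult_neq_0; [apply Cmult_neq_0; auto|];
  intros E; apply H1; rewrite <- (Cmult_1_r (1 - z0 * s n)), <- (Cinv_r _ H1), E; ring. }
specialize (Hall O). simpl in Hall. unfold phi, resolvent_sum in Hall. fold c in Hall.
rewrite (CSeries_ext _ (fun _ => RtoC 0)), CSeries_0 in Hall by (intros n; rewrite Hc0; ring).
replace (1 - z0 * 0)%C with (RtoC 1) in Hall by ring. injection Hall. lra.
Qed.
End Perturbation.

(** * Jordan chains *)

Section Chain.
Context (s : nat -> C) (nu : nat -> R) (a b : nat -> C) (D : perturbation_data s nu a b).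
Let L := rank_one_perturbation nu s a b.
Let Hnu := pd_nu _ _ _ _ D.
Let phiq := phi_quot s nu a b.
Let cpl := coupling nu a.

(** The derivatives of [(1 - z A)^-1 a] at [z0], divided by [j] factorial, where
    [A] is the multiplication operator. *)
Definition chain (z0 : C) (j : nat) : nat -> C :=
  fun n => (a n * (s n * / (1 - z0 * s n)) ^ j * / (1 - z0 * s n))%C.

(** The part of [a] at the eigenvalue [/ z0] of the multiplication operator, if
    there is one; [chain] omits it because the inverse of 0 is 0. *)
Definition resonant (z0 : C) : nat -> C :=
  fun n => if Ceq_dec (z0 * s n)%C 1 then a n else RtoC 0.

Lemma inverse_factor_bounded z0 : exists M, 0 < M /\ forall n, Cmod (/ (1 - z0 * s n)) <= M.
Proof.
destruct (denominators_lower_bound s z0 (pd_null _ _ _ _ D)) as (kap & d & Hk & Hd & H).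
exists (/ kap). split; [now apply Rinv_0_lt_compat|]. intros n.
destruct (classic ((z0 * s n)%C = 1)) as [E|E].
- rewrite E. replace (1 - 1)%C with (RtoC 0) by ring. rewrite Cinv_0, Cmod_0.
  left; now apply Rinv_0_lt_compat.
- specialize (H z0 n). replace (z0 - z0)%C with (RtoC 0) in H by ring.
  rewrite Cmod_0 in H. specialize (H Hd E).
  rewrite Cmod_inv by (apply Cmod_gt_0; lra). apply Rinv_le_contravar; lra.
Qed.

Lemma chain_L2 z0 j : L2 nu (chain z0 j).
Proof.
destruct (inverse_factor_bounded z0) as (M & HM & Hi).
destruct (Ctends_0_bounded s (pd_null _ _ _ _ D)) as (S & HS & HsS).
apply (L2_ext nu (fun n => ((s n * / (1 - z0 * s n)) ^ j * / (1 - z0 * s n)) * a n)%C).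
- intros n. unfold chain. ring.
- apply (L2_bounded_mult nu (fun n => (s n * / (1 - z0 * s n)) ^ j * / (1 - z0 * s n))%C a ((S * M) ^ j * M)); auto; [|apply D].
  intros n. rewrite Cmod_mult, Cmod_pow, Cmod_mult. apply Rmult_le_compat; auto using Cmod_ge_0.
  + apply pow_le, Rmult_le_pos; apply Cmod_ge_0.
  + apply pow_incr. split; [apply Rmult_le_pos; apply Cmod_ge_0|].
    apply Rmult_le_compat; auto using Cmod_ge_0.
Qed.

Lemma inner_chain z0 j x : inner nu (chain z0 j) x = resolvent_sum s (shifted_iter s z0 j (cpl x)) z0.
Proof.
unfold inner, resolvent_sum. apply CSeries_ext. intros n. rewrite shifted_iter_eq.
unfold chain, cpl, coupling. ring.
Qed.

Lemma chain_start (z0 : C) : z0 <> 0 -> regular s (cpl b) z0 ->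
  shift_op L (/ z0) (chain z0 0) = (fun n => - (/ z0) * phiq z0 0 z0 * a n + / z0 * resonant z0 n)%C.
Proof.
intros Hz Hr. apply functional_extensionality. intros n.
unfold shift_op, L, rank_one_perturbation, rank_one, mul_op. rewrite inner_chain.
change (shifted_iter s z0 0 (cpl b)) with (cpl b). unfold phiq, phi_quot, phi. fold (cpl b).
generalize (resolvent_sum s (cpl b) z0). intros kap. unfold chain, resonant. simpl.
destruct (Ceq_dec (z0 * s n)%C 1) as [E|E].
- rewrite E. replace (1 - 1)%C with (RtoC 0) by ring. rewrite Cinv_0. field. auto.
- assert (H1 : (1 - z0 * s n)%C <> 0) by (intros E'; apply E; symmetry; now apply Cminus_eq_0).
  field. auto.
Qed.

(** [L - / z0] moves the chain down by one step, up to multiples of [a] whose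
    coefficients are the divided differences of [phi]; these disappear at a zero
    of sufficient order. *)
Lemma chain_step (z0 : C) j : z0 <> 0 -> regular s (cpl b) z0 ->
  shift_op L (/ z0) (chain z0 (S j)) =
  (fun n => - (/ z0 * / z0) * chain z0 j n + - (/ z0) * shift_op L (/ z0) (chain z0 j) n
            + - (/ z0) * phiq z0 (S j) z0 * a n)%C.
Proof.
intros Hz Hr. apply functional_extensionality. intros n.
unfold shift_op, L, rank_one_perturbation, rank_one, mul_op. rewrite !inner_chain.
unfold phiq, phi_quot. fold (cpl b).
generalize (resolvent_sum s (shifted_iter s z0 j (cpl b)) z0). intros kj.
generalize (resolvent_sum s (shifted_iter s z0 (S j) (cpl b)) z0). intros kj1.
unfold chain. rewrite Cpow_S.
destruct (classic ((z0 * s n)%C = 1)) as [E|E].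
- rewrite E. replace (1 - 1)%C with (RtoC 0) by ring. rewrite Cinv_0. field. auto.
- assert (H1 : (1 - z0 * s n)%C <> 0) by (intros E'; apply E; symmetry; now apply Cminus_eq_0).
  generalize ((s n * / (1 - z0 * s n)) ^ j)%C. intros X. field. auto.
Qed.

Lemma resonant_L2 z0 : L2 nu (resonant z0).
Proof.
apply (L2_ext nu (fun n => (if Ceq_dec (z0 * s n)%C 1 then RtoC 1 else RtoC 0) * a n)%C).
- intros n. unfold resonant. destruct (Ceq_dec _ _); ring.
- apply (L2_bounded_mult nu (fun n => if Ceq_dec (z0 * s n)%C 1 then RtoC 1 else RtoC 0) a 1); auto; [|apply D].
  intros n. destruct (Ceq_dec _ _); rewrite ?Cmod_1, ?Cmod_0; lra.
Qed.

(** At a regular point the coupling [c n] vanishes at the resonant index, so the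
    rank one part annihilates this vector. *)
Lemma resonant_root_vector (z0 : C) : z0 <> 0 -> regular s (cpl b) z0 ->
  root_vector nu L (/ z0) (resonant z0).
Proof.
intros Hz Hr. split; [apply resonant_L2|]. exists 1%nat.
apply functional_extensionality. intros n. simpl.
unfold shift_op, L, rank_one_perturbation, rank_one, mul_op.
assert (E0 : inner nu (resonant z0) b = 0).
{ unfold inner. rewrite (CSeries_ext _ (fun _ => RtoC 0)); [apply CSeries_0|].
  intros k. unfold resonant. destruct (Ceq_dec (z0 * s k)%C 1) as [E|E]; [|ring].
  exact (Hr k E). }
rewrite E0. unfold resonant. destruct (Ceq_dec (z0 * s n)%C 1) as [E|E]; [|ring].
replace (s n) with (/ z0 * (z0 * s n))%C by (field; auto). rewrite E. ring.
Qed.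

Local Notation rv := (root_vector nu L).
Local Notation rv_plus := (root_vector_plus nu L Hnu (perturbation_maps_L2 s nu a b D)
  (perturbation_plus s nu a b D) (perturbation_scal s nu a b D)).
Local Notation rv_scal := (root_vector_scal nu L Hnu (perturbation_maps_L2 s nu a b D)
  (perturbation_scal s nu a b D)).
Local Notation rv_image := (root_vector_image nu L Hnu (perturbation_maps_L2 s nu a b D)
  (perturbation_scal s nu a b D)).

Lemma chain_root_vector (z0 : C) m : z0 <> 0 -> regular s (cpl b) z0 ->
  (forall j, (j <= m)%nat -> phiq z0 j z0 = 0) -> rv (/ z0)%C (chain z0 m).
Proof.
intros Hz Hr. induction m as [|m IH]; intros H0.
- apply root_vector_of_image; [apply chain_L2|]. rewrite chain_start, (H0 O) by auto.
  replace (fun n => _) with (fun n => / z0 * resonant z0 n)%C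
    by (apply functional_extensionality; intros; ring).
  apply rv_scal. now apply resonant_root_vector.
- assert (Hm : rv (/ z0)%C (chain z0 m)) by auto.
  apply root_vector_of_image; [apply chain_L2|]. rewrite chain_step, (H0 (S m)) by auto.
  replace (fun n => _) with (fun n => - (/ z0 * / z0) * chain z0 m n
      + - (/ z0) * shift_op L (/ z0) (chain z0 m) n)%C
    by (apply functional_extensionality; intros; ring).
  apply rv_plus; apply rv_scal; auto. now apply rv_image.
Qed.

(** Modulo root vectors, the first member of the chain that is not one is mapped
    to a nonzero multiple of [a]; so it can correct any vector mapped to a
    multiple of [a]. This will be applied to [delta n] with [z0 = / s n]. *)
Lemma corrected_root_vector (z0 : C) m y k : z0 <> 0 -> regular s (cpl b) z0 ->
  (forall j, (j < m)%nat -> phiq z0 j z0 = 0) -> phiq z0 m z0 <> 0 -> L2 nu y ->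
  shift_op L (/ z0) y = (fun n => k * a n)%C ->
  rv (/ z0)%C (fun n => y n + (k * z0 * / phiq z0 m z0) * chain z0 m n)%C.
Proof.
intros Hz Hr H0 Hm Hy Hk.
assert (Hc : L2 nu (fun n => (k * z0 * / phiq z0 m z0) * chain z0 m n)%C) by (apply L2_scal, chain_L2).
apply root_vector_of_image; [now apply L2_plus|].
rewrite (shift_op_plus nu L (perturbation_plus s nu a b D)) by auto.
rewrite (shift_op_scal nu L (perturbation_scal s nu a b D)) by apply chain_L2.
rewrite Hk. destruct m as [|m].
- rewrite chain_start by auto.
  replace (fun n => _) with (fun n => (k * / phiq z0 0 z0) * resonant z0 n)%C
    by (apply functional_extensionality; intros; field; auto).
  apply rv_scal. now apply resonant_root_vector.
- rewrite chain_step by auto.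
  assert (Hcm : rv (/ z0)%C (chain z0 m)).
  { apply chain_root_vector; auto. intros j Hj. apply H0. lia. }
  set (T := shift_op L (/ z0) (chain z0 m)).
  replace (fun n => _) with (fun n => (- (k * / phiq z0 (S m) z0 * / z0)) * chain z0 m n
      + (- (k * / phiq z0 (S m) z0)) * T n)%C
    by (apply functional_extensionality; intros; field; auto).
  apply rv_plus; apply rv_scal; auto. now apply rv_image.
Qed.

End Chain.

(** * The entire function attached to an orthogonal vector *)

Definition remove_term (n0 : nat) (e : nat -> C) : nat -> C :=
  fun n => if Nat.eq_dec n n0 then RtoC 0 else e n.

Lemma remove_term_summable n0 e : summable e -> summable (remove_term n0 e).
Proof.
intros He. apply (summable_le _ (fun n => Cmod (e n))); auto.
intros n. unfold remove_term. destruct (Nat.eq_dec n n0); [|lra]. rewrite Cmod_0. apply Cmod_ge_0.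
Qed.

Lemma resolvent_split s e n0 z : Ctends_0 s -> summable e -> regular s (remove_term n0 e) z ->
  resolvent_sum s e z = (e n0 * / (1 - z * s n0) + resolvent_sum s (remove_term n0 e) z)%C.
Proof.
intros Hs He Hr. unfold resolvent_sum.
rewrite <- (CSeries_delta n0 (fun n => e n * / (1 - z * s n))%C), <- CSeries_plus.
- apply CSeries_ext. intros n. unfold remove_term, delta. destruct (Nat.eq_dec n n0); ring.
- apply summable_delta.
- apply resolvent_summable; auto using remove_term_summable.
Qed.

Lemma continuous_agree f g z0 d : germ 1 f z0 -> germ 1 g z0 -> 0 < d ->
  (forall z, 0 < Cmod (z - z0) < d -> f z = g z) -> f z0 = g z0.
Proof.
intros Hf Hg Hd H. apply NNPP. intros Hne.
set (e := Cmod (f z0 - g z0) / 3).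
assert (He : 0 < e).
{ unfold e. assert (0 < Cmod (f z0 - g z0)); [|lra].
  apply Cmod_gt_0. intros E. apply Hne. now apply Cminus_eq_0. }
destruct (germ_continuous _ _ Hf e He) as (d1 & Hd1 & E1).
destruct (germ_continuous _ _ Hg e He) as (d2 & Hd2 & E2).
set (t := Rmin d (Rmin d1 d2) / 2).
assert (Hm : 0 < Rmin d (Rmin d1 d2)) by (repeat apply Rmin_pos; auto).
pose proof (Rmin_l d (Rmin d1 d2)). pose proof (Rmin_r d (Rmin d1 d2)).
pose proof (Rmin_l d1 d2). pose proof (Rmin_r d1 d2).
assert (Ht : Cmod (z0 + t - z0)%C = t).
{ replace (z0 + t - z0)%C with (RtoC t) by ring. apply Cmod_RtoC_pos. unfold t; lra. }
specialize (H (z0 + t)%C). specialize (E1 (z0 + t)%C). specialize (E2 (z0 + t)%C).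
rewrite Ht in H, E1, E2. rewrite H in E1 by (unfold t; lra).
specialize (E1 ltac:(unfold t; lra)). specialize (E2 ltac:(unfold t; lra)).
assert (3 * e <= 2 * e); [|lra].
replace (3 * e) with (Cmod (f z0 - g z0)) by (unfold e; field).
replace (f z0 - g z0)%C with (- (g (z0 + t) - f z0) + (g (z0 + t) - g z0))%C by ring.
eapply Rle_trans; [apply Cmod_triangle|]. rewrite Cmod_opp. lra.
Qed.

Section Extension.
Context (s : nat -> C) (nu : nat -> R) (a b : nat -> C) (D : perturbation_data s nu a b).
Let L := rank_one_perturbation nu s a b.
Let Hnu := pd_nu _ _ _ _ D.
Let Hs := pd_null _ _ _ _ D.
Let phiq := phi_quot s nu a b.
Let cpl := coupling nu a.
Let Phi := phi s nu a b.

Definition good_point (z : C) : Prop := regular s (cpl b) z /\ Phi z <> 0.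

Definition numerator (x : nat -> C) (z : C) : C := (z * resolvent_sum s (cpl x) z)%C.

Definition orthogonal_to_roots (x : nat -> C) : Prop :=
  L2 nu x /\ forall y, generalized_eigenvector nu L y -> inner nu y x = 0.

Context (x : nat -> C) (Hx : orthogonal_to_roots x).

Lemma root_vector_orthogonal lambda y : root_vector nu L lambda y -> inner nu y x = 0.
Proof. intros H. apply Hx. eapply root_vector_generalized, H. Qed.

Lemma nu_neq_0 n : RtoC (nu n) <> 0.
Proof. apply RtoC_neq_0. specialize (Hnu n). lra. Qed.

Lemma Cconj_eq_0 z : Cconj z = 0 -> z = 0.
Proof. intros H. apply Cmod_eq_0. rewrite <- Cmod_conj, H. apply Cmod_0. Qed.

Lemma shift_op_delta n0 : shift_op L (s n0) (delta n0) = (fun n => Cconj (b n0) * nu n0 * a n)%C.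
Proof.
apply functional_extensionality. intros n.
unfold shift_op, L, rank_one_perturbation, rank_one, mul_op. rewrite inner_delta_l.
unfold delta. destruct (Nat.eq_dec n n0) as [->|]; ring.
Qed.

(** When [b n = 0] the unit vector [delta n] is an eigenvector. *)
Lemma orthogonal_vanishes n : b n = 0 -> x n = 0.
Proof.
intros Hb. assert (H : inner nu (delta n) x = 0).
{ apply (root_vector_orthogonal (s n)). split; [apply L2_delta|]. exists 1%nat. simpl.
  rewrite shift_op_delta, Hb. apply functional_extensionality. intros k.
  replace (Cconj 0) with (RtoC 0) by (unfold Cconj, RtoC; simpl; f_equal; ring). ring. }
rewrite inner_delta_l in H. apply Cmult_integral in H as [H|H].
- now apply Cconj_eq_0.
- now apply nu_neq_0 in H.
Qed.

Lemma coupling_0 n : cpl b n = 0 -> cpl x n = 0.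
Proof.
unfold cpl, coupling. intros H. apply Cmult_integral in H as [H|H]; [|now apply nu_neq_0 in H].
apply Cmult_integral in H as [H|H].
- rewrite H. ring.
- rewrite (orthogonal_vanishes n) by (now apply Cconj_eq_0).
  replace (Cconj 0) with (RtoC 0) by (unfold Cconj, RtoC; simpl; f_equal; ring). ring.
Qed.

Lemma regular_coupling z : regular s (cpl b) z -> regular s (cpl x) z.
Proof. intros H n Hn. apply coupling_0, H, Hn. Qed.

Let Scb : summable (cpl b) := coupling_b_summable s nu a b D.
Let Scx : summable (cpl x) := coupling_summable s nu a b D x (proj1 Hx).

(** The last clause records the values at the points [/ s n], from which [x]
    will be recovered. *)
Definition local_extension (z0 : C) (f : C -> C) : Prop :=
  germ 3 f z0 /\
  (exists d, 0 < d /\ forall z, 0 < Cmod (z - z0) < d ->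
     good_point z /\ (f z * Phi z)%C = numerator x z) /\
  (forall n, (z0 * s n)%C = 1 -> (f z0 * Cconj (b n))%C = (- Cconj (x n))%C).

(** At a zero of [phi] of order [m] the first [m] divided differences of the
    numerator are inner products of [x] with the Jordan chain, so they vanish
    and the zero cancels. If [z0 = / s n], then orthogonality of [x] to the root
    vector obtained from [delta n] gives the value of the quotient. *)
Lemma local_extension_regular z0 : regular s (cpl b) z0 -> exists f, local_extension z0 f.
Proof.
intros Hr. destruct (phi_finite_order s nu a b D z0 Hr) as (m & Hm & H0).
fold phiq in Hm, H0.
pose proof (regular_coupling z0 Hr) as Hrx.
assert (Hz0 : (0 < m)%nat -> z0 <> 0).
{ intros Hpos E. specialize (H0 O Hpos). unfold phiq, phi_quot, phi in H0. rewrite E in H0.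
  rewrite Cmult_0_l in H0. replace (1 - 0)%C with (RtoC 1) in H0 by ring. injection H0. lra. }
assert (HG : forall j, (j < m)%nat -> resolvent_sum s (shifted_iter s z0 j (cpl x)) z0 = 0).
{ intros j Hj. unfold cpl. rewrite <- inner_chain.
  apply (root_vector_orthogonal (/ z0)). apply (chain_root_vector s nu a b D); auto.
  - apply Hz0. lia.
  - intros i Hi. apply H0. lia. }
exists (fun z => z * resolvent_sum s (shifted_iter s z0 m (cpl x)) z * / phiq z0 m z)%C.
split; [|split].
- apply germ_mult; [apply germ_mult; [apply germ_id|]|].
  + apply germ_resolvent; auto using shifted_iter_summable, shifted_iter_regular.
  + apply (germ_inv 2); auto. now apply germ_phi_quot.
- destruct (regular_near s (cpl b) z0 Hs Hr) as (d1 & Hd1 & R1).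
  destruct (germ_nonzero_near (phiq z0 m) z0) as (d2 & Hd2 & N); auto.
  { now apply germ_phi_quot. }
  exists (Rmin d1 d2). split; [now apply Rmin_pos|]. intros z [Hz0' Hz].
  apply Rmin_lt_inv in Hz as [Hz1 Hz2].
  assert (Hnz : phiq z0 m z <> 0).
  { apply Cmod_gt_0. specialize (N z Hz2). pose proof (Cmod_ge_0 (phiq z0 m z0)). lra. }
  assert (Hzz : (z - z0)%C <> 0) by (now apply Cmod_gt_0).
  specialize (R1 z Hz1).
  assert (E : Phi z = ((z - z0) ^ m * phiq z0 m z)%C) by (apply phi_factor; auto).
  split; [split; auto|].
  + rewrite E. apply Cmult_neq_0; auto. now apply Cpow_nz.
  + rewrite E. unfold numerator.
    rewrite (resolvent_zero_order s (cpl x) z0 z m); auto using regular_coupling. field. auto.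
- intros n Hn. assert (Hz : z0 <> 0) by (intros E; rewrite E, Cmult_0_l in Hn; injection Hn; lra).
  assert (Hsn : (/ z0)%C = s n).
  { replace (s n) with (/ z0 * (z0 * s n))%C by (field; auto). rewrite Hn. ring. }
  assert (Hin : inner nu (fun k => delta n k + (Cconj (b n) * nu n * z0 * / phiq z0 m z0) * chain s a z0 m k)%C x = 0).
  { apply (root_vector_orthogonal (/ z0)). apply (corrected_root_vector s nu a b D); auto.
    - apply L2_delta.
    - rewrite Hsn. apply shift_op_delta. }
  rewrite inner_plus_l in Hin; auto.
  + rewrite inner_scal_l in Hin; auto; [|apply (chain_L2 s nu a b D)|apply Hx].
    rewrite inner_delta_l, inner_chain in Hin. fold cpl in Hin.
    revert Hin. generalize (resolvent_sum s (shifted_iter s z0 m (cpl x)) z0). intros G Hin.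
    pose proof (nu_neq_0 n) as Hnn.
    assert (E : ((Cconj (x n) + z0 * G * / phiq z0 m z0 * Cconj (b n)) * nu n)%C = 0).
    { rewrite <- Hin. ring. }
    apply Cmult_integral in E as [E|E]; [|contradiction].
    apply Cminus_eq_0. rewrite <- E. ring.
  + apply L2_delta.
  + apply L2_scal, (chain_L2 s nu a b D).
  + apply Hx.
Qed.

(** The pole of [phi] here is simple, and multiplying numerator and denominator
    by [1 - z * s n0] removes it from both. *)
Lemma local_extension_singular z0 n0 : (z0 * s n0)%C = 1 -> cpl b n0 <> 0 ->
  exists f, local_extension z0 f.
Proof.
intros Hn0 Hc0.
assert (Hz : z0 <> 0) by (intros E; rewrite E, Cmult_0_l in Hn0; injection Hn0; lra).
assert (Huniq : forall n, (z0 * s n)%C = 1 -> n = n0).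
{ intros n Hn. apply (pd_inj _ _ _ _ D).
  replace (s n) with (/ z0 * (z0 * s n))%C by (field; auto).
  replace (s n0) with (/ z0 * (z0 * s n0))%C by (field; auto). now rewrite Hn, Hn0. }
assert (Hrem : forall e, regular s (remove_term n0 e) z0).
{ intros e n Hn. unfold remove_term. rewrite (Huniq n Hn). now destruct (Nat.eq_dec n0 n0). }
set (U := fun z => (z * cpl x n0 + (1 + - (1) * (z * s n0)) * (z * resolvent_sum s (remove_term n0 (cpl x)) z))%C).
set (W := fun z => ((1 + - (1) * (z * s n0)) * (1 + - (1) * (z * resolvent_sum s (remove_term n0 (cpl b)) z))
                    + - (1) * (z * cpl b n0))%C).
assert (HW0 : W z0 = (- (z0 * cpl b n0))%C) by (unfold W; rewrite Hn0; ring).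
assert (HU0 : U z0 = (z0 * cpl x n0)%C) by (unfold U; rewrite Hn0; ring).
assert (HWnz : W z0 <> 0).
{ rewrite HW0. intros E. assert (E2 : (z0 * cpl b n0)%C = 0).
  { replace (z0 * cpl b n0)%C with (- - (z0 * cpl b n0))%C by ring. rewrite E. ring. }
  revert E2. now apply Cmult_neq_0. }
assert (HgW : germ 3 W z0).
{ unfold W. apply germ_plus; [apply germ_mult; apply germ_plus|apply germ_mult]; try apply germ_const.
  - apply germ_mult; [apply germ_const|]. apply germ_mult; [apply germ_id|apply germ_const].
  - apply germ_mult; [apply germ_const|]. apply germ_mult; [apply germ_id|].
    apply germ_resolvent; auto using remove_term_summable.
  - apply germ_mult; [apply germ_id|apply germ_const]. }
exists (fun z => U z * / W z)%C. split; [|split].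
- apply germ_mult; [|apply (germ_inv 2); auto].
  unfold U. apply germ_plus.
  + apply germ_mult; [apply germ_id|apply germ_const].
  + apply germ_mult; [apply germ_plus; [apply germ_const|]|].
    * apply germ_mult; [apply germ_const|]. apply germ_mult; [apply germ_id|apply germ_const].
    * apply germ_mult; [apply germ_id|]. apply germ_resolvent; auto using remove_term_summable.
- destruct (regular_near s (remove_term n0 (cpl b)) z0 Hs (Hrem _)) as (d1 & Hd1 & R1).
  destruct (regular_near s (remove_term n0 (cpl x)) z0 Hs (Hrem _)) as (d3 & Hd3 & R3).
  destruct (germ_nonzero_near W z0 (germ_le 3 1 _ _ ltac:(lia) HgW) HWnz) as (d2 & Hd2 & N).
  exists (Rmin d1 (Rmin d2 d3)). split; [repeat apply Rmin_pos; auto|]. intros z [Hz0' Hzd].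
  apply Rmin_lt_inv in Hzd as [Hz1 Hzd]. apply Rmin_lt_inv in Hzd as [Hz2 Hz3].
  specialize (R1 z Hz1). specialize (R3 z Hz3). specialize (N z Hz2).
  assert (HWz : W z <> 0) by (apply Cmod_gt_0; pose proof (Cmod_ge_0 (W z0)); lra).
  assert (Hzz : (z - z0)%C <> 0) by (now apply Cmod_gt_0).
  assert (H1 : (1 - z * s n0)%C <> 0).
  { intros E. apply Hzz. apply Cminus_eq_0 in E.
    assert (Ez : z = z0); [|rewrite Ez; ring].
    rewrite <- (Cmult_1_r z), <- Hn0. replace (z * (z0 * s n0))%C with (z0 * (z * s n0))%C by ring.
    rewrite <- E. ring. }
  assert (EW : W z = ((1 - z * s n0) * Phi z)%C).
  { unfold W, Phi, phi. fold cpl. rewrite (resolvent_split s (cpl b) n0 z) by auto. field. auto. }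
  assert (EU : U z = ((1 - z * s n0) * numerator x z)%C).
  { unfold U, numerator. rewrite (resolvent_split s (cpl x) n0 z) by auto. field. auto. }
  assert (HP : Phi z <> 0).
  { intros E. apply HWz. rewrite EW, E. ring. }
  split; [split; auto|].
  + intros n Hn. destruct (Nat.eq_dec n n0) as [->|Hne].
    * exfalso. apply H1. rewrite Hn. ring.
    * specialize (R1 n Hn). unfold remove_term in R1. destruct (Nat.eq_dec n n0); [contradiction|auto].
  + rewrite EU, EW. field. auto.
- intros n Hn. rewrite (Huniq n Hn), HU0, HW0.
  unfold cpl, coupling in Hc0 |- *. apply Cmult_neq_0_inv in Hc0 as [Hc0 Hnn].
  apply Cmult_neq_0_inv in Hc0 as [Ha Hb]. field. auto.
Qed.

Lemma local_extension_exists z0 : exists f, local_extension z0 f.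
Proof.
destruct (classic (regular s (cpl b) z0)) as [Hr|Hr]; [now apply local_extension_regular|].
apply not_all_ex_not in Hr as (n0 & Hn0). apply imply_to_and in Hn0 as [H1 H2].
now apply (local_extension_singular z0 n0).
Qed.

Lemma good_point_germ k z : good_point z -> germ k Phi z /\ germ k (numerator x) z.
Proof.
intros [Hr _]. split.
- exact (germ_phi_quot s nu a b D k z 0 Hr).
- apply germ_mult; [apply germ_id|]. apply germ_resolvent; auto using regular_coupling.
Qed.

(** Each local extension agrees with the quotient at every point near its centre
    where [phi] does not vanish, so the values at the centres fit together. *)
Lemma entire_extension : exists h : C -> C,
  (forall z, germ 3 h z) /\
  (forall z, good_point z -> (h z * Phi z)%C = numerator x z) /\
  (forall n, (h (/ s n) * Cconj (b n))%C = (- Cconj (x n))%C).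
Proof.
destruct (functional_choice _ _ _ local_extension_exists) as (F & HF).
assert (Hgood : forall z, good_point z -> (F z z * Phi z)%C = numerator x z).
{ intros z Hz. destruct (HF z) as (Hg & (d & Hd & Hn) & _).
  destruct (good_point_germ 1 z Hz) as [G1 G2].
  apply (continuous_agree (fun z' => F z z' * Phi z')%C (numerator x) z d); auto.
  - apply germ_mult; auto. now apply (germ_le 3 1); [lia|].
  - intros z' Hz'. now apply Hn. }
(* Each point is given the value of the local extension centred there. *)
exists (fun z => F z z). split; [|split]; auto.
- intros z0. destruct (HF z0) as (Hg & (d & Hd & Hn) & _).
  apply (germ_ext 3 (F z0) _ z0 d); auto. intros w Hw.
  destruct (classic (w = 0)) as [->|Hw0]; [rewrite Cplus_0_r; reflexivity|].
  assert (Hw' : 0 < Cmod (z0 + w - z0) < d).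
  { replace (z0 + w - z0)%C with w by ring. split; auto. now apply Cmod_gt_0. }
  destruct (Hn _ Hw') as [Hgp E]. pose proof (Hgood _ Hgp) as E'. rewrite <- E' in E.
  destruct Hgp as [_ HP].
  apply Cminus_eq_0. apply (f_equal (fun y => (y * / Phi (z0 + w))%C)) in E.
  replace (F z0 (z0 + w)%C) with (F z0 (z0 + w) * Phi (z0 + w) * / Phi (z0 + w))%C by (field; auto).
  rewrite E. field. auto.
- intros n. destruct (HF (/ s n)%C) as (_ & _ & H). apply H.
  apply Cinv_l, (pd_nonzero _ _ _ _ D).
Qed.

Lemma good_points_punctured z0 : exists d, 0 < d /\ forall z, 0 < Cmod (z - z0) < d -> good_point z.
Proof.
destruct (local_extension_exists z0) as (f & _ & (d & Hd & H) & _).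
exists d. split; auto. intros z Hz. now apply H.
Qed.
End Extension.

(** * A self-improving growth inequality *)

(** Iterating [k] times leaves the factor [delta ^ k] in front of [m (3 ^ k *
    x)], which is at most [Cst * (3 ^ p) ^ k * x ^ p]; for [delta < / 3 ^ p]
    this tends to 0. The inhomogeneous part is absorbed by subtracting [4 * A *
    (1 + ln x)]. *)
Lemma growth_bootstrap (m : R -> R) Cst p :
  (forall x y, 1 <= x <= y -> m x <= m y) ->
  (forall x, 1 <= x -> m x <= Cst * x ^ p) ->
  (forall delta, 0 < delta -> exists A x0, 0 <= A /\ 1 <= x0 /\ forall x, x0 <= x ->
     m x <= A + A * ln x + delta * m (3 * x)) ->
  exists A, 0 <= A /\ forall x, 1 <= x -> m x <= A * (1 + ln x).
Proof.
intros Hmono Hpoly Hstep.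
assert (H3p : 1 <= 3 ^ p) by (apply pow_R1_Rle; lra).
set (delta := / (4 * 3 ^ p)).
assert (Hd : 0 < delta) by (apply Rinv_0_lt_compat; lra).
assert (Hd4 : delta <= 1/4).
{ unfold delta. replace (1/4) with (/ 4) by field. apply Rinv_le_contravar; lra. }
destruct (Hstep delta Hd) as (A & x0 & HA & Hx0 & H).
set (u := fun x => m x - 4 * A * (1 + ln x)).
assert (Hln3 : ln 3 <= 2).
{ rewrite <- (ln_exp 2). apply ln_le; [lra|]. pose proof (exp_ineq1_le 2). lra. }
assert (Hu : forall x, x0 <= x -> u x <= delta * u (3 * x)).
{ intros x Hx. unfold u. rewrite ln_mult by lra. specialize (H x Hx).
  assert (0 <= ln x) by (rewrite <- ln_1; apply ln_le; lra).
  assert (0 <= A * ln x) by (apply Rmult_le_pos; lra).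
  assert (delta * (4 * A * (1 + (ln 3 + ln x))) <= 1/4 * (4 * A * (1 + (2 + ln x)))).
  { apply Rmult_le_compat; try lra.
    - apply Rmult_le_pos; [lra|]. assert (0 <= ln 3) by (rewrite <- ln_1; apply ln_le; lra). lra.
    - apply Rmult_le_compat_l; lra. }
  lra. }
assert (Hiter : forall k x, x0 <= x -> u x <= delta ^ k * u (3 ^ k * x)).
{ induction k as [|k IH]; intros x Hx; [simpl; rewrite !Rmult_1_l; lra|].
  assert (H3k : 1 <= 3 ^ k) by (apply pow_R1_Rle; lra).
  assert (Hk : x0 <= 3 ^ k * x) by nra.
  eapply Rle_trans; [apply IH; auto|]. simpl.
  replace (delta * delta ^ k * u (3 * 3 ^ k * x)) with (delta ^ k * (delta * u (3 * (3 ^ k * x)))).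
  - apply Rmult_le_compat_l; [apply pow_le; lra|]. apply Hu; auto.
  - rewrite <- !Rmult_assoc. ring. }
assert (Hneg : forall x, x0 <= x -> u x <= 0).
{ intros x Hx. apply Rnot_lt_le. intros Hpos.
  assert (HC : 0 <= Rabs Cst * x ^ p).
  { apply Rmult_le_pos; [apply Rabs_pos|apply pow_le; lra]. }
  assert (Hb : forall k, u x <= (1/4) ^ k * (Rabs Cst * x ^ p)).
  { intros k. eapply Rle_trans; [apply (Hiter k x Hx)|].
    assert (H3k : 1 <= 3 ^ k) by (apply pow_R1_Rle; lra).
    assert (Hk : 1 <= 3 ^ k * x) by nra.
    assert (Hm : u (3 ^ k * x) <= Rabs Cst * (3 ^ k * x) ^ p).
    { unfold u. specialize (Hpoly _ Hk).
      assert (0 <= ln (3 ^ k * x)) by (rewrite <- ln_1; apply ln_le; lra).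
      assert (0 <= A * (1 + ln (3 ^ k * x))) by (apply Rmult_le_pos; lra).
      assert (Cst * (3 ^ k * x) ^ p <= Rabs Cst * (3 ^ k * x) ^ p).
      { apply Rmult_le_compat_r; [apply pow_le; lra|apply Rle_abs]. }
      lra. }
    eapply Rle_trans; [apply Rmult_le_compat_l; [apply pow_le; lra|exact Hm]|].
    rewrite Rpow_mult_distr, <- pow_mult, (Nat.mul_comm k p), pow_mult.
    replace (delta ^ k * (Rabs Cst * ((3 ^ p) ^ k * x ^ p)))
      with ((delta ^ k * (3 ^ p) ^ k) * (Rabs Cst * x ^ p)) by ring.
    rewrite <- Rpow_mult_distr. right. f_equal. f_equal. unfold delta. field. lra. }
  destruct (pow_lt_1_zero (1/4)) with (y := u x / (Rabs Cst * x ^ p + 1)) as (k & Hk).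
  { rewrite Rabs_pos_eq; lra. }
  { apply Rdiv_lt_0_compat; lra. }
  specialize (Hk k (le_n _)). rewrite Rabs_pos_eq in Hk by (apply pow_le; lra).
  specialize (Hb k). assert (0 <= (1/4) ^ k) by (apply pow_le; lra).
  apply (Rmult_lt_compat_r (Rabs Cst * x ^ p + 1)) in Hk; [|lra].
  replace (u x / (Rabs Cst * x ^ p + 1) * (Rabs Cst * x ^ p + 1)) with (u x) in Hk by (field; lra).
  lra. }
exists (4 * A + Rabs (m x0)).
pose proof (Rabs_pos (m x0)). split; [lra|]. intros x Hx.
assert (0 <= ln x) by (rewrite <- ln_1; apply ln_le; lra).
destruct (Rle_dec x0 x) as [Hge|Hlt].
- specialize (Hneg x Hge). unfold u in Hneg.
  assert (0 <= Rabs (m x0) * (1 + ln x)) by (apply Rmult_le_pos; lra). lra.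
- specialize (Hmono x x0 ltac:(lra)). pose proof (Rle_abs (m x0)).
  assert (Rabs (m x0) * 1 <= Rabs (m x0) * (1 + ln x)) by (apply Rmult_le_compat_l; lra).
  assert (0 <= 4 * A * (1 + ln x)) by (apply Rmult_le_pos; lra). lra.
Qed.

(** * Heads and tails of series *)

Definition below (K : nat) (f : nat -> R) (n : nat) : R := if lt_dec n K then f n else 0.
Definition above (K : nat) (f : nat -> R) (n : nat) : R := if lt_dec n K then 0 else f n.

Lemma finite_support_series (f : nat -> R) K : is_series (below K f) (rsum f K).
Proof.
unfold below.
induction K as [|K IH].
- simpl. apply is_series_ext with (fun n => if Nat.eq_dec n 0 then 0 else 0).
  + intros n. destruct (Nat.eq_dec n 0); auto.
  + apply (Series_single 0 0).
- simpl. apply is_series_ext with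
    (fun n => (if lt_dec n K then f n else 0) + (if Nat.eq_dec n K then f K else 0)).
  + intros n. destruct (Nat.eq_dec n K) as [->|Hn].
    * destruct (lt_dec K K); [lia|]. destruct (lt_dec K (S K)); [lra|lia].
    * destruct (lt_dec n K), (lt_dec n (S K)); try lia; lra.
  + apply (is_series_plus (K := R_AbsRing) (V := R_NormedModule)); auto. apply Series_single.
Qed.

Lemma rsum_le_Series f K : (forall n, 0 <= f n) -> ex_series f -> rsum f K <= Series f.
Proof.
intros Hf Hs. rewrite <- (is_series_unique _ _ (finite_support_series f K)).
apply Series_le; auto. intros n. specialize (Hf n). unfold below. destruct (lt_dec n K); lra.
Qed.

Lemma ex_series_above f K : (forall n, 0 <= f n) -> ex_series f -> ex_series (above K f).
Proof.
intros Hf. apply ex_series_pos_le. intros n. specialize (Hf n). unfold above.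
destruct (lt_dec n K); lra.
Qed.

Lemma Series_tail_small f e : (forall n, 0 <= f n) -> ex_series f -> 0 < e ->
  exists M, Series (above M f) < e.
Proof.
intros Hf Hs He. pose proof (Series_correct f Hs) as Hc.
destruct (Hc (ball (Series f) (mkposreal e He)) (locally_ball _ _)) as (n0 & Hn0).
specialize (Hn0 n0 (le_n _)). exists (S n0).
assert (E : forall n, sum_n f n = rsum f (S n)).
{ induction n as [|n IH]; [rewrite sum_O; simpl; ring|]. rewrite sum_Sn, IH. simpl. unfold plus; simpl. ring. }
assert (Hd : rsum f (S n0) > Series f - e).
{ change (Rabs (sum_n f n0 - Series f) < e) in Hn0. rewrite E in Hn0. apply Rabs_def2 in Hn0. lra. }
assert (Hx : ex_series (below (S n0) f)) by (eexists; apply finite_support_series).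
rewrite (Series_ext _ (fun n => f n - below (S n0) f n)).
- rewrite Series_minus, (is_series_unique _ _ (finite_support_series f (S n0))) by auto. lra.
- intros n. unfold above, below. destruct (lt_dec n (S n0)); ring.
Qed.

(** * Growth of the entire function *)

Section Growth.
Context (s : nat -> C) (Hnz : forall n, s n <> 0) (Hs : Ctends_0 s)
  (P : nat) (HP : (1 <= P)%nat) (HSP : ex_series (fun n => Cmod (s n) ^ P)).
Let t n := (/ s n)%C.

Lemma t_neq_0 n : t n <> 0.
Proof.
intros E. assert (H : (s n * t n)%C = 1) by (apply Cinv_r, Hnz).
rewrite E, Cmult_0_r in H. injection H. lra.
Qed.

Lemma Cmod_t n : Cmod (t n) = / Cmod (s n).
Proof. apply Cmod_inv, Hnz. Qed.

Lemma factor_t z n : (1 - z * s n)%C = (s n * (t n - z))%C.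
Proof. unfold t. field. apply Hnz. Qed.

Lemma inverse_factor_t z n : (t n - z)%C <> 0 ->
  Cmod (/ (1 - z * s n)) = Cmod (t n) / Cmod (z - t n).
Proof.
intros H. rewrite factor_t, Cmod_inv by (apply Cmult_neq_0; auto).
rewrite Cmod_mult, Cmod_t, (Cmod_minus_sym z). apply Cmod_gt_0 in H.
pose proof (proj1 (Cmod_gt_0 (s n)) (Hnz n)). field. split; lra.
Qed.

Definition denominator_bound (P : nat) (q x : R) : R := 2 + 512 * q ^ 2 * (8 * x) ^ (2 * P).

Lemma far_indices x : 0 < x -> exists K, forall n, (K <= n)%nat -> 8 * x <= Cmod (t n).
Proof.
intros Hx. destruct (Hs (/ (8 * x))) as (K & HK); [apply Rinv_0_lt_compat; lra|].
exists K. intros n Hn. specialize (HK n Hn). rewrite Cmod_t.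
rewrite <- (Rinv_inv (8 * x)). apply Rinv_le_contravar; [|lra].
apply Cmod_gt_0, Hnz.
Qed.

(** The weights dominate [eta * Cmod (s n) ^ P], so a bound on a single term of
    the sum over the poles already keeps [t n] away from the circle by a
    negative power of [x]. The poles beyond [8 * x] are far away anyway. *)
Lemma circle_denominators x K (w : nat -> R) W eta r : 1 <= x -> 0 < W -> 0 < eta ->
  (forall n, (K <= n)%nat -> 8 * x <= Cmod (t n)) ->
  (forall n, eta * Cmod (s n) ^ P <= w n) ->
  2 * x <= r <= 3 * x ->
  (forall n, (n < K)%nat -> r <> Cmod (t n) /\
       w n * / sqrt (Rabs (r - Cmod (t n))) <= 8 * W / sqrt x) ->
  forall z, Cmod z = r -> forall n, (t n - z)%C <> 0 /\
    Cmod (/ (1 - z * s n)) <= denominator_bound P (W / eta) x.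
Proof.
intros Hx HW Heta HK Hw Hr Hgood z Hz n.
assert (HQ : 0 <= 512 * (W / eta) ^ 2 * (8 * x) ^ (2 * P)).
{ apply Rmult_le_pos; [|apply pow_le; lra]. pose proof (pow2_ge_0 (W / eta)). lra. }
pose proof (proj1 (Cmod_gt_0 (t n)) (t_neq_0 n)) as Htn.
destruct (Rle_lt_dec (8 * x) (Cmod (t n))) as [Hfar|Hnear].
- assert (Hd : Cmod (t n) / 2 <= Cmod (z - t n)).
  { rewrite Cmod_minus_sym. pose proof (Cmod_reverse_triangle (t n) z). lra. }
  assert (Hne : (t n - z)%C <> 0) by (apply Cmod_gt_0; rewrite Cmod_minus_sym; lra).
  split; auto. rewrite inverse_factor_t by auto. unfold denominator_bound.
  apply Rle_trans with 2; [|lra].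
  apply Rmult_le_reg_r with (Cmod (z - t n)); [lra|]. unfold Rdiv. rewrite Rmult_assoc, Rinv_l; lra.
- assert (HnK : (n < K)%nat).
  { destruct (le_lt_dec K n) as [H|H]; auto. specialize (HK n H). lra. }
  destruct (Hgood n HnK) as [Hrn Hwn].
  set (gap := Rabs (r - Cmod (t n))) in *.
  assert (Hgap : 0 < gap) by (apply Rabs_pos_lt; lra).
  assert (Hd : gap <= Cmod (z - t n)).
  { unfold gap. pose proof (Cmod_reverse_triangle z (t n)) as T1.
    pose proof (Cmod_reverse_triangle (t n) z) as T2. rewrite Cmod_minus_sym in T2.
    apply Rabs_le. lra. }
  assert (Hne : (t n - z)%C <> 0) by (apply Cmod_gt_0; rewrite Cmod_minus_sym; lra).
  split; auto. rewrite inverse_factor_t by auto.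
  assert (Hsg : 0 < sqrt gap) by (now apply sqrt_lt_R0).
  assert (Hsx : 0 < sqrt x) by (apply sqrt_lt_R0; lra).
  assert (H8 : 0 < (8 * x) ^ P) by (apply pow_lt; lra).
  assert (Hsig : / (8 * x) ^ P <= Cmod (s n) ^ P).
  { rewrite <- pow_inv. apply pow_incr. split; [left; apply Rinv_0_lt_compat; lra|].
    rewrite <- (Rinv_inv (Cmod (s n))), <- Cmod_t. apply Rinv_le_contravar; lra. }
  assert (H1 : eta * sqrt x <= 8 * W * (8 * x) ^ P * sqrt gap).
  { assert (H2 : eta * / (8 * x) ^ P * / sqrt gap <= 8 * W / sqrt x).
    { eapply Rle_trans; [|exact Hwn]. apply Rmult_le_compat_r; [left; now apply Rinv_0_lt_compat|].
      eapply Rle_trans; [|apply Hw]. apply Rmult_le_compat_l; lra. }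
    apply (Rmult_le_compat_r ((8 * x) ^ P * sqrt gap * sqrt x)) in H2.
    2:{ left. repeat apply Rmult_lt_0_compat; auto. }
    replace (eta * / (8 * x) ^ P * / sqrt gap * ((8 * x) ^ P * sqrt gap * sqrt x))
      with (eta * sqrt x) in H2 by (field; lra).
    replace (8 * W / sqrt x * ((8 * x) ^ P * sqrt gap * sqrt x))
      with (8 * W * (8 * x) ^ P * sqrt gap) in H2 by (field; lra). exact H2. }
  assert (H3 : eta ^ 2 * x <= 64 * W ^ 2 * (8 * x) ^ (2 * P) * gap).
  { replace (2 * P)%nat with (P + P)%nat by lia. rewrite pow_add.
    replace (eta ^ 2 * x) with ((eta * sqrt x) * (eta * sqrt x)).
    2:{ replace x with (sqrt x * sqrt x) at 3 by (apply sqrt_sqrt; lra). ring. }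
    replace (64 * W ^ 2 * ((8 * x) ^ P * (8 * x) ^ P) * gap)
      with ((8 * W * (8 * x) ^ P * sqrt gap) * (8 * W * (8 * x) ^ P * sqrt gap)).
    2:{ replace gap with (sqrt gap * sqrt gap) at 3 by (apply sqrt_sqrt; lra). ring. }
    assert (0 <= eta * sqrt x) by (apply Rmult_le_pos; lra).
    apply Rmult_le_compat; auto. }
  apply Rle_trans with (8 * x / gap).
  { apply Rmult_le_compat; try lra.
    - left; apply Rinv_0_lt_compat; lra.
    - apply Rinv_le_contravar; lra. }
  unfold denominator_bound. apply Rle_trans with (512 * (W / eta) ^ 2 * (8 * x) ^ (2 * P)); [|lra].
  assert (Heta2 : 0 < eta ^ 2) by (now apply pow_lt).
  apply Rmult_le_reg_r with (gap * eta ^ 2); [now apply Rmult_lt_0_compat|].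
  replace (8 * x / gap * (gap * eta ^ 2)) with (8 * (eta ^ 2 * x)) by (field; lra).
  replace (512 * (W / eta) ^ 2 * (8 * x) ^ (2 * P) * (gap * eta ^ 2))
    with (8 * (64 * W ^ 2 * (8 * x) ^ (2 * P) * gap)) by (field; lra).
  lra.
Qed.

Context (c g : nat -> C) (Hc : summable c) (Hg : summable g).
Let Phi z := (1 - z * resolvent_sum s c z)%C.
Context (h : C -> C) (Hh : forall z, germ 3 h z)
  (Hhphi : forall z, regular s c z -> Phi z <> 0 -> (h z * Phi z = z * resolvent_sum s g z)%C).

Let Mass (e : nat -> C) : R := Series (fun n => Cmod (e n)).

Lemma Mass_pos e : summable e -> 0 <= Mass e.
Proof. intros H. apply Series_pos; auto. intros; apply Cmod_ge_0. Qed.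

Lemma resolvent_bound e z Q : summable e -> (forall n, Cmod (/ (1 - z * s n)) <= Q) ->
  Cmod (resolvent_sum s e z) <= Q * Mass e.
Proof.
intros He HQ. unfold resolvent_sum, Mass. rewrite <- Series_scal_l. apply CSeries_abs_le.
- intros n. rewrite Cmod_mult, Rmult_comm. apply Rmult_le_compat_r; auto using Cmod_ge_0.
- now apply ex_series_Rscal.
Qed.

Lemma regular_off_poles e z : (forall n, (t n - z)%C <> 0) -> regular s e z.
Proof.
intros H n Hn. exfalso. assert (H1 : (1 - z * s n)%C = 0) by (rewrite Hn; ring).
rewrite factor_t in H1. apply Cmult_integral in H1 as [H1|H1].
- now apply (Hnz n).
- now apply (H n).
Qed.

Definition pole_factor (x : R) (n : nat) (z : C) : C :=
  if Rle_dec 1 (8 * x * Cmod (s n)) then (1 - z * s n)%C else RtoC 1.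

Fixpoint pole_product (x : R) (K : nat) (z : C) : C :=
  match K with O => RtoC 1 | S K => (pole_product x K z * pole_factor x K z)%C end.

(** The coefficients with those of the poles up to modulus [8 * x] set to 0; the
    removed terms, multiplied by [pole_product], are collected in [near_part].
    *)
Fixpoint far_part (x : R) (K : nat) : nat -> C :=
  match K with
  | O => c
  | S K => if Rle_dec 1 (8 * x * Cmod (s K)) then remove_term K (far_part x K) else far_part x K
  end.

Fixpoint near_part (x : R) (K : nat) (z : C) : C :=
  match K with
  | O => RtoC 0
  | S K => if Rle_dec 1 (8 * x * Cmod (s K))
           then ((1 - z * s K) * near_part x K z + c K * pole_product x K z)%C
           else near_part x K z
  end.

(** The product of [phi] and [pole_product] (see [cleared_eq]) written without
    the cancelled poles, so that it is analytic in the disc of radius [8 * x];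
    its value at 0 is 1. *)
Definition cleared (x : R) (K : nat) (z : C) : C :=
  (pole_product x K z * (1 + - (1) * (z * resolvent_sum s (far_part x K) z))
   + - (1) * (z * near_part x K z))%C.

Lemma far_part_summable x K : summable (far_part x K).
Proof.
induction K as [|K IH]; simpl; auto. destruct (Rle_dec _ _); auto using remove_term_summable.
Qed.

Lemma far_part_above x K n : (K <= n)%nat -> far_part x K n = c n.
Proof.
induction K as [|K IH]; intros Hn; simpl; auto. destruct (Rle_dec _ _); auto; [|apply IH; lia].
unfold remove_term. destruct (Nat.eq_dec n K); [lia|]. apply IH; lia.
Qed.

Lemma far_part_near x K n : (n < K)%nat -> 1 <= 8 * x * Cmod (s n) -> far_part x K n = 0.
Proof.
induction K as [|K IH]; intros Hn H1; [lia|]. simpl.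
destruct (Nat.eq_dec n K) as [->|Hne].
- destruct (Rle_dec _ _); [|contradiction]. unfold remove_term. now destruct (Nat.eq_dec K K).
- assert (E : far_part x K n = 0) by (apply IH; auto; lia).
  destruct (Rle_dec _ _); auto. unfold remove_term. destruct (Nat.eq_dec n K); auto.
Qed.

Lemma germ_pole_product k x K z : germ k (pole_product x K) z.
Proof.
induction K as [|K IH]; simpl; [apply germ_const|]. apply (germ_mult k); auto.
unfold pole_factor. destruct (Rle_dec _ _); [|apply germ_const].
apply (germ_ext k (fun z => 1 + - (s K) * z)%C _ z 1); [lra|intros; ring|].
apply germ_plus; [apply germ_const|]. apply germ_mult; [apply germ_const|apply germ_id].
Qed.

Lemma germ_near_part k x K z : germ k (near_part x K) z.
Proof.
induction K as [|K IH]; simpl; [apply germ_const|]. destruct (Rle_dec _ _); auto.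
apply germ_plus; apply germ_mult; auto using germ_const, germ_pole_product.
apply (germ_ext k (fun z => 1 + - (s K) * z)%C _ z 1); [lra|intros; ring|].
apply germ_plus; [apply germ_const|]. apply germ_mult; [apply germ_const|apply germ_id].
Qed.

Lemma germ_cleared k x K z : 0 < x -> (forall n, (K <= n)%nat -> 8 * x <= Cmod (t n)) ->
  Cmod z < 8 * x -> germ k (cleared x K) z.
Proof.
intros Hx HK Hz. unfold cleared. apply germ_plus.
- apply germ_mult; [apply germ_pole_product|]. apply germ_plus; [apply germ_const|].
  apply germ_mult; [apply germ_const|]. apply germ_mult; [apply germ_id|].
  apply germ_resolvent; auto using far_part_summable.
  intros n Hn. pose proof (proj1 (Cmod_gt_0 (s n)) (Hnz n)) as Hsn.
  assert (H1 : Cmod z * Cmod (s n) = 1) by (rewrite <- Cmod_mult, Hn; apply Cmod_1).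
  assert (H8 : 1 < 8 * x * Cmod (s n)) by (rewrite <- H1; now apply Rmult_lt_compat_r).
  destruct (le_lt_dec K n) as [HKn|HKn].
  + exfalso. specialize (HK n HKn). rewrite Cmod_t in HK.
    apply (Rmult_le_compat_r (Cmod (s n))) in HK; [|lra]. rewrite Rinv_l in HK; lra.
  + apply far_part_near; auto. lra.
- apply germ_mult; [apply germ_const|]. apply germ_mult; [apply germ_id|apply germ_near_part].
Qed.

Lemma cleared_0 x K : cleared x K 0 = 1.
Proof.
unfold cleared. rewrite !Cmult_0_l.
assert (E : pole_product x K 0 = 1).
{ induction K as [|K IH]; simpl; auto. rewrite IH. unfold pole_factor.
  destruct (Rle_dec _ _); ring. }
rewrite E. ring.
Qed.

Lemma cleared_eq x K z : (forall n, (t n - z)%C <> 0) -> cleared x K z = (pole_product x K z * Phi z)%C.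
Proof.
intros Hz. induction K as [|K IH].
- unfold cleared, Phi. simpl. ring.
- assert (H1 : (1 - z * s K)%C <> 0) by (rewrite factor_t; apply Cmult_neq_0; auto).
  unfold cleared in *. simpl. unfold pole_factor at 1.
  destruct (Rle_dec 1 (8 * x * Cmod (s K))).
  + rewrite (resolvent_split s (far_part x K) K z) in IH;
      auto using far_part_summable, regular_off_poles.
    rewrite far_part_above in IH by lia.
    unfold pole_factor. destruct (Rle_dec 1 (8 * x * Cmod (s K))); [|contradiction].
    replace (pole_product x K z * (1 - z * s K) * Phi z)%C with
      ((1 - z * s K) * (pole_product x K z * Phi z))%C by ring.
    rewrite <- IH. field. auto.
  + unfold pole_factor. destruct (Rle_dec 1 (8 * x * Cmod (s K))); [contradiction|].
    rewrite !Cmult_1_r. exact IH.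
Qed.

Let SP := Series (fun n => Cmod (s n) ^ P).

Lemma pow_s_pos n : 0 <= Cmod (s n) ^ P.
Proof. apply pow_le, Cmod_ge_0. Qed.

Lemma SP_pos : 0 <= SP.
Proof. apply Series_pos; auto. apply pow_s_pos. Qed.

(** With [y = 8 * x * Cmod (s n)], a factor is at most [1 + y <= 1 + y ^ P <=
    exp (y ^ P)], as [y >= 1]; the exponents add up to a multiple of the
    Schatten sum. *)
Lemma pole_product_bound x K z : 0 < x -> Cmod z <= 3 * x ->
  Cmod (pole_product x K z) <= exp ((8 * x) ^ P * SP).
Proof.
intros Hx Hz. assert (H8 : 0 <= (8 * x) ^ P) by (apply pow_le; lra).
apply Rle_trans with (exp ((8 * x) ^ P * rsum (fun n => Cmod (s n) ^ P) K)).
- induction K as [|K IH]; simpl.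
  + rewrite Rmult_0_r, exp_0, Cmod_1. lra.
  + rewrite Cmod_mult, Rmult_plus_distr_l, exp_plus.
    apply Rmult_le_compat; auto using Cmod_ge_0.
    unfold pole_factor. destruct (Rle_dec 1 (8 * x * Cmod (s K))) as [H1|H1].
    * rewrite <- Rpow_mult_distr. eapply Rle_trans; [apply Cmod_minus_le|].
      rewrite Cmod_1, Cmod_mult. set (y := 8 * x * Cmod (s K)) in *.
      assert (Hy : Cmod z * Cmod (s K) <= y).
      { unfold y. apply Rmult_le_compat_r; [apply Cmod_ge_0|lra]. }
      assert (Hyp : y <= y ^ P).
      { rewrite <- (pow_1 y) at 1. apply Rle_pow; auto. }
      eapply Rle_trans; [|apply exp_ineq1_le]. lra.
    * rewrite Cmod_1, <- exp_0. apply exp_le. apply Rmult_le_pos; auto using pow_s_pos.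
- apply exp_le. apply Rmult_le_compat_l; auto. apply rsum_le_Series; auto using pow_s_pos.
Qed.

Lemma Mass_sum_pos : 0 <= Mass c + Mass g.
Proof. pose proof (Mass_pos c Hc). pose proof (Mass_pos g Hg). lra. Qed.

Lemma Rmax_1_mult a b B : a * b <= B -> a <= B -> b <= B -> 1 <= B -> Rmax 1 a * Rmax 1 b <= B.
Proof.
intros. unfold Rmax. destruct (Rle_dec 1 a), (Rle_dec 1 b); lra.
Qed.

Lemma exp_log_plus x : exp (log_plus x) = Rmax 1 x.
Proof. unfold log_plus. apply exp_ln. pose proof (Rmax_l 1 x). lra. Qed.

(** On a good circle both [cleared] and [h * cleared] are bounded by [exp B],
    with [B] polynomial in [x]. Therefore the mean of [ln (Cmod (h z))] is at
    most [B] minus the mean of [ln (Cmod (cleared z))], and the latter is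
    nonnegative by Jensen's inequality because [cleared] is 1 at 0. The factor
    [exp Y], with [Y] at least the logarithm of [Cmod (h z)] on the disc, allows
    all logarithms to be truncated. *)
Lemma growth_at_scale x : 1 <= x -> forall z, Cmod z <= x ->
  Cmod (h z) <= exp (4 + 3 * ((8 * x) ^ P * SP
     + 3 * x * denominator_bound P (SP + 1) x * (Mass c + Mass g))).
Proof.
intros Hx. pose proof SP_pos as HSP0. pose proof Mass_sum_pos as HM.
pose proof (Mass_pos c Hc) as Hmc. pose proof (Mass_pos g Hg) as Hmg.
destruct (far_indices x ltac:(lra)) as (K & HK).
destruct (good_circle (fun n => Cmod (s n) ^ P) t K x (SP + 1)) as (r & Hr & Hgood & _);
  [lra|lra|apply pow_s_pos|apply t_neq_0| |].
{ apply Rle_trans with SP; [|lra]. apply rsum_le_Series; auto using pow_s_pos. }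
set (Q := denominator_bound P (SP + 1) x).
assert (Hden : forall z, Cmod z = r -> forall n, (t n - z)%C <> 0 /\ Cmod (/ (1 - z * s n)) <= Q).
{ unfold Q. replace (SP + 1) with ((SP + 1) / 1) by field.
  apply (circle_denominators x K (fun n => Cmod (s n) ^ P) (SP + 1) 1 r); auto; try lra.
  intros n. lra. }
assert (HQ : 0 <= Q).
{ unfold Q, denominator_bound. assert (0 <= 512 * (SP + 1) ^ 2 * (8 * x) ^ (2 * P)); [|lra].
  apply Rmult_le_pos; [|apply pow_le; lra]. pose proof (pow2_ge_0 (SP + 1)). lra. }
set (B := (8 * x) ^ P * SP + 3 * x * Q * (Mass c + Mass g)).
assert (HxQ : 0 <= 3 * x * Q) by (apply Rmult_le_pos; lra).
assert (H8S : 0 <= (8 * x) ^ P * SP) by (apply Rmult_le_pos; auto; apply pow_le; lra).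
assert (HB : 0 <= B) by (unfold B; assert (0 <= 3 * x * Q * (Mass c + Mass g)) by (apply Rmult_le_pos; lra); lra).
assert (HV : forall z, Cmod z = r -> Cmod (cleared x K z) <= exp B).
{ intros z Hz. rewrite cleared_eq by (intros; now apply Hden). rewrite Cmod_mult.
  unfold B. rewrite exp_plus. apply Rmult_le_compat; auto using Cmod_ge_0.
  - apply pole_product_bound; lra.
  - unfold Phi. eapply Rle_trans; [apply Cmod_minus_le|]. rewrite Cmod_1, Cmod_mult, Hz.
    eapply Rle_trans; [|apply exp_ineq1_le]. apply Rplus_le_compat_l.
    assert (Hres : Cmod (resolvent_sum s c z) <= Q * Mass c)
      by (apply resolvent_bound; auto; intros; now apply Hden).
    apply Rle_trans with (3 * x * (Q * Mass c)).
    + apply Rmult_le_compat; auto using Cmod_ge_0; lra.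
    + rewrite <- Rmult_assoc. apply Rmult_le_compat_l; lra. }
assert (HVh : forall z, Cmod z = r -> Cmod (h z) * Cmod (cleared x K z) <= exp B).
{ intros z Hz. rewrite cleared_eq by (intros; now apply Hden).
  destruct (classic (Phi z = 0)) as [H0|H0].
  { rewrite H0, Cmult_0_r, Cmod_0, Rmult_0_r. left; apply exp_pos. }
  rewrite <- Cmod_mult. replace (h z * (pole_product x K z * Phi z))%C
    with (pole_product x K z * (h z * Phi z))%C by ring.
  rewrite Hhphi; auto; [|apply regular_off_poles; intros; now apply Hden].
  rewrite !Cmod_mult, Hz. unfold B. rewrite exp_plus. apply Rmult_le_compat; auto using Cmod_ge_0.
  - apply Rmult_le_pos; [lra|apply Cmod_ge_0].
  - apply pole_product_bound; lra.
  - assert (Hres : Cmod (resolvent_sum s g z) <= Q * Mass g)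
      by (apply resolvent_bound; auto; intros; now apply Hden).
    apply Rle_trans with (3 * x * Q * (Mass c + Mass g)).
    + apply Rle_trans with (3 * x * (Q * Mass g)).
      * apply Rmult_le_compat; auto using Cmod_ge_0; lra.
      * rewrite <- Rmult_assoc. apply Rmult_le_compat_l; lra.
    + eapply Rle_trans; [|apply exp_ineq1_le]. lra. }
destruct (disc_max (fun z => Cmod (h z)) r) as (z1 & Hz1 & Hmax); [lra| |].
{ intros z _. apply Ccontinuous_germ, (germ_le 3); auto. }
set (Y := log_plus (Cmod (h z1))).
assert (HY : 0 <= Y) by apply log_plus_pos.
set (V := fun z => (exp Y * cleared x K z)%C).
assert (HVmod : forall z, Cmod (V z) = exp Y * Cmod (cleared x K z)).
{ intros z. unfold V. rewrite Cmod_mult, Cmod_RtoC_pos; auto. left; apply exp_pos. }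
destruct (poisson_log_plus V r 1) as (m1 & Hm1); [lra|lra| |].
{ intros z Hz. apply germ_mult; [apply germ_const|]. apply germ_cleared; auto; lra. }
destruct (poisson_log_plus h r 1) as (m2 & Hm2); [lra|lra|auto|].
set (m := S (Nat.max m1 m2)).
destruct (Hm1 m) as [J _]; [lia|lia|]. destruct (Hm2 m) as [_ J2]; [lia|lia|].
assert (HmR : 0 < INR m) by (apply lt_0_INR; lia).
assert (J1 : Y <= 1 + sample_mean (fun z => log_plus (Cmod (V z))) r m).
{ rewrite HVmod, cleared_0, Cmod_1, Rmult_1_r in J. apply exp_le_inv in J. exact J. }
assert (Hpt : forall z, Cmod z = r -> log_plus (Cmod (h z)) + log_plus (Cmod (V z)) <= Y + B).
{ intros z Hz. apply exp_le_inv. rewrite exp_plus, !exp_log_plus.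
  rewrite HVmod, exp_plus.
  assert (EY : 1 <= exp Y) by (rewrite <- exp_0; now apply exp_le).
  assert (EB : 1 <= exp B) by (rewrite <- exp_0; now apply exp_le).
  specialize (HV z Hz). specialize (HVh z Hz).
  pose proof (Cmod_ge_0 (h z)). pose proof (Cmod_ge_0 (cleared x K z)).
  assert (HhY : Cmod (h z) <= exp Y).
  { eapply Rle_trans; [apply Hmax; lra|apply le_exp_log_plus]. }
  apply Rmax_1_mult.
  - replace (Cmod (h z) * (exp Y * Cmod (cleared x K z))) with
      (exp Y * (Cmod (h z) * Cmod (cleared x K z))) by ring.
    apply Rmult_le_compat_l; lra.
  - rewrite <- (Rmult_1_r (Cmod (h z))). apply Rmult_le_compat; lra.
  - apply Rmult_le_compat_l; lra.
  - rewrite <- (Rmult_1_r 1). apply Rmult_le_compat; lra. }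
assert (Hmean : sample_mean (fun z => log_plus (Cmod (h z))) r m
   + sample_mean (fun z => log_plus (Cmod (V z))) r m <= Y + B).
{ unfold sample_mean. apply Rmult_le_reg_r with (INR m); auto.
  rewrite Rmult_plus_distr_r. unfold Rdiv. rewrite !Rmult_assoc, Rinv_l, !Rmult_1_r by lra.
  rewrite <- rsum_plus, (Rmult_comm (Y + B)), <- rsum_const. apply rsum_le.
  intros k _. apply Hpt, Cmod_sample. lra. }
intros z Hz. eapply Rle_trans; [apply J2; lra|]. apply exp_le. fold Q. fold B. lra.
Qed.

Lemma growth_scale_polynomial : exists Cst p, 0 <= Cst /\ forall x, 1 <= x ->
  4 + 3 * ((8 * x) ^ P * SP + 3 * x * denominator_bound P (SP + 1) x * (Mass c + Mass g)) <= Cst * x ^ p.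
Proof.
pose proof SP_pos as HSP0. pose proof Mass_sum_pos as HM. set (La := Mass c + Mass g) in *.
assert (H8 : 0 <= 8 ^ P) by (apply pow_le; lra).
assert (H82 : 0 <= 8 ^ (2 * P)) by (apply pow_le; lra).
assert (HW2 : 0 <= (SP + 1) ^ 2) by apply pow2_ge_0.
set (q := 512 * (SP + 1) ^ 2 * 8 ^ (2 * P)).
assert (Hq : 0 <= q) by (apply Rmult_le_pos; lra).
exists (4 + 3 * (8 ^ P * SP + 3 * (2 + q) * La)), (2 * P + 1)%nat.
assert (HS8 : 0 <= 8 ^ P * SP) by (apply Rmult_le_pos; lra).
assert (HqL : 0 <= (2 + q) * La) by (apply Rmult_le_pos; lra).
split; [lra|]. intros x Hx. unfold denominator_bound.
assert (X0 : 1 <= x ^ (2 * P + 1)) by (now apply pow_R1_Rle).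
assert (X1 : x ^ P <= x ^ (2 * P + 1)) by (apply Rle_pow; [auto|lia]).
assert (X2 : x <= x ^ (2 * P + 1)) by (rewrite <- (pow_1 x) at 1; apply Rle_pow; [auto|lia]).
assert (X3 : x ^ (2 * P + 1) = x ^ (2 * P) * x) by (rewrite pow_add; simpl; ring).
rewrite !Rpow_mult_distr. set (X := x ^ (2 * P + 1)) in *.
assert (Y1 : 8 ^ P * x ^ P * SP <= 8 ^ P * SP * X).
{ replace (8 ^ P * x ^ P * SP) with (8 ^ P * SP * x ^ P) by ring. apply Rmult_le_compat_l; auto. }
assert (Y2 : 3 * x * (2 + 512 * (SP + 1) ^ 2 * (8 ^ (2 * P) * x ^ (2 * P))) * La <= 3 * (2 + q) * La * X).
{ replace (3 * x * (2 + 512 * (SP + 1) ^ 2 * (8 ^ (2 * P) * x ^ (2 * P))) * La)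
    with (3 * La * (2 * x + q * X)) by (rewrite X3; unfold q; ring).
  replace (3 * (2 + q) * La * X) with (3 * La * (2 * X + q * X)) by ring.
  apply Rmult_le_compat_l; lra. }
lra.
Qed.

Context (e : nat -> C) (He : summable e) (N : nat) (mu : C) (Hmu : mu <> 0)
  (Hphi : forall z, regular s c z -> (z ^ N * Phi z = mu - resolvent_sum s e z)%C).

(** The first [M] terms are small because [z] is far from their poles, those
    with poles beyond [8 * x] because the tail of [e] is small; the rest is
    bounded by the sum that [good_circle] controls. *)
Lemma resolvent_small M (x r : R) K (w : nat -> R) z :
  1 <= x -> 2 * x <= r <= 3 * x -> Cmod z = r ->
  (forall n, (t n - z)%C <> 0) ->
  (forall n, (K <= n)%nat -> 8 * x <= Cmod (t n)) ->
  (forall n, above M (fun n => Cmod (e n)) n <= w n) ->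
  (forall n, (n < M)%nat -> Cmod (t n) <= x) ->
  Cmod (resolvent_sum s e z) <=
    rsum (fun n => Cmod (e n) * Cmod (t n)) M / x
    + 8 * rsum (fun n => w n * (x / Cmod (z - t n))) K
    + 2 * Series (above M (fun n => Cmod (e n))).
Proof.
intros Hx Hr Hz Hne HK Hw HM.
set (ab := above M (fun n => Cmod (e n))) in *.
assert (Hab0 : forall n, 0 <= ab n).
{ intros n. unfold ab, above. destruct (lt_dec n M); [lra|apply Cmod_ge_0]. }
assert (Hd : forall n, 0 < Cmod (z - t n)).
{ intros n. rewrite Cmod_minus_sym. now apply Cmod_gt_0. }
assert (Hsab : ex_series ab) by (apply ex_series_above; auto; intros; apply Cmod_ge_0).
set (v1 := below M (fun n => / x * (Cmod (e n) * Cmod (t n)))).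
set (v2 := below K (fun n => 8 * (w n * (x / Cmod (z - t n))))).
assert (S1 : is_series v1 (rsum (fun n => Cmod (e n) * Cmod (t n)) M / x)).
{ unfold Rdiv. rewrite Rmult_comm, <- rsum_scal. apply finite_support_series. }
assert (S2 : is_series v2 (8 * rsum (fun n => w n * (x / Cmod (z - t n))) K)).
{ rewrite <- rsum_scal. apply finite_support_series. }
assert (E1 : ex_series v1) by (now exists (rsum (fun n => Cmod (e n) * Cmod (t n)) M / x)).
assert (E2 : ex_series v2) by (now exists (8 * rsum (fun n => w n * (x / Cmod (z - t n))) K)).
assert (E3 : ex_series (fun n => 2 * ab n)) by (now apply ex_series_Rscal).
rewrite <- (is_series_unique _ _ S1), <- (is_series_unique _ _ S2), <- Series_scal_l.
rewrite <- Series_plus, <- Series_plus; auto using ex_series_Rplus.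
unfold resolvent_sum. apply CSeries_abs_le; auto using ex_series_Rplus.
intros n. rewrite Cmod_mult, inverse_factor_t by auto.
pose proof (Cmod_ge_0 (e n)) as Hen. pose proof (Cmod_ge_0 (t n)) as Htn.
specialize (Hd n). pose proof (Hab0 n) as Habn.
assert (Hv1 : 0 <= v1 n).
{ unfold v1, below. destruct (lt_dec n M); [|lra].
  apply Rmult_le_pos; [left; apply Rinv_0_lt_compat; lra|now apply Rmult_le_pos]. }
assert (Hv2 : 0 <= v2 n).
{ unfold v2, below. destruct (lt_dec n K); [|lra]. specialize (Hw n).
  apply Rmult_le_pos; [lra|]. apply Rmult_le_pos; [lra|]. left. apply Rdiv_lt_0_compat; lra. }
destruct (lt_dec n M) as [HnM|HnM].
- assert (Cmod (e n) * (Cmod (t n) / Cmod (z - t n)) <= v1 n); [|lra].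
  unfold v1, below. destruct (lt_dec n M); [|contradiction].
  replace (/ x * (Cmod (e n) * Cmod (t n))) with (Cmod (e n) * (Cmod (t n) / x)) by (field; lra).
  apply Rmult_le_compat_l; auto. apply Rmult_le_compat_l; auto.
  apply Rinv_le_contravar; [lra|]. specialize (HM n HnM).
  pose proof (Cmod_reverse_triangle z (t n)). lra.
- assert (Hab : ab n = Cmod (e n)) by (unfold ab, above; destruct (lt_dec n M); [contradiction|auto]).
  destruct (Rle_lt_dec (8 * x) (Cmod (t n))) as [Hfar|Hnear].
  + assert (Cmod (e n) * (Cmod (t n) / Cmod (z - t n)) <= 2 * ab n); [|lra].
    rewrite Hab, (Rmult_comm 2). apply Rmult_le_compat_l; auto.
    pose proof (Cmod_reverse_triangle (t n) z) as T2. rewrite Cmod_minus_sym in T2.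
    apply Rmult_le_reg_r with (Cmod (z - t n)); auto. unfold Rdiv. rewrite Rmult_assoc, Rinv_l; lra.
  + assert (HnK : (n < K)%nat).
    { destruct (le_lt_dec K n) as [H|H]; auto. specialize (HK n H). lra. }
    assert (Cmod (e n) * (Cmod (t n) / Cmod (z - t n)) <= v2 n); [|lra].
    unfold v2, below. destruct (lt_dec n K); [|contradiction].
    replace (8 * (w n * (x / Cmod (z - t n)))) with (w n * (8 * x / Cmod (z - t n))) by (field; lra).
    specialize (Hw n). rewrite Hab in Hw. apply Rmult_le_compat; auto.
    * apply Rmult_le_pos; auto. left; now apply Rinv_0_lt_compat.
    * apply Rmult_le_compat_r; [left; now apply Rinv_0_lt_compat|lra].
Qed.

Lemma log_plus_monomial X x p : 0 <= X -> 1 <= x -> log_plus (X * x ^ p) <= log_plus X + INR p * ln x.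
Proof.
intros HX Hx. assert (0 <= ln x) by (rewrite <- ln_1; apply ln_le; lra).
apply log_plus_le_of_exp.
- pose proof (log_plus_pos X). pose proof (pos_INR p).
  assert (0 <= INR p * ln x) by (now apply Rmult_le_pos). lra.
- rewrite exp_plus. apply Rmult_le_compat; auto using le_exp_log_plus.
  + apply pow_le. lra.
  + rewrite <- ln_pow by lra. rewrite exp_ln; [lra|]. apply pow_lt; lra.
Qed.

(** At a sample where [resolvent_sum s e] is at most half of [mu] in modulus,
    [phi] is bounded below by a negative power of [x], and the logarithm of [h]
    is at most a multiple of [1 + ln x]. The other samples are estimated by [m
    (3 * x)]; since the tail of [e] is small, their proportion is at most [delta
    / 3], and the Poisson bound costs a factor 3. *)
Lemma growth_step (m : R -> R)
  (Hm1 : forall x z, 0 <= x -> Cmod z <= x -> log_plus (Cmod (h z)) <= m x)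
  (Hm2 : forall x, 0 <= x -> exists z, Cmod z <= x /\ m x = log_plus (Cmod (h z))) :
  forall delta, 0 < delta -> exists A x0, 0 <= A /\ 1 <= x0 /\ forall x, x0 <= x ->
     m x <= A + A * ln x + delta * m (3 * x).
Proof.
intros delta Hdelta. pose proof (proj1 (Cmod_gt_0 mu) Hmu) as Hmu0.
pose proof SP_pos as HSP0. pose proof (Mass_pos g Hg) as Hmg.
(* Then the middle part in [resolvent_small] is at most [8 * theta = Cmod mu /
   8], and [97 * W / theta = delta / 3] in [good_circle]. *)
set (theta := Cmod mu / 64). assert (Hth : 0 < theta) by (unfold theta; lra).
set (W := theta * delta / 291). assert (HW : 0 < W).
{ unfold W. apply Rdiv_lt_0_compat; [now apply Rmult_lt_0_compat|lra]. }
destruct (Series_tail_small (fun n => Cmod (e n)) (Rmin (W / 2) (Cmod mu / 32))) as (M & HM);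
  [intros; apply Cmod_ge_0|exact He|apply Rmin_pos; lra|].
apply Rmin_lt_inv in HM as [HM1 HM2].
(* One half of [W] is spent on the tail of [e], the other on the weights that
   [circle_denominators] requires. *)
set (eta := W / (2 * (SP + 1))). assert (Heta : 0 < eta) by (apply Rdiv_lt_0_compat; lra).
assert (Hab0 : forall n, 0 <= above M (fun n => Cmod (e n)) n).
{ intros n. unfold above. destruct (lt_dec n M); [lra|apply Cmod_ge_0]. }
set (w := fun n => above M (fun n => Cmod (e n)) n + eta * Cmod (s n) ^ P).
assert (Hesp : forall n, 0 <= eta * Cmod (s n) ^ P)
  by (intros; apply Rmult_le_pos; [lra|apply pow_s_pos]).
assert (Hw0 : forall n, 0 <= w n) by (intros n; specialize (Hab0 n); specialize (Hesp n); unfold w; lra).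
assert (HwW : forall K, rsum w K <= W).
{ intros K. unfold w. rewrite rsum_plus, rsum_scal.
  assert (rsum (above M (fun n => Cmod (e n))) K <= Series (above M (fun n => Cmod (e n)))).
  { apply rsum_le_Series; auto. apply ex_series_above; auto. intros; apply Cmod_ge_0. }
  assert (rsum (fun n => Cmod (s n) ^ P) K <= SP) by (apply rsum_le_Series; auto using pow_s_pos).
  assert (eta * rsum (fun n => Cmod (s n) ^ P) K <= eta * (SP + 1)) by (apply Rmult_le_compat_l; lra).
  assert (eta * (SP + 1) = W / 2) by (unfold eta; field; lra). lra. }
set (T1 := rsum (fun n => Cmod (e n) * Cmod (t n)) M).
set (T2 := rsum (fun n => Cmod (t n)) M).
assert (HT1 : 0 <= T1) by (apply rsum_pos; intros; apply Rmult_le_pos; apply Cmod_ge_0).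
assert (HT2 : 0 <= T2) by (apply rsum_pos; intros; apply Cmod_ge_0).
(* Beyond [x0] the first [M] poles have modulus at most [x], and the first part
   in [resolvent_small] is at most [Cmod mu / 8]. *)
set (x0 := 1 + T2 + 8 * T1 / Cmod mu).
assert (HT1m : 0 <= 8 * T1 / Cmod mu) by (apply Rmult_le_pos; [lra|left; now apply Rinv_0_lt_compat]).
set (q := 512 * (W / eta) ^ 2 * 8 ^ (2 * P)).
assert (Hq : 0 <= q).
{ unfold q. apply Rmult_le_pos; [|apply pow_le; lra]. pose proof (pow2_ge_0 (W / eta)). lra. }
set (X0 := 3 * (2 + q) * Mass g * (2 * 3 ^ N / Cmod mu)).
assert (H3N : 0 < 3 ^ N) by (apply pow_lt; lra).
assert (HX0 : 0 <= X0).
{ unfold X0. apply Rmult_le_pos; [apply Rmult_le_pos; lra|]. left. apply Rdiv_lt_0_compat; lra. }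
set (p := (2 * P + 1 + N)%nat).
exists (1 + 3 * log_plus X0 + 3 * INR p), x0.
pose proof (log_plus_pos X0) as HlX. pose proof (pos_INR p) as Hp.
split; [lra|]. split; [unfold x0; lra|]. intros x Hxx.
assert (Hx : 1 <= x) by (unfold x0 in Hxx; lra).
assert (Hlnx : 0 <= ln x) by (rewrite <- ln_1; apply ln_le; lra).
destruct (far_indices x ltac:(lra)) as (K & HK).
destruct (good_circle w t K x W) as (r & Hr & Hgood & Hbeta); auto; [lra|apply t_neq_0|].
set (Q := denominator_bound P (W / eta) x).
assert (Hden : forall z, Cmod z = r -> forall n, (t n - z)%C <> 0 /\ Cmod (/ (1 - z * s n)) <= Q).
{ apply (circle_denominators x K w W eta r); auto. intros n. unfold w. specialize (Hab0 n). lra. }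
destruct (Hbeta theta Hth) as (m1 & Hb). clear Hbeta.
destruct (poisson_log_plus h r 1) as (m2 & Hp2); [lra|lra|auto|].
set (mm := S (Nat.max m1 m2)).
destruct (Hb mm) as (beta & Hb0 & Hbs & Hbk); [lia|lia|].
destruct (Hp2 mm) as [_ HJ]; [lia|lia|].
assert (HmR : 0 < INR mm) by (apply lt_0_INR; lia).
assert (Hm3 : 0 <= m (3 * x)).
{ eapply Rle_trans; [apply (log_plus_pos (Cmod (h 0)))|]. apply Hm1; [lra|]. rewrite Cmod_0. lra. }
set (Ax := log_plus X0 + INR p * ln x).
assert (HAx : 0 <= Ax) by (unfold Ax; assert (0 <= INR p * ln x) by (now apply Rmult_le_pos); lra).
assert (Hpt : forall k, (k < mm)%nat -> log_plus (Cmod (h (sample r mm k))) <= Ax + m (3 * x) * beta k).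
{ intros k Hk. set (z := sample r mm k).
  assert (Hz : Cmod z = r) by (apply Cmod_sample; lra).
  destruct (Rlt_le_dec (beta k) 1) as [Hlt|Hge].
  2:{ assert (log_plus (Cmod (h z)) <= m (3 * x)) by (apply Hm1; lra).
      assert (m (3 * x) * 1 <= m (3 * x) * beta k) by (apply Rmult_le_compat_l; lra). lra. }
  specialize (Hbk k Hk Hlt). fold z in Hbk.
  assert (Hreg : forall e, regular s e z) by (intros; apply regular_off_poles; intros; now apply Hden).
  assert (HSe : Cmod (resolvent_sum s e z) <= Cmod mu / 2).
  { eapply Rle_trans; [apply (resolvent_small M x r K w z); auto|].
    - intros n. now apply Hden.
    - intros n. unfold w. specialize (Hesp n). lra.
    - intros n Hn. assert (Cmod (t n) <= T2).
      { apply (rsum_single (fun n => Cmod (t n))); auto. intros; apply Cmod_ge_0. }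
      unfold x0 in Hxx. lra.
    - fold T1. assert (T1 / x <= Cmod mu / 8).
      { apply Rmult_le_reg_r with x; [lra|]. unfold Rdiv at 1. rewrite Rmult_assoc, Rinv_l by lra.
        assert (8 * T1 / Cmod mu <= x) by (unfold x0 in Hxx; lra).
        apply (Rmult_le_compat_l (Cmod mu / 8)) in H; [|lra].
        replace (Cmod mu / 8 * (8 * T1 / Cmod mu)) with T1 in H by (field; lra). lra. }
      unfold theta in Hbk. lra. }
  assert (HzPhi : Cmod mu / 2 <= Cmod (z ^ N * Phi z)%C).
  { rewrite Hphi by auto. eapply Rle_trans; [|apply Cmod_reverse_triangle]. lra. }
  rewrite Cmod_mult, Cmod_pow, Hz in HzPhi.
  assert (HrN : 0 < r ^ N) by (apply pow_lt; lra).
  assert (HPhi0 : 0 < Cmod (Phi z)).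
  { apply Rnot_le_lt. intros H0. pose proof (Cmod_ge_0 (Phi z)).
    replace (Cmod (Phi z)) with 0 in HzPhi by lra. lra. }
  assert (Hnum : Cmod (h z) * Cmod (Phi z) <= 3 * x * (Q * Mass g)).
  { rewrite <- Cmod_mult, Hhphi by (auto; now apply Cmod_gt_0). rewrite Cmod_mult, Hz.
    apply Rmult_le_compat; auto using Cmod_ge_0; [lra|lra|].
    apply resolvent_bound; auto. intros n. now apply Hden. }
  assert (HX : Cmod (h z) <= X0 * x ^ p).
  { assert (Hinv : 1 <= Cmod (Phi z) * (2 * r ^ N / Cmod mu)).
    { apply Rmult_le_reg_l with (Cmod mu / 2); [lra|].
      replace (Cmod mu / 2 * (Cmod (Phi z) * (2 * r ^ N / Cmod mu))) with (r ^ N * Cmod (Phi z)) by (field; lra).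
      lra. }
    apply Rle_trans with (3 * x * (Q * Mass g) * (2 * r ^ N / Cmod mu)).
    - apply Rle_trans with (Cmod (h z) * Cmod (Phi z) * (2 * r ^ N / Cmod mu)).
      + rewrite Rmult_assoc. rewrite <- (Rmult_1_r (Cmod (h z))) at 1.
        apply Rmult_le_compat_l; auto using Cmod_ge_0.
      + apply Rmult_le_compat_r; auto. left. apply Rdiv_lt_0_compat; lra.
    - assert (HQx : Q * x <= (2 + q) * x ^ (2 * P + 1)).
      { unfold Q, denominator_bound. rewrite Rpow_mult_distr.
        assert (X2 : x <= x ^ (2 * P + 1)) by (rewrite <- (pow_1 x) at 1; apply Rle_pow; [auto|lia]).
        replace ((2 + 512 * (W / eta) ^ 2 * (8 ^ (2 * P) * x ^ (2 * P))) * x)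
          with (2 * x + q * (x ^ (2 * P) * x)) by (unfold q; ring).
        replace (x ^ (2 * P) * x) with (x ^ (2 * P + 1)) by (rewrite pow_add; simpl; ring). lra. }
      assert (HrNx : r ^ N <= 3 ^ N * x ^ N) by (rewrite <- Rpow_mult_distr; apply pow_incr; lra).
      replace (X0 * x ^ p) with (3 * Mass g * ((2 + q) * x ^ (2 * P + 1)) * (2 * (3 ^ N * x ^ N) / Cmod mu)).
      2:{ unfold X0, p. rewrite (pow_add x (2 * P + 1) N). field. lra. }
      replace (3 * x * (Q * Mass g)) with (3 * Mass g * (Q * x)) by ring.
      assert (0 <= Q * x).
      { apply Rmult_le_pos; [|lra]. destruct (Hden z Hz O) as [_ HQ0].
        eapply Rle_trans; [apply Cmod_ge_0|exact HQ0]. }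
      apply Rmult_le_compat.
      + apply Rmult_le_pos; lra.
      + left. apply Rdiv_lt_0_compat; lra.
      + apply Rmult_le_compat_l; lra.
      + apply Rmult_le_compat_r; [left; now apply Rinv_0_lt_compat|]. lra. }
  assert (log_plus (Cmod (h z)) <= Ax).
  { eapply Rle_trans; [apply log_plus_le, HX|]. apply log_plus_monomial; auto. }
  assert (0 <= m (3 * x) * beta k) by (apply Rmult_le_pos; auto). lra. }
assert (Hmean : sample_mean (fun z => log_plus (Cmod (h z))) r mm <= Ax + m (3 * x) * (delta / 3)).
{ unfold sample_mean. apply Rmult_le_reg_r with (INR mm); auto.
  unfold Rdiv at 1. rewrite Rmult_assoc, Rinv_l, Rmult_1_r by lra.
  eapply Rle_trans; [apply rsum_le, Hpt|]. rewrite rsum_plus, rsum_const, rsum_scal.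
  assert (m (3 * x) * rsum beta mm <= m (3 * x) * (INR mm * (97 * W / theta))) by (apply Rmult_le_compat_l; auto).
  replace (97 * W / theta) with (delta / 3) in H by (unfold W; field; lra). lra. }
destruct (Hm2 x ltac:(lra)) as (z & Hz & ->).
assert (HA : 0 <= 3 * log_plus X0 * ln x) by (apply Rmult_le_pos; lra).
assert (HpA : 0 <= 3 * INR p) by lra.
apply Rle_trans with (1 + 3 * (Ax + m (3 * x) * (delta / 3))).
- apply log_plus_le_of_exp; [|].
  + assert (0 <= m (3 * x) * (delta / 3)) by (apply Rmult_le_pos; lra). lra.
  + eapply Rle_trans; [apply HJ; lra|]. apply exp_le. lra.
- unfold Ax. nra.
Qed.

(** Finite order ([growth_at_scale]) and contraction ([growth_step]) are the
    inputs of [growth_bootstrap]; logarithmic growth of the maximum of [log_plus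
    (Cmod (h z))] is polynomial growth of [h]. *)
Theorem polynomial_growth : exists Cst K, forall z, Cmod (h z) <= Cst * (1 + Cmod z) ^ K.
Proof.
assert (Hex : forall x, exists v, 0 <= x ->
   (forall z, Cmod z <= x -> log_plus (Cmod (h z)) <= v) /\
   exists z, Cmod z <= x /\ v = log_plus (Cmod (h z))).
{ intros x. destruct (Rle_dec 0 x) as [Hx|Hx]; [|exists 0; intros; contradiction].
  destruct (disc_max (fun z => Cmod (h z)) x Hx) as (z1 & Hz1 & Hmax).
  { intros z _. apply Ccontinuous_germ, (germ_le 3); auto. }
  exists (log_plus (Cmod (h z1))). intros _. split; [|now exists z1].
  intros z Hz. apply log_plus_le. now apply Hmax. }
destruct (functional_choice _ _ _ Hex) as (m & Hm).
destruct growth_scale_polynomial as (Cst & p & HC & Hsc).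
destruct (growth_bootstrap m Cst p) as (A & HA & HmA).
- intros x y Hxy. destruct (Hm x ltac:(lra)) as [_ (z & Hz & ->)]. apply Hm; lra.
- intros x Hx. destruct (Hm x ltac:(lra)) as [_ (z & Hz & ->)].
  apply log_plus_le_of_exp.
  + apply Rmult_le_pos; auto. apply pow_le; lra.
  + eapply Rle_trans; [apply (growth_at_scale x Hx z Hz)|]. apply exp_le. now apply Hsc.
- apply growth_step.
  + intros x z Hx. now apply Hm.
  + intros x Hx. now apply Hm.
- destruct (INR_unbounded A) as (K & HK).
  exists (exp A), K. intros z. pose proof (Cmod_ge_0 z) as Hz.
  assert (Hln : 0 <= ln (1 + Cmod z)) by (rewrite <- ln_1; apply ln_le; lra).
  eapply Rle_trans; [apply le_exp_log_plus|].
  apply Rle_trans with (exp (A * (1 + ln (1 + Cmod z)))).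
  + apply exp_le. eapply Rle_trans; [|apply HmA; lra]. apply Hm; lra.
  + rewrite Rmult_plus_distr_l, Rmult_1_r, exp_plus. apply Rmult_le_compat_l; [left; apply exp_pos|].
    rewrite <- (exp_ln ((1 + Cmod z) ^ K)) by (apply pow_lt; lra). apply exp_le.
    rewrite ln_pow by lra. apply Rmult_le_compat_r; lra.
Qed.
End Growth.

(** * The adjoint on the orthogonal complement of the root vectors *)

Lemma summable_0 : summable (fun _ => RtoC 0).
Proof.
apply (summable_ext (fun n => delta 0 n * RtoC 0)%C); [intros; ring|]. apply summable_delta.
Qed.

Lemma CSeries_csum (u : nat -> nat -> C) k : (forall j, (j < k)%nat -> summable (u j)) ->
  summable (fun n => csum (fun j => u j n) k) /\
  CSeries (fun n => csum (fun j => u j n) k) = csum (fun j => CSeries (u j)) k.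
Proof.
induction k as [|k IH]; intros H; simpl.
- split; [apply summable_0|apply CSeries_0].
- destruct IH as [I1 I2]; [auto|]. split.
  + apply summable_plus; auto.
  + rewrite CSeries_plus, I2; auto. apply H. lia.
Qed.

Section Adjoint.
Context (s : nat -> C) (nu : nat -> R) (a b : nat -> C) (D : perturbation_data s nu a b).
Let L := rank_one_perturbation nu s a b.
Let V := rank_one_perturbation nu (fun n => Cconj (s n)) b a.
Let Hnu := pd_nu _ _ _ _ D.
Let Hs := pd_null _ _ _ _ D.
Let cpl := coupling nu a.
Let Phi := phi s nu a b.
Let orth := orthogonal_to_roots s nu a b.
Let good := good_point s nu a b.

Definition entire_extension_of (x : nat -> C) (h : C -> C) : Prop :=
  (forall z, germ 3 h z) /\
  (forall z, good z -> (h z * Phi z)%C = numerator s nu a x z) /\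
  (forall n, (h (/ s n) * Cconj (b n))%C = (- Cconj (x n))%C).

Lemma s_bounded : exists M, forall n, Cmod (s n) <= M.
Proof. destruct (Ctends_0_bounded s Hs) as (M & _ & HM). now exists M. Qed.

(** The operator maps its root vectors to root vectors. *)
Lemma adjoint_orthogonal x : orth x -> orth (V x).
Proof.
intros [Hx Ho].
pose proof (is_adjoint_rank_one_perturbation nu s a b Hnu s_bounded (pd_a _ _ _ _ D) (pd_b _ _ _ _ D))
  as [HV Hadj].
split; [now apply HV|]. intros y Hy. unfold V. rewrite <- Hadj; auto; [|apply Hy]. apply Ho.
destruct (generalized_root_vector _ _ _ Hy) as (lambda & Hr).
apply (root_vector_generalized nu _ lambda).
apply (root_vector_operator nu L Hnu (perturbation_maps_L2 s nu a b D)
  (perturbation_plus s nu a b D) (perturbation_scal s nu a b D)). exact Hr.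
Qed.

Lemma resolvent_times_z (e : nat -> C) z : summable e -> regular s e z ->
  (z * CSeries (fun n => e n * s n * / (1 - z * s n)) = resolvent_sum s e z - CSeries e)%C.
Proof.
intros He Hr. unfold resolvent_sum.
assert (H1 : summable (fun n => e n * / (1 - z * s n))%C) by (now apply resolvent_summable).
destruct (Ctends_0_bounded s Hs) as (M & HM & HsM).
assert (H2 : summable (fun n => e n * s n * / (1 - z * s n))%C).
{ apply (summable_ext (fun n => (e n * / (1 - z * s n)) * s n)%C); [intros; ring|].
  apply summable_bounded_mult with M; auto. }
rewrite <- CSeries_scal by auto.
replace (CSeries (fun n => e n * / (1 - z * s n)) - CSeries e)%C with
  (CSeries (fun n => e n * / (1 - z * s n)) + (- (1)) * CSeries e)%C by ring.
rewrite <- (CSeries_scal (- (1)) e), <- CSeries_plus by (auto; now apply summable_scal).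
apply CSeries_ext. intros n. destruct (classic (e n = 0)) as [->|Hn]; [ring|].
pose proof (regular_neq _ _ _ _ Hr Hn) as Hne. field.
intros E. apply Hne. symmetry. now apply Cminus_eq_0.
Qed.

Lemma numerator_adjoint x z : orth x -> regular s (cpl b) z ->
  (z * numerator s nu a (V x) z = numerator s nu a x z - z * inner nu a x * Phi z)%C.
Proof.
intros Hx Hr. pose proof (regular_coupling s nu a b D x Hx z Hr) as Hrx. destruct Hx as [Hx _].
pose proof (coupling_summable s nu a b D x Hx) as Scx. fold cpl in Scx, Hrx.
pose proof (coupling_b_summable s nu a b D) as Scb. fold cpl in Scb.
destruct (Ctends_0_bounded s Hs) as (M & HM & HsM).
assert (E : resolvent_sum s (cpl (V x)) z =
   (CSeries (fun n => cpl x n * s n * / (1 - z * s n)) + inner nu a x * resolvent_sum s (cpl b) z)%C).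
{ unfold resolvent_sum. rewrite <- CSeries_scal, <- CSeries_plus.
  - apply CSeries_ext. intros n. unfold cpl, coupling, V, rank_one_perturbation, rank_one, mul_op.
    rewrite (inner_conj nu a x), Cplus_conj, !Cmult_conj, !Cconj_conj. ring.
  - apply (summable_ext (fun n => (cpl x n * / (1 - z * s n)) * s n)%C); [intros; ring|].
    apply summable_bounded_mult with M; auto. now apply resolvent_summable.
  - apply summable_scal. now apply resolvent_summable.
  - now apply resolvent_summable. }
unfold numerator. fold cpl. rewrite E.
replace (z * (z * (CSeries (fun n => cpl x n * s n * / (1 - z * s n)) + inner nu a x * resolvent_sum s (cpl b) z)))%C
 with (z * (z * CSeries (fun n => cpl x n * s n * / (1 - z * s n)))
       + z * z * inner nu a x * resolvent_sum s (cpl b) z)%C by ring.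
rewrite resolvent_times_z by auto.
change (CSeries (cpl x)) with (inner nu a x). unfold Phi, phi. fold cpl. ring.
Qed.

(** On these entire functions the adjoint acts by [h z => h z / z - inner nu a
    x], so it lowers the degree of polynomial growth by one. *)
Lemma extension_adjoint x h h' : orth x -> entire_extension_of x h -> entire_extension_of (V x) h' ->
  forall z, h z = (z * (h' z + inner nu a x))%C.
Proof.
intros Hx (Hg & He & _) (Hg' & He' & _) z0.
destruct (good_points_punctured s nu a b D x Hx z0) as (d & Hd & Hgood).
apply (continuous_agree h (fun z => z * (h' z + inner nu a x))%C z0 d); auto.
- apply (germ_le 3 1); auto.
- apply germ_mult; [apply germ_id|]. apply germ_plus; [|apply germ_const].
  apply (germ_le 3 1); auto.
- intros z Hz. specialize (Hgood z Hz). specialize (He z Hgood). specialize (He' z Hgood).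
  destruct Hgood as [Hr HP]. fold Phi in HP.
  pose proof (numerator_adjoint x z Hx Hr) as E. rewrite <- He, <- He' in E.
  assert (E2 : (h z * Phi z = z * (h' z + inner nu a x) * Phi z)%C).
  { replace (h z * Phi z)%C with (h z * Phi z - z * inner nu a x * Phi z + z * inner nu a x * Phi z)%C by ring.
    rewrite <- E. ring. }
  replace (h z) with (h z * Phi z * / Phi z)%C by (field; auto). rewrite E2. field. auto.
Qed.

(** Liouville's theorem, by the maximum principle on large discs. *)
Lemma entire_decay_zero (f : C -> C) Cst : (forall z, germ 3 f z) ->
  (forall z, 1 <= Cmod z -> Cmod z * Cmod (f z) <= Cst) -> forall z, f z = 0.
Proof.
intros Hf Hb z. apply Cmod_eq_0, Rle_antisym; [|apply Cmod_ge_0].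
apply Rnot_lt_le. intros Hpos.
assert (HC : 0 <= Cst).
{ assert (H1 : Cmod (RtoC 1) = 1) by (apply Cmod_RtoC_pos; lra).
  eapply Rle_trans; [|apply (Hb 1)]; [apply Rmult_le_pos; apply Cmod_ge_0|lra]. }
set (r := 1 + Cmod z + Cst / Cmod (f z)).
assert (Hq : 0 <= Cst / Cmod (f z)) by (apply Rmult_le_pos; auto; left; now apply Rinv_0_lt_compat).
pose proof (Cmod_ge_0 z) as Hz.
assert (Hr : 1 <= r) by (unfold r; lra).
assert (H : Cmod (f z) <= Cst / r).
{ apply (maximum_principle (fun z => Cmod (f z)) r (Cst / r)); try (unfold r; lra).
  - intros; apply Cmod_ge_0.
  - intros w _. apply Ccontinuous_germ, (germ_le 3 1); auto.
  - intros w _. now apply log_subharmonic_germ.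
  - intros w Hw. specialize (Hb w ltac:(lra)). rewrite Hw in Hb.
    apply Rmult_le_reg_l with r; [lra|]. replace (r * (Cst / r)) with Cst by (field; lra). exact Hb. }
apply (Rmult_le_compat_l r) in H; [|lra]. replace (r * (Cst / r)) with Cst in H by (field; lra).
assert (r * Cmod (f z) = (1 + Cmod z) * Cmod (f z) + Cst) by (unfold r; field; lra).
assert (0 < (1 + Cmod z) * Cmod (f z)) by (apply Rmult_lt_0_compat; lra). lra.
Qed.

Lemma extension_exists x : orth x -> exists h, entire_extension_of x h.
Proof. exact (entire_extension s nu a b D x). Qed.

(** When the degree has been lowered to 0, [h z / z] decays; it then vanishes,
    and with [h] also the vector. *)
Lemma adjoint_nilpotent_of_growth K : forall x h Cst, orth x -> entire_extension_of x h ->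
  (forall z, 1 <= Cmod z -> Cmod (h z) <= Cst * Cmod z ^ K) ->
  exists k, Nat.iter k V x = (fun _ => RtoC 0).
Proof.
induction K as [|K IH]; intros x h Cst Hx Hh Hb;
  destruct (extension_exists (V x) (adjoint_orthogonal x Hx)) as (h' & Hh');
  pose proof (extension_adjoint x h h' Hx Hh Hh') as E.
- exists O. simpl. apply functional_extensionality. intros n.
  assert (Hz : forall z, (h' z + inner nu a x)%C = 0).
  { apply (entire_decay_zero _ Cst).
    - intros z. apply germ_plus; [apply Hh'|apply germ_const].
    - intros z Hz. rewrite <- Cmod_mult, <- E. specialize (Hb z Hz). simpl in Hb. lra. }
  destruct Hh as (_ & _ & H). specialize (H n). rewrite E, Hz, Cmult_0_r, Cmult_0_l in H.
  apply Cconj_eq_0. replace (Cconj (x n)) with (- - Cconj (x n))%C by ring. rewrite <- H. ring.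
- destruct (IH (V x) h' (Cst + Cmod (inner nu a x)) (adjoint_orthogonal x Hx) Hh') as (k & Hk).
  + intros z Hz. specialize (Hb z Hz). rewrite E, Cmod_mult in Hb. simpl in Hb.
    assert (Hsum : Cmod (h' z + inner nu a x) <= Cst * Cmod z ^ K).
    { apply Rmult_le_reg_l with (Cmod z); [lra|]. lra. }
    pose proof (Cmod_reverse_triangle (h' z) (- inner nu a x)) as T. rewrite Cmod_opp in T.
    replace (h' z - - inner nu a x)%C with (h' z + inner nu a x)%C in T by ring.
    assert (1 <= Cmod z ^ K) by (now apply pow_R1_Rle).
    pose proof (Cmod_ge_0 (inner nu a x)).
    assert (Cmod (inner nu a x) * 1 <= Cmod (inner nu a x) * Cmod z ^ K) by (now apply Rmult_le_compat_l).
    lra.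
  + exists (S k). simpl. now rewrite <- Nat.iter_swap.
Qed.

Definition moment_coefficients (i : nat) : nat -> C := fun n => (cpl b n * (/ s n) ^ i)%C.

Lemma abs_moment_summable i : abs_moment_finite nu s a b i -> summable (moment_coefficients i).
Proof.
apply ex_series_Rext. intros n. unfold moment_coefficients, cpl, coupling.
rewrite !Cmod_mult, Cmod_conj, Cmod_pow, (Cmod_RtoC_pos (nu n)) by (left; apply Hnu). ring.
Qed.

Lemma abs_moment_lower i j : (i <= j)%nat -> abs_moment_finite nu s a b j -> abs_moment_finite nu s a b i.
Proof.
intros Hij Hj. destruct (Ctends_0_bounded s Hs) as (M & HM & HsM).
apply ex_series_pos_le with (fun n => M ^ (j - i) * (Cmod (a n * b n)%C * Cmod (/ s n)%C ^ j * nu n)).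
- intros n. pose proof (Hnu n). pose proof (Cmod_ge_0 (a n * b n)). pose proof (Cmod_ge_0 (/ s n)).
  split; [apply Rmult_le_pos; [apply Rmult_le_pos; auto; now apply pow_le|lra]|].
  replace (M ^ (j - i) * (Cmod (a n * b n) * Cmod (/ s n) ^ j * nu n))
    with (Cmod (a n * b n) * (M ^ (j - i) * Cmod (/ s n) ^ j) * nu n) by ring.
  apply Rmult_le_compat_r; [lra|]. apply Rmult_le_compat_l; auto.
  replace j with ((j - i) + i)%nat at 2 by lia. rewrite pow_add, <- Rmult_assoc, <- Rpow_mult_distr.
  rewrite <- (Rmult_1_l (Cmod (/ s n) ^ i)) at 1. apply Rmult_le_compat_r; [now apply pow_le|].
  apply pow_R1_Rle. rewrite Cmod_inv by apply D.
  pose proof (proj1 (Cmod_gt_0 (s n)) (pd_nonzero _ _ _ _ D n)) as Hp.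
  apply Rmult_le_reg_r with (Cmod (s n)); auto. rewrite Rmult_assoc, Rinv_l by lra.
  specialize (HsM n). lra.
- now apply ex_series_Rscal.
Qed.

Lemma moment_eq i : CSeries (moment_coefficients i) = moment nu s a b i.
Proof. unfold moment. apply CSeries_ext. intros n. unfold moment_coefficients, cpl, coupling. ring. Qed.

Lemma moment_coefficients_regular i z : regular s (cpl b) z -> regular s (moment_coefficients i) z.
Proof. intros H n Hn. unfold moment_coefficients. rewrite (H n Hn). ring. Qed.

Lemma moment_shift i z : abs_moment_finite nu s a b (S i) -> regular s (cpl b) z ->
  (z * resolvent_sum s (moment_coefficients i) z
   = resolvent_sum s (moment_coefficients (S i)) z - moment nu s a b (S i))%C.
Proof.
intros Hi Hr. rewrite <- moment_eq, <- resolvent_times_z;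
  auto using abs_moment_summable, moment_coefficients_regular.
f_equal. unfold resolvent_sum. apply CSeries_ext. intros n. unfold moment_coefficients.
rewrite Cpow_S.
replace (cpl b n * (/ s n * (/ s n) ^ i) * s n)%C with (cpl b n * (/ s n) ^ i * (/ s n * s n))%C by ring.
rewrite Cinv_l by apply D. ring.
Qed.

Lemma phi_first_moment z : abs_moment_finite nu s a b 1 -> regular s (cpl b) z ->
  Phi z = (1 + moment nu s a b 1 - resolvent_sum s (moment_coefficients 1) z)%C.
Proof.
intros H1 Hr. pose proof (moment_shift 0 z H1 Hr) as E.
replace (resolvent_sum s (moment_coefficients 0) z) with (resolvent_sum s (cpl b) z) in E.
- unfold Phi, phi. fold cpl. rewrite E. ring.
- apply CSeries_ext. intros n. unfold moment_coefficients. simpl. ring.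
Qed.

(** The moment conditions annihilate the coefficients of [z ^ 0] to [z ^ (1 -
    N)] in the expansion of [phi] at infinity. *)
Lemma phi_degenerate N z : (1 <= N)%nat -> degenerate_moments nu s a b N -> regular s (cpl b) z ->
  (z ^ N * Phi z = moment nu s a b (N + 1) - resolvent_sum s (moment_coefficients (N + 1)) z)%C.
Proof.
intros HN (Habs & H1 & H0 & _) Hr.
assert (Hlow : forall i, (i <= N + 1)%nat -> abs_moment_finite nu s a b i)
  by (intros i Hi; now apply (abs_moment_lower i (N + 1))).
assert (K : forall i, (i < N)%nat -> (z ^ i * Phi z = - resolvent_sum s (moment_coefficients (S i)) z)%C).
{ induction i as [|i IH]; intros Hi.
  - simpl. rewrite phi_first_moment by (auto; apply Hlow; lia). rewrite H1.
    replace (RtoC (-1)) with (- RtoC 1)%C by (unfold RtoC, Copp; simpl; f_equal; ring). ring.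
  - rewrite Cpow_S, <- Cmult_assoc, IH by lia.
    replace (z * - resolvent_sum s (moment_coefficients (S i)) z)%C with
      (- (z * resolvent_sum s (moment_coefficients (S i)) z))%C by ring.
    rewrite moment_shift by (auto; apply Hlow; lia). rewrite H0 by lia. ring. }
destruct N as [|N]; [lia|].
rewrite Cpow_S, <- Cmult_assoc, K by lia.
replace (z * - resolvent_sum s (moment_coefficients (S N)) z)%C with
  (- (z * resolvent_sum s (moment_coefficients (S N)) z))%C by ring.
replace (S N + 1)%nat with (S (S N)) by lia.
rewrite moment_shift by (auto; apply Hlow; lia). ring.
Qed.

Lemma adjoint_nilpotent P e N mu : (1 <= P)%nat -> ex_series (fun n => Cmod (s n) ^ P) ->
  summable e -> mu <> RtoC 0 ->
  (forall z, regular s (cpl b) z -> (z ^ N * Phi z = mu - resolvent_sum s e z)%C) ->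
  forall x, orth x -> exists k, Nat.iter k V x = (fun _ => RtoC 0).
Proof.
intros HP HSP He Hmu Hphi x Hx.
destruct (extension_exists x Hx) as (h & Hh).
destruct (polynomial_growth s (pd_nonzero _ _ _ _ D) Hs P HP HSP (cpl b) (cpl x)
  (coupling_b_summable s nu a b D) (coupling_summable s nu a b D x (proj1 Hx)) h (proj1 Hh))
  with (e := e) (N := N) (mu := mu) as (Cst & K & HK); auto.
{ intros z Hr HP'. apply Hh. split; auto. }
apply (adjoint_nilpotent_of_growth K x h (Rabs Cst * 2 ^ K)); auto.
intros z Hz. eapply Rle_trans; [apply HK|].
rewrite Rmult_assoc, <- Rpow_mult_distr.
apply Rle_trans with (Rabs Cst * (1 + Cmod z) ^ K).
- apply Rmult_le_compat_r; [apply pow_le; lra|apply Rle_abs].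
- apply Rmult_le_compat_l; [apply Rabs_pos|]. apply pow_incr. lra.
Qed.

(** Dividing [b] repeatedly by [Cconj (s n)] gives the candidates for root
    vectors of [V] at 0; they need not belong to [L2]. *)
Definition kernel_model (j : nat) : nat -> C := fun n => (Cconj (/ s n) ^ j * b n)%C.

Lemma Cconj_RtoC (x : R) : Cconj x = x.
Proof. unfold Cconj, RtoC; simpl. f_equal. ring. Qed.

Lemma Cconj_s_inv n : (Cconj (s n) * Cconj (/ s n))%C = 1.
Proof. rewrite <- Cmult_conj, Cinv_r by apply D. apply Cconj_RtoC. Qed.

Lemma csum_shift (f : nat -> C) k : csum f (S k) = (f O + csum (fun j => f (S j)) k)%C.
Proof. induction k as [|k IH]; [simpl; ring|]. simpl in *. rewrite IH. ring. Qed.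

(** Solving [V y = x] for [y] means dividing by [Cconj (s n)], which raises
    every index of [kernel_model] by one, after moving the rank one term to the
    other side, which contributes a multiple of [kernel_model 1]. The same
    coefficients serve all iterates. *)
Lemma adjoint_kernel_form k : forall x, Nat.iter k V x = (fun _ => RtoC 0) ->
  exists q : nat -> C, ((0 < k)%nat -> q O = (- inner nu x a)%C) /\
    forall i, (i <= k)%nat -> forall n,
      Nat.iter i V x n = csum (fun j => q (i + j)%nat * kernel_model (S j) n)%C (k - i).
Proof.
induction k as [|k IH]; intros x Hx.
- exists (fun _ => RtoC 0). split; [lia|]. intros i Hi n. replace i with O by lia. simpl in *.
  now rewrite Hx.
- simpl in Hx. rewrite <- Nat.iter_swap in Hx. destruct (IH (V x) Hx) as (q & _ & Hq).
  exists (fun j => match j with O => (- inner nu x a)%C | S j => q j end). split; auto.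
  intros i Hi n. destruct i as [|i].
  + change (Nat.iter 0 V x n) with (x n). rewrite Nat.sub_0_r, csum_shift. cbn [Nat.add].
    assert (Hq0 : (Cconj (s n) * x n + inner nu x a * b n)%C
                  = csum (fun j => q j * kernel_model (S j) n)%C k).
    { pose proof (Hq O (Nat.le_0_l _) n) as E. rewrite Nat.sub_0_r in E. exact E. }
    assert (Ex : x n = (Cconj (/ s n) * (Cconj (s n) * x n))%C).
    { rewrite Cmult_assoc, (Cmult_comm (Cconj (/ s n))), Cconj_s_inv. ring. }
    rewrite Ex.
    replace (Cconj (s n) * x n)%C with
      (Cconj (s n) * x n + inner nu x a * b n - inner nu x a * b n)%C by ring.
    rewrite Hq0.
    rewrite (csum_ext (fun j => q j * kernel_model (S (S j)) n)%C
        (fun j => Cconj (/ s n) * (q j * kernel_model (S j) n))%C).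
    * rewrite csum_scal. unfold kernel_model at 2. rewrite Cpow_1_r. ring.
    * intros j _. unfold kernel_model. rewrite !Cpow_S. ring.
  + simpl. rewrite <- Nat.iter_swap. rewrite Hq by lia. reflexivity.
Qed.

Lemma kernel_model_inner j : abs_moment_finite nu s a b j ->
  summable (fun n => kernel_model j n * Cconj (a n) * nu n)%C /\
  CSeries (fun n => kernel_model j n * Cconj (a n) * nu n)%C = Cconj (moment nu s a b j).
Proof.
intros Hj.
assert (E : forall n, (kernel_model j n * Cconj (a n) * nu n)%C = Cconj (moment_coefficients j n)).
{ intros n. unfold kernel_model, moment_coefficients, cpl, coupling.
  rewrite !Cmult_conj, Cpow_conj, Cconj_conj, Cconj_RtoC. ring. }
split.
- apply (summable_ext (fun n => Cconj (moment_coefficients j n))); [intros; now rewrite E|].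
  apply (summable_le _ (fun n => Cmod (moment_coefficients j n))).
  + intros n. rewrite Cmod_conj. lra.
  + now apply abs_moment_summable.
- rewrite (CSeries_ext _ (fun n => Cconj (moment_coefficients j n))) by auto.
  now rewrite CSeries_conj, moment_eq.
Qed.

Lemma kernel_inner (x q : nat -> C) k : (forall j, (j <= k)%nat -> abs_moment_finite nu s a b j) ->
  (forall n, x n = csum (fun j => q j * kernel_model (S j) n)%C k) ->
  inner nu x a = csum (fun j => q j * Cconj (moment nu s a b (S j)))%C k.
Proof.
intros Hm Hx. unfold inner.
rewrite (CSeries_ext _ (fun n => csum (fun j => q j * (kernel_model (S j) n * Cconj (a n) * nu n)) k)%C).
- destruct (CSeries_csum (fun j n => q j * (kernel_model (S j) n * Cconj (a n) * nu n))%C k) as [_ E].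
  + intros j Hj. apply summable_scal. apply kernel_model_inner. apply Hm. lia.
  + rewrite E. apply csum_ext. intros j Hj.
    destruct (kernel_model_inner (S j)) as [S1 S2]; [apply Hm; lia|].
    now rewrite CSeries_scal, S2.
- intros n. rewrite Hx.
  replace (csum (fun j => q j * kernel_model (S j) n) k * Cconj (a n) * nu n)%C with
    ((Cconj (a n) * nu n) * csum (fun j => q j * kernel_model (S j) n) k)%C by ring.
  rewrite <- csum_scal. apply csum_ext. intros. ring.
Qed.

(** A vector of the kernel is [y = - inner nu y a * kernel_model 1]; taking
    inner products with [a] gives a contradiction unless the first moment is
    [-1] or [y = 0]. *)
Lemma adjoint_injective x : abs_moment_finite nu s a b 1 -> moment nu s a b 1 <> RtoC (-1) ->
  V x = (fun _ => RtoC 0) -> x = (fun _ => RtoC 0).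
Proof.
intros H1 Hm HV. destruct (adjoint_kernel_form 1 x HV) as (q & Hq0 & Hq).
assert (Hx : forall n, x n = csum (fun j => q j * kernel_model (S j) n)%C 1) by exact (Hq O (le_S _ _ (le_n _))).
specialize (Hq0 (le_n _)).
assert (Hi : inner nu x a = (q O * Cconj (moment nu s a b 1))%C).
{ rewrite (kernel_inner x q 1); [simpl; ring| |exact Hx].
  intros j Hj. now apply (abs_moment_lower j 1). }
assert (E : (q O * (1 + Cconj (moment nu s a b 1)))%C = 0).
{ replace (q O * (1 + Cconj (moment nu s a b 1)))%C with
    (q O + q O * Cconj (moment nu s a b 1))%C by ring.
  rewrite <- Hi, Hq0. ring. }
apply Cmult_integral in E as [E|E].
- apply functional_extensionality. intros n. rewrite Hx. simpl. rewrite E. ring.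
- exfalso. apply Hm. rewrite <- (Cconj_conj (moment nu s a b 1)).
  replace (Cconj (moment nu s a b 1)) with (1 + Cconj (moment nu s a b 1) - 1)%C by ring.
  rewrite E. unfold Cconj, Cminus, Cplus, Copp, RtoC; simpl. f_equal; ring.
Qed.

Lemma iter_adjoint_orthogonal k x : orth x -> orth (Nat.iter k V x).
Proof. intros Hx. induction k as [|k IH]; simpl; auto. now apply adjoint_orthogonal. Qed.

Lemma nilpotent_injective_zero k x :
  (forall y, orth y -> V y = (fun _ => RtoC 0) -> y = (fun _ => RtoC 0)) -> orth x ->
  Nat.iter k V x = (fun _ => RtoC 0) -> x = (fun _ => RtoC 0).
Proof.
intros Hinj Hx. induction k as [|k IH]; simpl; auto.
intros H. apply IH, Hinj; auto. now apply iter_adjoint_orthogonal.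
Qed.

(** In the inner product of [y] with [a] only the first and the last moment
    survive, so [inner nu y a = - q 0 + q N * Cconj (moment (N + 1))], whereas
    [q 0 = - inner nu y a]. Hence [q N = 0], and [q N] is the only coefficient
    of [V ^ N y]. *)
Lemma adjoint_ascent N y : (1 <= N)%nat -> degenerate_moments nu s a b N ->
  Nat.iter (N + 1) V y = (fun _ => RtoC 0) -> Nat.iter N V y = (fun _ => RtoC 0).
Proof.
intros HN (Habs & H1 & H0 & Hne) Hy.
destruct (adjoint_kernel_form (N + 1) y Hy) as (q & Hq0 & Hq). specialize (Hq0 ltac:(lia)).
assert (Hi : inner nu y a = (- q O + q N * Cconj (moment nu s a b (N + 1)))%C).
{ rewrite (kernel_inner y q (N + 1)).
  - destruct N as [|N]; [lia|]. replace (S N + 1)%nat with (S (S N)) by lia.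
    rewrite csum_shift, H1. change (csum (fun j => q (S j) * Cconj (moment nu s a b (S (S j)))) (S N))%C
     with (csum (fun j => q (S j) * Cconj (moment nu s a b (S (S j)))) N
          + q (S N) * Cconj (moment nu s a b (S (S N))))%C.
    rewrite (csum_ext _ (fun _ => RtoC 0)), csum_0.
    + rewrite Cconj_RtoC. replace (RtoC (-1)) with (- RtoC 1)%C by (unfold RtoC, Copp; simpl; f_equal; ring).
      ring.
    + intros j Hj. rewrite H0 by lia. rewrite Cconj_RtoC. ring.
  - intros j Hj. now apply (abs_moment_lower j (N + 1)).
  - intros n. specialize (Hq O (Nat.le_0_l _) n). rewrite Nat.sub_0_r in Hq. exact Hq. }
assert (HqN : (q N * Cconj (moment nu s a b (N + 1)))%C = 0).
{ replace (q N * Cconj (moment nu s a b (N + 1)))%C with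
   (- q O + q N * Cconj (moment nu s a b (N + 1)) + q O)%C by ring.
  rewrite <- Hi, Hq0. ring. }
apply Cmult_integral in HqN as [HqN|HqN].
- apply functional_extensionality. intros n. rewrite Hq by lia.
  replace (N + 1 - N)%nat with 1%nat by lia. simpl. rewrite Nat.add_0_r, HqN. ring.
- exfalso. apply Hne. now apply Cconj_eq_0.
Qed.

Lemma adjoint_nilpotency_index N k x : (1 <= N)%nat -> degenerate_moments nu s a b N ->
  Nat.iter k V x = (fun _ => RtoC 0) -> Nat.iter N V x = (fun _ => RtoC 0).
Proof.
intros HN Hdeg Hk.
assert (Hstep : forall d, Nat.iter (d + N) V x = (fun _ => RtoC 0) -> Nat.iter N V x = (fun _ => RtoC 0)).
{ induction d as [|d IH]; auto. intros Hd. apply IH.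
  rewrite Nat.add_comm, Nat.iter_add. apply adjoint_ascent; auto.
  rewrite <- Nat.iter_add. replace (N + 1 + d)%nat with (S d + N)%nat by lia. exact Hd. }
apply (Hstep k). rewrite Nat.add_comm, Nat.iter_add, Hk. clear Hstep Hk HN Hdeg.
induction N as [|N IH]; auto. simpl. rewrite IH. apply functional_extensionality. intros n.
unfold V, rank_one_perturbation, rank_one, mul_op, inner.
rewrite (CSeries_ext _ (fun _ => RtoC 0)), CSeries_0 by (intros; ring). ring.
Qed.

(** The vector is a nonzero multiple of [kernel_model 1], which therefore
    belongs to [L2]. *)
Lemma kernel_in_zL2 y : L2 nu y -> V y = (fun _ => RtoC 0) -> y <> (fun _ => RtoC 0) ->
  in_zL2' nu s a b.
Proof.
intros Hy HV Hne. destruct (adjoint_kernel_form 1 y HV) as (q & _ & Hq).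
assert (Hx : forall n, y n = csum (fun j => q j * kernel_model (S j) n)%C 1) by exact (Hq O (le_S _ _ (le_n _))).
assert (Hq0 : q O <> 0).
{ intros E. apply Hne, functional_extensionality. intros n. rewrite Hx. simpl. rewrite E. ring. }
apply Cmod_gt_0 in Hq0.
apply ex_series_pos_le with (fun n => / Cmod (q O) ^ 2 * (Cmod (y n) ^ 2 * nu n)).
- intros n. pose proof (Hnu n).
  assert (E : / Cmod (q O) ^ 2 * (Cmod (y n) ^ 2 * nu n) = Cmod (b n) ^ 2 * Cmod (/ s n) ^ 2 * nu n).
  { rewrite Hx. simpl csum. rewrite Cplus_0_l. unfold kernel_model.
    rewrite !Cmod_mult, Cpow_1_r, Cmod_conj. field. lra. }
  rewrite E.
  assert (0 <= Cmod (b n) ^ 2 * Cmod (/ s n) ^ 2 * nu n).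
  { apply Rmult_le_pos; [|lra]. apply Rmult_le_pos; apply pow2_ge_0. }
  destruct (Ceq_dec (a n) 0); lra.
- now apply ex_series_Rscal.
Qed.

Section Schatten.
Context (P : nat) (HP : (1 <= P)%nat) (HSP : ex_series (fun n => Cmod (s n) ^ P)).

Lemma orthogonal_trivial_nondegenerate : abs_moment_finite nu s a b 1 ->
  moment nu s a b 1 <> RtoC (-1) -> forall x, orth x -> x = (fun _ => RtoC 0).
Proof.
intros H1 Hm x Hx.
destruct (adjoint_nilpotent P (moment_coefficients 1) 0 (1 + moment nu s a b 1)%C) with (x := x) as (k & Hk); auto.
- now apply abs_moment_summable.
- intros E. apply Hm. replace (moment nu s a b 1) with (1 + moment nu s a b 1 - 1)%C by ring.
  rewrite E. unfold Cminus, Cplus, Copp, RtoC; simpl. f_equal; ring.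
- intros z Hz. rewrite <- phi_first_moment by auto. simpl. ring.
- apply (nilpotent_injective_zero k); auto. intros y _. now apply adjoint_injective.
Qed.

Lemma orthogonal_nilpotent_degenerate N : (1 <= N)%nat -> degenerate_moments nu s a b N ->
  forall x, orth x -> Nat.iter N V x = (fun _ => RtoC 0).
Proof.
intros HN Hdeg x Hx.
destruct (adjoint_nilpotent P (moment_coefficients (N + 1)) N (moment nu s a b (N + 1))) with (x := x) as (k & Hk); auto.
- apply abs_moment_summable, Hdeg.
- apply Hdeg.
- intros z Hz. now apply phi_degenerate.
- now apply (adjoint_nilpotency_index N k).
Qed.

Lemma orthogonal_trivial_degenerate N : (1 <= N)%nat -> degenerate_moments nu s a b N ->
  ~ in_zL2' nu s a b -> forall x, orth x -> x = (fun _ => RtoC 0).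
Proof.
intros HN Hdeg Hz x Hx. apply (nilpotent_injective_zero N); auto.
- intros y Hy HV. apply NNPP. intros Hne. apply Hz. apply (kernel_in_zL2 y); auto. apply Hy.
- now apply orthogonal_nilpotent_degenerate.
Qed.

Lemma orthogonal_form_degenerate N : (1 <= N)%nat -> degenerate_moments nu s a b N ->
  forall x, orth x -> exists q : nat -> C, forall n, x n = csum (fun j => q j * kernel_model (S j) n)%C N.
Proof.
intros HN Hdeg x Hx.
destruct (adjoint_kernel_form N x (orthogonal_nilpotent_degenerate N HN Hdeg x Hx)) as (q & _ & Hq).
exists q. intros n. specialize (Hq O (Nat.le_0_l _) n). rewrite Nat.sub_0_r in Hq. exact Hq.
Qed.
End Schatten.
End Adjoint.

(** * Spans, projections and dimension *)

Lemma lin_comb_app l l' n : lin_comb (l ++ l') n = (lin_comb l n + lin_comb l' n)%C.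
Proof. unfold lin_comb. induction l as [|cv l IH]; simpl; [ring|rewrite IH; ring]. Qed.

Lemma span_plus P x y : span P x -> span P y -> span P (fun n => x n + y n)%C.
Proof.
intros (l & Hl & E) (l' & Hl' & E'). exists (l ++ l'). split; [now apply Forall_app|].
intros n. now rewrite lin_comb_app, E, E'.
Qed.

Lemma span_scal P c x : span P x -> span P (fun n => c * x n)%C.
Proof.
intros (l & Hl & E). exists (map (fun cv => ((c * fst cv)%C, snd cv)) l). split.
- clear E. induction Hl; simpl; constructor; auto.
- intros n. rewrite E. unfold lin_comb. clear. induction l as [|cv l IH]; simpl; [ring|].
  rewrite <- IH. ring.
Qed.

Lemma span_mem (P : (nat -> C) -> Prop) x : P x -> span P x.
Proof.
intros H. exists ((RtoC 1, x) :: nil). split; [constructor; auto|]. intros n. unfold lin_comb. simpl. ring.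
Qed.

Lemma span_0 P : span P (fun _ => RtoC 0).
Proof. exists nil. split; [constructor|]. reflexivity. Qed.

Lemma span_L2 nu P x : (forall n, 0 < nu n) -> (forall y, P y -> L2 nu y) -> span P x -> L2 nu x.
Proof.
intros Hnu HP (l & Hl & E). apply (L2_ext nu (lin_comb l)); [intros; now rewrite E|]. clear E.
induction Hl as [|[c v] l Hv Hl IH]; [apply L2_0|].
apply (L2_plus nu (fun n => c * v n)%C (lin_comb l)); auto. now apply L2_scal, HP.
Qed.

Definition sqnorm (nu : nat -> R) (x : nat -> C) : R := Series (fun n => Cmod (x n) ^ 2 * nu n).

Section Hilbert.
Context (nu : nat -> R) (Hnu : forall n, 0 < nu n).

Lemma sq_term_pos x n : 0 <= Cmod (x n) ^ 2 * nu n.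
Proof. apply Rmult_le_pos; [apply pow2_ge_0|left; apply Hnu]. Qed.

Lemma sqnorm_pos x : L2 nu x -> 0 <= sqnorm nu x.
Proof. intros Hx. apply Series_pos; auto. intros; apply sq_term_pos. Qed.

Lemma L2_minus x y : L2 nu x -> L2 nu y -> L2 nu (fun n => x n - y n)%C.
Proof.
intros Hx Hy. apply (L2_ext nu (fun n => x n + (- (1)) * y n)%C); [intros; ring|].
apply L2_plus; auto. now apply L2_scal.
Qed.

Lemma sqnorm_expand x y c : L2 nu x -> L2 nu y ->
  sqnorm nu (fun n => x n - c * y n)%C
  = sqnorm nu x - 2 * Re (Cconj c * inner nu x y)%C + Cmod c ^ 2 * sqnorm nu y.
Proof.
intros Hx Hy. unfold sqnorm.
assert (S : summable (fun n => x n * Cconj (y n) * nu n)%C) by (now apply inner_abs).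
unfold inner. rewrite <- CSeries_scal by exact S.
assert (ReC : forall v, Re (CSeries v) = Series (fun n => Re (v n))) by reflexivity.
rewrite ReC, <- !Series_scal_l.
assert (SR : ex_series (fun n => 2 * Re (Cconj c * (x n * Cconj (y n) * nu n))%C)).
{ apply ex_series_Rscal. apply ex_series_Re. exact (summable_scal _ _ S). }
assert (Sy : ex_series (fun n => Cmod c ^ 2 * (Cmod (y n) ^ 2 * nu n))) by (now apply ex_series_Rscal).
rewrite <- Series_minus, <- Series_plus; auto.
- apply Series_ext. intros n. rewrite !Cmod2_alt.
  destruct (x n) as [x1 x2], (y n) as [y1 y2], c as [c1 c2].
  unfold Re, Im, Cminus, Cplus, Copp, Cmult, Cconj, RtoC; simpl. ring.
- apply (ex_series_Rext (fun n => Cmod (x n) ^ 2 * nu n + (-1) * (2 * Re (Cconj c * (x n * Cconj (y n) * nu n))%C)));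
    [intros; ring|]. apply ex_series_Rplus; auto. now apply ex_series_Rscal.
Qed.

(** If [w] is nearly the shortest vector on its translate of the line of [v],
    then it is nearly orthogonal to [v]: compare with the multiple of [v] by
    [inner nu w v / (sqnorm nu v + 1)], where the added 1 covers [v = 0]. *)
Lemma almost_orthogonal w v dist : L2 nu w -> L2 nu v ->
  (forall c, dist <= sqnorm nu (fun n => w n - c * v n)%C) ->
  Cmod (inner nu w v) ^ 2 <= (sqnorm nu w - dist) * (sqnorm nu v + 1).
Proof.
intros Hw Hv H. pose proof (sqnorm_pos v Hv) as Hv0.
set (I := inner nu w v) in *. set (tau := / (sqnorm nu v + 1)).
assert (Htau : 0 < tau) by (apply Rinv_0_lt_compat; lra).
specialize (H (tau * I)%C). rewrite sqnorm_expand in H by auto. fold I in H.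
assert (E1 : Re (Cconj (tau * I) * I)%C = tau * Cmod I ^ 2).
{ rewrite Cmod2_alt. destruct I as [i1 i2]. unfold Re, Im, Cmult, Cconj, RtoC; simpl. ring. }
rewrite E1, Cmod_mult, (Cmod_RtoC_pos tau), Rpow_mult_distr in H by lra.
assert (E2 : tau * sqnorm nu v <= 1).
{ unfold tau. apply Rmult_le_reg_l with (sqnorm nu v + 1); [lra|].
  rewrite <- Rmult_assoc, Rinv_r; lra. }
assert (HI : 0 <= Cmod I ^ 2) by apply pow2_ge_0.
assert (E3 : tau ^ 2 * Cmod I ^ 2 * sqnorm nu v <= tau * Cmod I ^ 2).
{ replace (tau ^ 2 * Cmod I ^ 2 * sqnorm nu v) with (tau * Cmod I ^ 2 * (tau * sqnorm nu v)) by ring.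
  rewrite <- (Rmult_1_r (tau * Cmod I ^ 2)) at 2. apply Rmult_le_compat_l; auto.
  apply Rmult_le_pos; lra. }
assert (E4 : tau * Cmod I ^ 2 <= sqnorm nu w - dist) by lra.
apply (Rmult_le_compat_r (sqnorm nu v + 1)) in E4; [|lra].
replace (tau * Cmod I ^ 2 * (sqnorm nu v + 1)) with (Cmod I ^ 2) in E4 by (unfold tau; field; lra).
exact E4.
Qed.

Lemma sqnorm_ext x y : (forall n, x n = y n) -> sqnorm nu x = sqnorm nu y.
Proof. intros H. apply Series_ext. intros n. now rewrite H. Qed.

Lemma parallelogram x y : L2 nu x -> L2 nu y ->
  sqnorm nu (fun n => x n - y n)%C
  = 2 * sqnorm nu x + 2 * sqnorm nu y - 4 * sqnorm nu (fun n => / 2 * (x n + y n))%C.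
Proof.
intros Hx Hy. unfold sqnorm. rewrite <- !Series_scal_l.
assert (S1 : ex_series (fun n => 2 * (Cmod (x n) ^ 2 * nu n))) by (now apply ex_series_Rscal).
assert (S2 : ex_series (fun n => 2 * (Cmod (y n) ^ 2 * nu n))) by (now apply ex_series_Rscal).
assert (S3 : ex_series (fun n => 4 * (Cmod (/ 2 * (x n + y n))%C ^ 2 * nu n))).
{ apply ex_series_Rscal. apply L2_scal. now apply L2_plus. }
rewrite <- Series_plus, <- Series_minus by (auto using ex_series_Rplus).
apply Series_ext. intros n.
rewrite Cmod_mult, Cmod_inv, (Cmod_RtoC_pos 2) by (try apply RtoC_neq_0; lra).
rewrite Rpow_mult_distr, !Cmod2_alt.
destruct (x n) as [x1 x2], (y n) as [y1 y2]. unfold Re, Im, Cminus, Cplus, Copp; simpl. field.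
Qed.

Lemma bounded_partial_sums (f : nat -> R) B : (forall n, 0 <= f n) -> (forall m, rsum f m <= B) ->
  ex_series f /\ Series f <= B.
Proof.
intros Hf HB.
assert (E : forall n, sum_n f n = rsum f (S n)).
{ induction n as [|n IH]; [rewrite sum_O; simpl; ring|]. rewrite sum_Sn, IH. simpl. unfold plus; simpl. ring. }
assert (Hex : ex_finite_lim_seq (sum_n f)).
{ apply (ex_finite_lim_seq_incr _ B).
  - intros n. rewrite !E. simpl. specialize (Hf (S n)). lra.
  - intros n. rewrite E. apply HB. }
destruct Hex as (l & Hl).
assert (Hser : is_series f l) by exact Hl.
split; [now exists l|]. rewrite (is_series_unique _ _ Hser).
apply (is_lim_seq_le (sum_n f) (fun _ => B) l B); auto.
- intros n. rewrite E. apply HB.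
- apply is_lim_seq_const.
Qed.

Lemma is_lim_seq_rsum (f : nat -> nat -> R) (l : nat -> R) m :
  (forall n, is_lim_seq (fun j => f j n) (l n)) ->
  is_lim_seq (fun j => rsum (f j) m) (rsum l m).
Proof.
intros H. induction m as [|m IH]; simpl; [apply is_lim_seq_const|].
now apply (is_lim_seq_plus' _ _ _ _ IH).
Qed.

(** The coordinates converge, and the bounds on partial sums pass to the limit
    as in Fatou's lemma. *)
Lemma L2_complete (u : nat -> nat -> C) (eps : nat -> R) : (forall i, L2 nu (u i)) ->
  is_lim_seq eps 0 ->
  (forall i j, sqnorm nu (fun n => u i n - u j n)%C <= eps i + eps j) ->
  exists x, L2 nu x /\ forall i, sqnorm nu (fun n => u i n - x n)%C <= eps i.
Proof.
intros Hu Heps Hd.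
assert (Hrs : forall i j m, rsum (fun n => Cmod (u i n - u j n)%C ^ 2 * nu n) m <= eps i + eps j).
{ intros i j m. eapply Rle_trans; [|apply Hd]. apply rsum_le_Series.
  - intros n. apply Rmult_le_pos; [apply pow2_ge_0|left; apply Hnu].
  - apply L2_minus; auto. }
assert (Hcoord : forall n, exists z : C, is_lim_seq (fun j => Re (u j n)) (Re z) /\ is_lim_seq (fun j => Im (u j n)) (Im z)).
{ intros n.
  assert (Hc : forall e, 0 < e -> exists J, forall i j, (J <= i)%nat -> (J <= j)%nat -> Cmod (u i n - u j n) < e).
  { intros e He. assert (He2 : 0 < e ^ 2 * nu n / 2).
    { apply Rdiv_lt_0_compat; [|lra]. apply Rmult_lt_0_compat; auto. now apply pow_lt. }
    apply is_lim_seq_spec in Heps. destruct (Heps (mkposreal _ He2)) as (J & HJ). simpl in HJ.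
    exists J. intros i j Hi Hj. pose proof (HJ i Hi) as H1. pose proof (HJ j Hj) as H2.
    rewrite Rminus_0_r in H1, H2. apply Rabs_def2 in H1. apply Rabs_def2 in H2.
    pose proof (Hrs i j (S n)) as H3.
    pose proof (rsum_single (fun n => Cmod (u i n - u j n)%C ^ 2 * nu n) (S n) n (le_n _)) as H4.
    cbv beta in H4. pose proof (H4 (fun k _ => sq_term_pos (fun n => u i n - u j n)%C k)) as H5.
    assert (H6 : Cmod (u i n - u j n) ^ 2 * nu n < e ^ 2 * nu n) by lra.
    apply Rmult_lt_reg_r in H6; auto.
    apply Rnot_le_lt. intros H7.
    assert (e ^ 2 <= Cmod (u i n - u j n) ^ 2) by (apply pow_incr; lra). lra. }
  assert (Hlim : forall f : C -> R, (forall z w, Rabs (f z - f w) <= Cmod (z - w)) ->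
     exists l, is_lim_seq (fun j => f (u j n)) (Finite l)).
  { intros f Hf. destruct (Rcomplete.R_complete (fun j => f (u j n))) as (l & Hl).
    - intros e He. destruct (Hc e He) as (J & HJ). exists J. intros i j Hi Hj.
      eapply Rle_lt_trans; [apply Hf|]. now apply HJ.
    - exists l. now apply is_lim_seq_Reals. }
  destruct (Hlim Re) as (l1 & H1).
  { intros z w. replace (Re z - Re w) with (Re (z - w)%C) by (unfold Re; simpl; ring). apply re_le_Cmod. }
  destruct (Hlim Im) as (l2 & H2).
  { intros z w. replace (Im z - Im w) with (Im (z - w)%C) by (unfold Im; simpl; ring). apply im_le_Cmod. }
  exists (l1, l2). split; auto. }
destruct (functional_choice _ _ _ Hcoord) as (x & Hx).
assert (Hterm : forall i n, is_lim_seq (fun j => Cmod (u i n - u j n)%C ^ 2 * nu n) (Cmod (u i n - x n)%C ^ 2 * nu n)).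
{ intros i n. destruct (Hx n) as [H1 H2].
  apply (is_lim_seq_ext (fun j => ((Re (u i n) - Re (u j n)) * (Re (u i n) - Re (u j n))
      + (Im (u i n) - Im (u j n)) * (Im (u i n) - Im (u j n))) * nu n)).
  { intros j. rewrite Cmod2_alt. unfold Re, Im; simpl. ring. }
  replace (Cmod (u i n - x n)%C ^ 2 * nu n) with (((Re (u i n) - Re (x n)) * (Re (u i n) - Re (x n))
      + (Im (u i n) - Im (x n)) * (Im (u i n) - Im (x n))) * nu n).
  2:{ rewrite Cmod2_alt. unfold Re, Im; simpl. ring. }
  assert (L1 : is_lim_seq (fun j => Re (u i n) - Re (u j n)) (Re (u i n) - Re (x n)))
    by (apply is_lim_seq_minus'; auto; apply is_lim_seq_const).
  assert (L2 : is_lim_seq (fun j => Im (u i n) - Im (u j n)) (Im (u i n) - Im (x n)))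
    by (apply is_lim_seq_minus'; auto; apply is_lim_seq_const).
  apply is_lim_seq_mult'; [|apply is_lim_seq_const].
  apply is_lim_seq_plus'; now apply is_lim_seq_mult'. }
assert (Hfat : forall i m, rsum (fun n => Cmod (u i n - x n)%C ^ 2 * nu n) m <= eps i).
{ intros i m.
  pose proof (is_lim_seq_rsum (fun j n => Cmod (u i n - u j n)%C ^ 2 * nu n) _ m (Hterm i)) as Hl.
  assert (Hr : is_lim_seq (fun j => eps i + eps j) (eps i + 0))
    by (apply is_lim_seq_plus'; auto; apply is_lim_seq_const).
  rewrite Rplus_0_r in Hr.
  exact (is_lim_seq_le _ _ (Finite _) (Finite _) (fun j => Hrs i j m) Hl Hr). }
assert (Hb : forall i, L2 nu (fun n => u i n - x n)%C /\ sqnorm nu (fun n => u i n - x n)%C <= eps i).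
{ intros i. apply bounded_partial_sums; auto. intros n. exact (sq_term_pos (fun n => u i n - x n)%C n). }
exists x. split; [|apply Hb].
apply (L2_ext nu (fun n => u O n - (u O n - x n))%C); [intros; ring|].
apply L2_minus; auto. apply Hb.
Qed.

(** The projection theorem: let [y i] in the span be such that the norm of [x -
    y i] tends to its infimum. By the parallelogram law the differences [x - y
    i] converge, and their limit is orthogonal to [P], hence 0. *)
Lemma closed_span_total (P : (nat -> C) -> Prop) : (forall y, P y -> L2 nu y) ->
  (forall x, L2 nu x -> (forall y, P y -> inner nu y x = 0) -> x = (fun _ => RtoC 0)) ->
  forall x, L2 nu x -> closed_span nu P x.
Proof.
intros HP Htot x Hx. split; auto.
set (E := fun v => exists y, span P y /\ v = - sqnorm nu (fun n => x n - y n)%C).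
destruct (completeness E) as (d' & Hub & Hlub).
{ exists 0. intros v (y & Hy & ->).
  assert (0 <= sqnorm nu (fun n => x n - y n)%C); [|lra].
  apply sqnorm_pos, L2_minus; auto. now apply (span_L2 nu P). }
{ eexists. exists (fun _ => RtoC 0). split; [apply span_0|reflexivity]. }
set (d := - d').
assert (Hd : forall y, span P y -> d <= sqnorm nu (fun n => x n - y n)%C).
{ intros y Hy. specialize (Hub (- sqnorm nu (fun n => x n - y n)%C)).
  assert (- sqnorm nu (fun n => x n - y n)%C <= d'); [|unfold d; lra]. apply Hub. now exists y. }
assert (Hnear : forall i, exists y, span P y /\ sqnorm nu (fun n => x n - y n)%C <= d + / (INR i + 1)).
{ intros i. apply NNPP. intros Hno.
  assert (Hi : 0 < / (INR i + 1)) by (apply Rinv_0_lt_compat; pose proof (pos_INR i); lra).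
  assert (d' <= d' - / (INR i + 1)); [|lra]. apply Hlub. intros v (y & Hy & ->).
  apply Rnot_lt_le. intros Hlt. apply Hno. exists y. split; auto. unfold d. lra. }
destruct (functional_choice _ _ _ Hnear) as (y & Hy).
set (u := fun i n => (x n - y i n)%C).
assert (Hyl : forall i, L2 nu (y i)) by (intros i; apply (span_L2 nu P); auto; apply Hy).
assert (Hu : forall i, L2 nu (u i)) by (intros i; apply L2_minus; auto).
set (eps := fun i => 2 * / (INR i + 1)).
assert (Heps : is_lim_seq eps 0).
{ replace (Finite 0) with (Rbar_mult 2 0) by (simpl; f_equal; ring).
  apply is_lim_seq_scal_l.
  apply (is_lim_seq_ext (fun i => / INR (S i))); [intros; now rewrite S_INR|].
  apply (is_lim_seq_incr_1 (fun i => / INR i)).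
  replace (Finite 0) with (Rbar_inv p_infty) by reflexivity.
  apply is_lim_seq_inv; [apply is_lim_seq_INR|discriminate]. }
destruct (L2_complete u eps Hu Heps) as (w & Hw & Huw).
{ intros i j. rewrite parallelogram by auto.
  assert (Hm : d <= sqnorm nu (fun n => / 2 * (u i n + u j n))%C).
  { rewrite (sqnorm_ext _ (fun n => x n - (/ 2 * y i n + / 2 * y j n))%C).
    - apply Hd. apply (span_plus P (fun n => / 2 * y i n)%C (fun n => / 2 * y j n)%C);
        apply span_scal; apply Hy.
    - intros n. unfold u. field. }
  destruct (Hy i) as [_ Hi]. destruct (Hy j) as [_ Hj]. fold (u i) in Hi. fold (u j) in Hj.
  unfold eps. lra. }
assert (Hw0 : w = (fun _ => RtoC 0)).
{ apply Htot; auto. intros v Hv. specialize (HP v Hv). rewrite inner_conj.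
  replace (RtoC 0) with (Cconj 0) by apply Cconj_RtoC. f_equal.
  apply Cmod_eq_0, Rle_antisym; [|apply Cmod_ge_0]. apply Rnot_lt_le. intros Hpos.
  pose proof (sqnorm_pos v HP) as Hv0.
  assert (Hi : forall i, (Cmod (inner nu w v)) ^ 2 <= 4 * (eps i * (sqnorm nu v + 1))).
  { intros i.
    assert (A1 : Cmod (inner nu (u i) v) ^ 2 <= eps i * (sqnorm nu v + 1)).
    { eapply Rle_trans; [apply (almost_orthogonal (u i) v d); auto|].
      - intros c. rewrite (sqnorm_ext _ (fun n => x n - (y i n + c * v n))%C).
        + apply Hd. apply (span_plus P (y i) (fun n => c * v n)%C); [apply Hy|].
          apply span_scal. now apply span_mem.
        + intros n. unfold u. ring.
      - apply Rmult_le_compat_r; [lra|]. destruct (Hy i) as [_ Hi]. fold (u i) in Hi. unfold eps.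
        assert (0 < / (INR i + 1)) by (apply Rinv_0_lt_compat; pose proof (pos_INR i); lra). lra. }
    assert (A2 : Cmod (inner nu (fun n => u i n - w n)%C v) ^ 2 <= eps i * (sqnorm nu v + 1)).
    { eapply Rle_trans; [apply (almost_orthogonal _ v 0); auto using L2_minus|].
      - intros c. apply sqnorm_pos. apply L2_minus; [now apply L2_minus|]. now apply L2_scal.
      - apply Rmult_le_compat_r; [lra|]. specialize (Huw i). lra. }
    assert (A3 : inner nu w v = (inner nu (u i) v - inner nu (fun n => u i n - w n)%C v)%C).
    { replace (inner nu (fun n => u i n - w n)%C v) with (inner nu (u i) v + (- (1)) * inner nu w v)%C; [ring|].
      rewrite <- inner_scal_l, <- inner_plus_l by (auto; now apply L2_scal).
      apply CSeries_ext. intros n. ring. }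
    rewrite A3. pose proof (Cmod_minus_le (inner nu (u i) v) (inner nu (fun n => u i n - w n)%C v)) as T.
    revert T A1 A2. generalize (Cmod_ge_0 (inner nu (u i) v - inner nu (fun n => u i n - w n)%C v)).
    generalize (Cmod (inner nu (u i) v - inner nu (fun n => u i n - w n)%C v)).
    generalize (Cmod (inner nu (u i) v)) (Cmod (inner nu (fun n => u i n - w n)%C v)).
    intros p q r0 Hr0 T A1 A2. pose proof (pow2_ge_0 (p - q)).
    assert (r0 ^ 2 <= (p + q) ^ 2) by (apply pow_incr; lra). nra. }
  assert (Hlim : is_lim_seq (fun i => 4 * (eps i * (sqnorm nu v + 1))) (4 * (0 * (sqnorm nu v + 1)))).
  { apply is_lim_seq_mult'; [apply is_lim_seq_const|]. apply is_lim_seq_mult'; auto. apply is_lim_seq_const. }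
  pose proof (is_lim_seq_le _ _ (Finite _) (Finite _) Hi (is_lim_seq_const _) Hlim) as Hle. simpl in Hle.
  assert (0 < Cmod (inner nu w v) ^ 2) by (now apply pow_lt). simpl in H. lra. }
intros e He. apply is_lim_seq_spec in Heps.
assert (He2 : 0 < e ^ 2) by (now apply pow_lt).
destruct (Heps (mkposreal _ He2)) as (J & HJ). specialize (HJ J (le_n _)). simpl in HJ.
rewrite Rminus_0_r in HJ. apply Rabs_def2 in HJ as [HJ _].
exists (y J). split; [apply Hy|].
assert (HuJ : sqnorm nu (u J) <= eps J).
{ eapply Rle_trans; [|apply (Huw J)]. right. apply sqnorm_ext. intros n. rewrite Hw0. ring. }
unfold L2norm. change (Series _) with (sqnorm nu (u J)).
rewrite <- (sqrt_square e) by lra. apply sqrt_lt_1_alt. split; [now apply sqnorm_pos|].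
eapply Rle_lt_trans; [exact HuJ|]. simpl in HJ. lra.
Qed.

Lemma closed_span_incl (P : (nat -> C) -> Prop) x : (forall y, P y -> L2 nu y) -> P x -> closed_span nu P x.
Proof.
intros HP Hx. split; auto. intros e He. exists x. split; [now apply span_mem|].
unfold L2norm. rewrite (Series_ext _ (fun n => 0 * 0)).
- rewrite Series_scal_l, Rmult_0_l, sqrt_0. exact He.
- intros n. replace (x n - x n)%C with (RtoC 0) by ring. rewrite Cmod_0. ring.
Qed.
End Hilbert.

(** The sequences [f j] need not belong to [P]; a spanning family inside [P] is
    found by eliminating the last coefficient with one element of [P] where it
    is not 0. *)
Lemma dim_le_of_form N : forall (P : (nat -> C) -> Prop) (f : nat -> nat -> C),
  (forall x y, P x -> P y -> P (fun n => x n + y n)%C) ->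
  (forall c x, P x -> P (fun n => c * x n)%C) ->
  (forall x, P x -> exists q : nat -> C, forall n, x n = csum (fun j => q j * f j n)%C N) ->
  dim_le P N.
Proof.
induction N as [|N IH]; intros P f Hplus Hscal Hform.
- exists nil. split; [auto|]. split; [constructor|]. intros x Hx.
  destruct (Hform x Hx) as (q & Hq). exists nil. split; [constructor|]. exact Hq.
- set (P' := fun x => P x /\ exists q : nat -> C, forall n, x n = csum (fun j => q j * f j n)%C N).
  assert (HP' : dim_le P' N).
  { apply (IH P' f).
    - intros x y [Hx (q & Hq)] [Hy (q' & Hq')]. split; auto. exists (fun j => q j + q' j)%C.
      intros n. rewrite Hq, Hq', <- csum_plus. apply csum_ext. intros; ring.
    - intros c x [Hx (q & Hq)]. split; auto. exists (fun j => c * q j)%C.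
      intros n. rewrite Hq, <- csum_scal. apply csum_ext. intros; ring.
    - intros x [_ H]. exact H. }
  destruct HP' as (vs & Hlen & Hvs & Hsp).
  destruct (classic (exists x0 q0, P x0 /\ q0 N <> RtoC 0 /\ forall n, x0 n = csum (fun j => q0 j * f j n)%C (S N)))
    as [(x0 & q0 & Hx0 & Hq0 & E0)|Hno].
  + exists (x0 :: vs). split; [simpl; lia|]. split.
    { constructor; auto. eapply Forall_impl; [|exact Hvs]. intros v Hv. apply Hv. }
    intros x Hx. destruct (Hform x Hx) as (q & Hq).
    set (k := (q N / q0 N)%C).
    assert (Hin : P' (fun n => x n + (- k) * x0 n)%C).
    { split; [apply (Hplus x (fun n => (- k) * x0 n)%C); auto|].
      exists (fun j => q j + (- k) * q0 j)%C. intros n. rewrite Hq, E0. simpl.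
      rewrite (csum_ext (fun j => (q j + - k * q0 j) * f j n)%C
         (fun j => q j * f j n + (- k) * (q0 j * f j n))%C) by (intros; ring).
      rewrite csum_plus, csum_scal. unfold k. field. auto. }
    destruct (Hsp _ Hin) as (l & Hl & El).
    exists ((k, x0) :: l). split.
    * constructor; [now left|]. eapply Forall_impl; [|exact Hl]. intros cv Hcv. now right.
    * intros n. change (lin_comb ((k, x0) :: l) n) with (k * x0 n + lin_comb l n)%C.
      rewrite <- El. ring.
  + exists vs. split; [lia|]. split.
    { eapply Forall_impl; [|exact Hvs]. intros v Hv. apply Hv. }
    intros x Hx. apply Hsp. split; auto. destruct (Hform x Hx) as (q & Hq).
    exists q. intros n. rewrite Hq. simpl.
    assert (E : q N = 0).
    { apply NNPP. intros Hne. apply Hno. now exists x, q. }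
    rewrite E. ring.
Qed.

(** * Completeness of the perturbation and of its adjoint *)

Lemma generalized_L2 nu U y : generalized_eigenvector nu U y -> L2 nu y.
Proof. now intros [H _]. Qed.

Lemma root_vector_completeness (s : nat -> C) (nu : nat -> R) (a b : nat -> C) (P : nat) :
  perturbation_data s nu a b -> (1 <= P)%nat -> ex_series (fun n => Cmod (s n) ^ P) ->
  let L := rank_one_perturbation nu s a b in
  (abs_moment_finite nu s a b 1 -> moment nu s a b 1 <> RtoC (-1) -> complete nu L) /\
  (forall N, (1 <= N)%nat -> degenerate_moments nu s a b N ->
     dim_le (orthogonal_complement nu (eigen_closure nu L)) N /\
     (~ in_zL2' nu s a b -> complete nu L)).
Proof.
intros D HP HSP L. pose proof (pd_nu _ _ _ _ D) as Hnu.
assert (Htot : (forall x, orthogonal_to_roots s nu a b x -> x = (fun _ => RtoC 0)) -> complete nu L).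
{ intros H x Hx. apply closed_span_total; auto.
  - intros y. apply generalized_L2.
  - intros y Hy Ho. apply H. now split. }
split.
- intros H1 Hm. apply Htot. now apply (orthogonal_trivial_nondegenerate s nu a b D P).
- intros N HN Hdeg. split.
  + apply (dim_le_of_form N _ (fun j => kernel_model s b (S j))).
    * intros x y [Hx Hx'] [Hy Hy']. split; [now apply L2_plus|]. intros z Hz.
      rewrite inner_plus_l, Hx', Hy'; auto; [ring|apply Hz].
    * intros c x [Hx Hx']. split; [now apply L2_scal|]. intros z Hz.
      rewrite inner_scal_l, Hx'; auto; [ring|apply Hz].
    * intros x [Hx Hx']. apply (orthogonal_form_degenerate s nu a b D P HP HSP N HN Hdeg).
      split; auto. intros y Hy. rewrite inner_conj, Hx'; [apply Cconj_RtoC|].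
      apply closed_span_incl; auto. intros z. apply generalized_L2.
  + intros Hz. apply Htot. now apply (orthogonal_trivial_degenerate s nu a b D P HP HSP N).
Qed.

Lemma perturbation_data_adjoint s nu a b : perturbation_data s nu a b ->
  perturbation_data (fun n => Cconj (s n)) nu b a.
Proof.
intros D. constructor; try apply D.
- intros n E. apply (pd_nonzero _ _ _ _ D n). now apply Cconj_eq_0.
- intros m n E. apply (pd_inj _ _ _ _ D). now rewrite <- (Cconj_conj (s m)), E, Cconj_conj.
- intros e He. destruct (pd_null _ _ _ _ D e He) as (K & HK). exists K. intros n Hn.
  rewrite Cmod_conj. now apply HK.
Qed.

Section Conjugate.
Context (s : nat -> C) (nu : nat -> R) (a b : nat -> C) (Hs : forall n, s n <> 0).
Let sc n := Cconj (s n).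

Lemma Cmod_inv_conj n : Cmod (/ sc n) = Cmod (/ s n).
Proof. unfold sc. rewrite <- Cinv_conj by auto. apply Cmod_conj. Qed.

Lemma abs_moment_adjoint k : abs_moment_finite nu s a b k -> abs_moment_finite nu sc b a k.
Proof. apply ex_series_Rext. intros n. rewrite Cmod_inv_conj, (Cmult_comm (b n)). reflexivity. Qed.

Lemma moment_adjoint k : moment nu sc b a k = Cconj (moment nu s a b k).
Proof.
unfold moment. rewrite <- CSeries_conj. apply CSeries_ext. intros n.
rewrite !Cmult_conj, Cpow_conj, Cinv_conj, Cconj_conj, Cconj_RtoC by auto. unfold sc. ring.
Qed.

Lemma Cconj_inj x y : Cconj x = Cconj y -> x = y.
Proof. intros H. now rewrite <- (Cconj_conj x), H, Cconj_conj. Qed.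

Lemma degenerate_moments_adjoint N : degenerate_moments nu s a b N -> degenerate_moments nu sc b a N.
Proof.
intros (H1 & H2 & H3 & H4). split; [|split; [|split]].
- now apply abs_moment_adjoint.
- rewrite moment_adjoint, H2. apply Cconj_RtoC.
- intros k Hk. rewrite moment_adjoint, H3 by auto. apply Cconj_RtoC.
- rewrite moment_adjoint. intros E. apply H4. now apply Cconj_eq_0.
Qed.

Lemma in_zL2_adjoint : in_zL2' nu sc b a -> in_zL2' nu s b a.
Proof. apply ex_series_Rext. intros n. rewrite Cmod_inv_conj. reflexivity. Qed.
End Conjugate.

Lemma adjoint_unique nu U V V' : (forall n, 0 < nu n) -> is_adjoint nu U V -> is_adjoint nu U V' ->
  forall y, L2 nu y -> V' y = V y.
Proof.
intros Hnu [_ H] [_ H'] y Hy. apply functional_extensionality. intros n.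
pose proof (H (delta n) y (L2_delta nu n) Hy) as E.
rewrite (H' (delta n) y (L2_delta nu n) Hy), !inner_delta_l in E.
assert (Hn : RtoC (nu n) <> 0) by (apply RtoC_neq_0; specialize (Hnu n); lra).
apply Cconj_inj. apply (f_equal (fun w => w * / nu n)%C) in E.
replace (Cconj (V' y n)) with (Cconj (V' y n) * nu n * / nu n)%C by (field; auto).
rewrite E. field. auto.
Qed.

(** An adjoint is determined on [L2] only, which is enough for its root vectors.
    *)
Lemma generalized_eigenvector_L2_ext nu U U' : (forall n, 0 < nu n) -> maps_L2 nu U ->
  (forall y, L2 nu y -> U' y = U y) -> generalized_eigenvector nu U' = generalized_eigenvector nu U.
Proof.
intros Hnu HU HE. apply functional_extensionality. intros x. apply propositional_extensionality.
assert (Hiter : forall lambda m, L2 nu x ->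
   Nat.iter m (shift_op U' lambda) x = Nat.iter m (shift_op U lambda) x).
{ intros lambda m Hx. induction m as [|m IH]; auto. simpl. rewrite IH. unfold shift_op at 1.
  rewrite HE; auto. now apply iter_shift_op_L2. }
split; intros [Hx (lambda & m & H)]; split; auto; exists lambda, m; intros n; specialize (H n);
  specialize (Hiter lambda m Hx); apply (f_equal (fun f => f n)) in Hiter.
- exact (eq_trans (eq_sym Hiter) H).
- exact (eq_trans Hiter H).
Qed.

Lemma Ctends_0_filterlim s : filterlim s eventually (locally (RtoC 0)) -> Ctends_0 s.
Proof.
intros H e He. assert (He2 : 0 < e / 2) by lra.
assert (Hl : locally (RtoC 0) (fun z : C => Cmod z < e)).
{ exists (mkposreal _ He2). intros [x y] [Hx Hy].
  change (Rabs (x - 0) < e / 2) in Hx. change (Rabs (y - 0) < e / 2) in Hy.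
  rewrite Rminus_0_r in Hx, Hy. eapply Rle_lt_trans; [apply Cmod_2Rmax|]. simpl.
  assert (S2 : sqrt 2 < 2).
  { rewrite <- (sqrt_square 2) at 2 by lra. apply sqrt_lt_1_alt. lra. }
  pose proof (Rmax_lub_lt _ _ _ Hx Hy).
  pose proof (Rle_trans _ _ _ (Rabs_pos x) (Rmax_l (Rabs x) (Rabs y))).
  apply Rle_lt_trans with (2 * Rmax (Rabs x) (Rabs y)); [|lra].
  apply Rmult_le_compat_r; lra. }
destruct (H _ Hl) as (K & HK). now exists K.
Qed.

(** Since [s] is bounded the exponent may be increased; an integer makes the
    later bounds polynomials. *)
Lemma Schatten_integer_exponent (s : nat -> C) : (forall n, s n <> 0) -> Ctends_0 s ->
  (exists p, 0 < p /\ mul_op_in_Schatten s p) ->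
  exists P, (1 <= P)%nat /\ ex_series (fun n => Cmod (s n) ^ P).
Proof.
intros Hs H0 (p & Hp & HS). destruct (INR_unbounded p) as (P & HP).
assert (HP1 : (1 <= P)%nat) by (destruct P; [simpl in HP; lra|lia]).
exists P. split; auto. destruct (Ctends_0_bounded s H0) as (M & HM & HsM).
apply ex_series_pos_le with (fun n => Rpower M (INR P - p) * Rpower (Cmod (s n)) p).
- intros n. pose proof (proj1 (Cmod_gt_0 (s n)) (Hs n)) as Hn. split; [apply pow_le; lra|].
  rewrite <- Rpower_pow by auto. replace (INR P) with ((INR P - p) + p) at 1 by ring.
  rewrite Rpower_plus. apply Rmult_le_compat_r; [left; apply exp_pos|].
  apply Rle_Rpower_l; [lra|]. split; auto.
- now apply ex_series_Rscal.
Qed.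

Theorem theorem2p1 :
  forall (s : nat -> C) (nu : nat -> R) (a b : nat -> C)
         (Lstar : (nat -> C) -> (nat -> C)),
  (forall n, s n <> RtoC 0) ->
  (forall m n, s m = s n -> m = n) ->
  filterlim s eventually (locally (RtoC 0)) ->
  (forall n, 0 < nu n) ->
  ex_series nu ->
  (exists p : R, 0 < p /\ mul_op_in_Schatten s p) ->
  L2 nu a ->
  L2 nu b ->
  is_adjoint nu (rank_one_perturbation nu s a b) Lstar ->
  (abs_moment_finite nu s a b 1 ->
   moment nu s a b 1 <> RtoC (-1) ->
   complete nu (rank_one_perturbation nu s a b) /\ complete nu Lstar)
  /\
  (forall N : nat, (1 <= N)%nat ->
   degenerate_moments nu s a b N ->
   dim_le (orthogonal_complement nu
             (eigen_closure nu (rank_one_perturbation nu s a b))) N /\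
   dim_le (orthogonal_complement nu (eigen_closure nu Lstar)) N)
  /\
  (forall N : nat, (1 <= N)%nat ->
   degenerate_moments nu s a b N ->
   (~ in_zL2' nu s a b -> complete nu (rank_one_perturbation nu s a b)) /\
   (~ in_zL2' nu s b a -> complete nu Lstar)).
Proof.
intros s nu a b Lstar Hs Hinj Hlim Hnu _ HS Ha Hb Hadj.
pose proof (Ctends_0_filterlim s Hlim) as H0.
destruct (Schatten_integer_exponent s Hs H0 HS) as (P & HP & HSP).
assert (D : perturbation_data s nu a b) by (constructor; auto).
pose proof (perturbation_data_adjoint s nu a b D) as D'.
assert (HSP' : ex_series (fun n => Cmod (Cconj (s n)) ^ P)).
{ revert HSP. apply ex_series_Rext. intros n. now rewrite Cmod_conj. }
assert (HM : exists M, forall n, Cmod (s n) <= M).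
{ destruct (Ctends_0_bounded s H0) as (M & _ & HM). now exists M. }
pose proof (is_adjoint_rank_one_perturbation nu s a b Hnu HM Ha Hb) as HV.
assert (HG : generalized_eigenvector nu Lstar
   = generalized_eigenvector nu (rank_one_perturbation nu (fun n => Cconj (s n)) b a)).
{ apply generalized_eigenvector_L2_ext; auto; [apply HV|].
  intros y Hy. now apply (adjoint_unique nu (rank_one_perturbation nu s a b)). }
unfold complete, eigen_closure. rewrite HG.
destruct (root_vector_completeness s nu a b P D HP HSP) as [A1 A2].
(* The adjoint is the perturbation attached to the conjugate data. *)
destruct (root_vector_completeness _ nu b a P D' HP HSP') as [B1 B2].
split; [|split].
- intros H1 Hm. split; [now apply A1|]. apply B1; [now apply abs_moment_adjoint|].
  rewrite moment_adjoint by auto. intros E. apply Hm. apply Cconj_inj. rewrite E.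
  symmetry. apply Cconj_RtoC.
- intros N HN Hdeg. split; [now apply A2|]. apply B2; auto. now apply degenerate_moments_adjoint.
- intros N HN Hdeg. destruct (A2 N HN Hdeg) as [_ A3].
  destruct (B2 N HN (degenerate_moments_adjoint s nu a b Hs N Hdeg)) as [_ B3].
  split; [exact A3|]. intros Hz. apply B3. intros Hz'. apply Hz.
  now apply (in_zL2_adjoint s nu a b Hs).
Qed.
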